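(* Let $k\in\mathbb{N}_0$, $\beta\in\mathbb{C}$, and let $\alpha,\gamma>-1$ be real numbers such that if $\alpha,\gamma\in(-1,0)$ then $\alpha+\gamma+1\neq0$. Let $\rho\in(0,1)$ and, for $x\in[-1,1]$, put $R:=\sqrt{1+\rho^2-2\rho x}$. Then $$\int_{-1}^1\frac{(1-x)^{\alpha/2}(1+x)^\gamma}{R^{\beta+1}}\,\mathrm{P}_\beta^{-\alpha}\!\left(\frac{1-\rho}{R}\right)P_k^{(\alpha,\gamma)}(x)\,dx=\frac{2^{\gamma+\alpha/2+1}\,\Gamma(\gamma+k+1)\,(\alpha+\beta+1)_{2k}}{(1+\rho)^{\beta-\gamma}\,\rho^{(\gamma+1)/2}\,k!}\,\mathrm{P}_{\gamma-\beta}^{-\gamma-\alpha-2k-1}\!\left(\frac{1-\rho}{1+\rho}\right).$$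
   Context: $\mathbb{N}_0=\{0,1,2,\dots\}$. $(z)_n:=\prod_{i=1}^n(z+i-1)$ is the Pochhammer symbol. The Jacobi polynomials are $P_n^{(\alpha,\beta)}(z):=\frac{(\alpha+1)_n}{n!}\,{}_2F_1\left(-n,n+\alpha+\beta+1;\alpha+1;\frac{1-z}{2}\right)$. The Ferrers function of the first kind (associated Legendre function on the cut) $\mathrm{P}_\nu^\mu:(-1,1)\to\mathbb{C}$ (upright $\mathrm{P}$) is $$\mathrm{P}_\nu^\mu(t):=\frac{1}{\Gamma(1-\mu)}\left(\frac{1+t}{1-t}\right)^{\mu/2}{}_2F_1\!\left(-\nu,\nu+1;1-\mu;\frac{1-t}{2}\right),$$ where ${}_2F_1$ is the Gauss hypergeometric function. *)

(* Defs.v *)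
(* Stdlib real numbers, with Coquelicot for C, series and integrals *)
From Stdlib Require Import Reals ZArith Factorial.
From Coquelicot Require Import Coquelicot.

Open Scope R_scope.

Definition Cexp (z : C) : C := (exp (Re z) * cos (Im z), exp (Re z) * sin (Im z)).

(* Principal power a^z of a base a > 0; not meaningful for a <= 0. *)
Definition cpow (a : R) (z : C) : C := Cexp (z * ln a)%C.

Definition CSeries (u : nat -> C) : C :=
  (Series (fun n => Re (u n)), Series (fun n => Im (u n))).

(* (z)_n = z (z + 1) ... (z + n - 1) *)
Fixpoint pochhammer (z : C) (n : nat) : C :=
  match n with
  | O => 1%C
  | S m => (pochhammer z m * (z + INR m))%C
  end.

Definition Gamma_Euler (z : C) : C :=
  RInt_gen (V := C_R_CompleteNormedModule)
    (fun t : R => (cpow t (z - 1) * exp (- t))%C)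
    (at_right 0) (Rbar_locally p_infty).

(* Euler's integral converges for Re z > 0 only. In general it is evaluated at
   z + n, where n is a natural number with Re z + n > 0 (and n = 0 if
   Re z > 0), and continued by Gamma (z + n) = (z)_n Gamma z. At the poles
   z = 0, -1, -2, ... the convention / 0 = 0 gives Gamma z = 0, hence also
   / Gamma z = 0, which is the correct value of the reciprocal. *)
Definition Gamma (z : C) : C :=
  let n := Z.to_nat (up (- Re z)) in
  (Gamma_Euler (z + INR n) / pochhammer z n)%C.

(* Sum of the Gauss series: meaningful when c is not in {0, -1, -2, ...} and
   either |z| < 1 or the series terminates. *)
Definition hyp2F1 (a b c z : C) : C :=
  CSeries (fun n =>
    (pochhammer a n * pochhammer b n / (pochhammer c n * INR (fact n)) * z ^ n)%C).

Definition jacobi (n : nat) (alpha beta z : C) : C :=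
  (pochhammer (alpha + 1) n / INR (fact n)
   * hyp2F1 (- INR n) (INR n + alpha + beta + 1) (alpha + 1) ((1 - z) / 2))%C.

(* Ferrers function of the first kind of degree nu and order mu, -1 < t < 1. *)
Definition ferrersP (nu mu : C) (t : R) : C :=
  (/ Gamma (1 - mu) * cpow ((1 + t) / (1 - t)) (mu / 2)
   * hyp2F1 (- nu) (nu + 1) (1 - mu) ((1 - t) / 2))%C.

(* Main.v *)
Require Import Defs.
From Stdlib Require Import Reals Factorial Lra Lia.
From Coquelicot Require Import Coquelicot.

Open Scope R_scope.

(** Put [y = (1 - x) / 2], [c = alpha + 1], [d = gamma + 1],
    [zeta = 4 rho / (1 + rho)^2] and [t = (1 - rho) / dist x].  A quadratic
    transformation rewrites the Ferrers function as an elementary factor times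
    [F(a, b; c; 1 - t^2)], where [a = (c + beta) / 2], [b = (c - beta - 1) / 2]
    and [1 - t^2 = zeta y / (1 - zeta (1 - y))] ([quadratic_transformation],
    [ferrersP_quadratic]).  The two half powers of [1 - x] combine, and the
    integrand becomes a constant times
<<
      y^(c-1) (1-y)^(d-1) P_k(1 - 2 y)
        (1 - zeta (1-y))^(-a) F(a, b; c; zeta y / (1 - zeta (1-y))).
>>
    Expanding the last two factors and collecting the terms of equal degree in
    [zeta] gives
<<
      sum over N of  (a)_N / N! zeta^N B_N(y),
      B_N(y) = sum over n of  binom(N, n) (b)_n / (c)_n y^n (1-y)^(N-n),
>>
    which converges uniformly on the whole interval [0 <= y <= 1] because
    [zeta < 1] and the Bernstein coefficients [(b)_n / (c)_n] grow
    subexponentially ([bern_generating], [bern_bound]).  An expansion in powers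
    of [y] alone would converge only for small [rho]; this one needs no
    analytic continuation in [rho], so that the integral may be taken term by
    term ([beta_integral_series]).

    Each term is explicit.  For [k = 0] the integral of [B_N] follows by
    induction from the recurrence of [B_N] and the two recurrences of the Beta
    function ([beta_integral_bern]).  Integration by parts, with the raising
    relation [jac_raise] for the Jacobi polynomials and the fact that the
    derivative of [B_N] is a multiple of [B_(N-1)] with [c] replaced by
    [c + 1], lowers [k] by one ([beta_integral_jac_bern_S]).  The sum over [N]
    is then again a hypergeometric function with argument [zeta], and
    [ferrersP_quadratic] at [t = (1 - rho) / (1 + rho)], where
    [1 - t^2 = zeta], recognises it as the Ferrers function on the right.

    Three classical facts carry the computation.  The quadratic transformation
    holds because both sides solve one hypergeometric equation, whose solutions
    that are regular at the singular point 0 are determined by their value there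
    ([hypergeometric_ode_unique]).  The rearrangement along diagonals is
    [is_Cseries_diagonal] together with the binomial series
    [binomial_series].  Euler's relation between the Beta and Gamma functions,
    [RBeta_RGamma], is obtained by interpolating their recurrences by
    log-convexity. *)

(** * Improper integrals on an open interval *)

(** Filters shrinking to the two ends of the open interval [D], so that
    integrals over bounded and unbounded intervals are treated together. *)
Record integration_ends (D : R -> Prop) (Fa Fb : (R -> Prop) -> Prop) : Prop := {
  ends_Fa : ProperFilter Fa;
  ends_Fb : ProperFilter Fb;
  ends_convex : forall u v x, D u -> D v -> u <= x <= v -> D x;
  ends_open : forall x, D x -> locally x D;
  ends_lo : forall u, D u -> Fa (fun x => D x /\ x <= u);
  ends_hi : forall u, D u -> Fb (fun x => D x /\ u <= x);
  ends_inh : exists u, D u }.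

Lemma ends_m1_1 : integration_ends (fun x => -1 < x < 1) (at_right (-1)) (at_left 1).
Proof.
split.
- apply at_right_proper_filter.
- apply at_left_proper_filter.
- intros; lra.
- intros x Hx. apply (locally_interval _ x (-1) 1); simpl; try lra; intros; lra.
- intros u Hu. assert (Hp : 0 < u + 1) by lra.
  exists (mkposreal _ Hp). intros y Hy Hy1.
  unfold ball in Hy; simpl in Hy; unfold AbsRing_ball, abs, minus, plus, opp in Hy; simpl in Hy.
  apply Rabs_def2 in Hy. lra.
- intros u Hu. assert (Hp : 0 < 1 - u) by lra.
  exists (mkposreal _ Hp). intros y Hy Hy1.
  unfold ball in Hy; simpl in Hy; unfold AbsRing_ball, abs, minus, plus, opp in Hy; simpl in Hy.
  apply Rabs_def2 in Hy. lra.
- exists 0; lra.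
Qed.

Lemma ends_half_line : integration_ends (fun x => 0 < x) (at_right 0) (Rbar_locally p_infty).
Proof.
split.
- apply at_right_proper_filter.
- apply Rbar_locally_filter.
- intros; lra.
- intros x Hx. apply (locally_interval _ x 0 p_infty); simpl; try lra; try easy.
- intros u Hu. exists (mkposreal _ Hu). intros y Hy Hy1.
  unfold ball in Hy; simpl in Hy; unfold AbsRing_ball, abs, minus, plus, opp in Hy; simpl in Hy.
  apply Rabs_def2 in Hy. lra.
- intros u Hu. exists u. intros x Hx. lra.
- exists 1; lra.
Qed.

Lemma ends_prod D Fa Fb (I : integration_ends D Fa Fb) u v : D u -> D v ->
  filter_prod Fa Fb (fun ab => D (fst ab) /\ D (snd ab) /\ fst ab <= u /\ v <= snd ab).
Proof.
intros Hu Hv.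
apply (Filter_prod _ _ _ _ _ (ends_lo _ _ _ I u Hu) (ends_hi _ _ _ I v Hv)).
intros x y Hx Hy; simpl; tauto.
Qed.

Lemma is_RInt_gen_primitive D Fa Fb (I : integration_ends D Fa Fb) (F f : R -> R) la lb :
  (forall x, D x -> is_derive F x (f x)) -> (forall x, D x -> continuous f x) ->
  filterlim F Fa (locally la) -> filterlim F Fb (locally lb) ->
  is_RInt_gen f Fa Fb (lb - la).
Proof.
intros HF Hf Ha Hb P HP.
destruct (ends_Fa _ _ _ I) as [_ FFa]. destruct (ends_Fb _ _ _ I) as [_ FFb].
destruct (ends_inh _ _ _ I) as [m Hm].
unfold filtermapi.
assert (HL : filterlim (fun ab : R * R => F (snd ab) - F (fst ab)) (filter_prod Fa Fb) (locally (lb - la))).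
{ apply (filterlim_comp_2 (G := locally lb) (H := locally (opp la)) (fun ab : R*R => F (snd ab)) (fun ab : R * R => opp (F (fst ab))) plus).
  - apply (filterlim_comp _ _ _ (fun ab : R*R => snd ab) F _ Fb); auto. apply filterlim_snd.
  - apply (filterlim_comp _ _ _ (fun ab : R*R => F (fst ab)) opp _ (locally la)); [|apply (filterlim_opp (V := R_NormedModule) la)].
    apply (filterlim_comp _ _ _ (fun ab : R*R => fst ab) F _ Fa); auto. apply filterlim_fst.
  - apply (filterlim_plus (V := R_NormedModule) lb (opp la)). }
specialize (HL P HP). unfold filtermap in HL.
generalize (filter_and _ _ HL (ends_prod _ _ _ I m m Hm Hm)).
apply filter_imp. intros [a b] [H1 H2]; simpl in *.
exists (F b - F a). split; auto.
apply (is_RInt_derive F f a b); intros x Hx; rewrite Rmin_left, Rmax_right in Hx by lra.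
apply HF. apply (ends_convex _ _ _ I a b); tauto.
apply Hf. apply (ends_convex _ _ _ I a b); tauto.
Qed.

Lemma is_RInt_zero (a b : R) : is_RInt (fun _ : R => 0) a b 0.
Proof.
assert (H := is_RInt_const a b (0 : R_NormedModule)).
unfold scal in H; simpl in H; unfold mult in H; simpl in H. now rewrite Rmult_0_r in H.
Qed.

(** The pieces left over at both ends contribute nonnegative amounts. *)
Lemma is_RInt_gen_ge_sub D Fa Fb (I : integration_ends D Fa Fb) (f : R -> R) l u v lf :
  D u -> D v -> u <= v -> (forall x, D x -> 0 <= f x) -> (forall x, D x -> continuous f x) ->
  is_RInt_gen f Fa Fb l -> is_RInt f u v lf -> lf <= l.
Proof.
intros Hu Hv Huv Hpos Hf Hl Huvf.
destruct (ends_Fa _ _ _ I) as [EFa FFa]. destruct (ends_Fb _ _ _ I) as [EFb FFb].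
destruct (Rle_lt_dec lf l) as [|Hlt]; auto. exfalso.
assert (HP : locally l (fun y => y < lf)).
{ apply (locally_interval _ l m_infty lf); simpl; auto. }
specialize (Hl _ HP). unfold filtermapi in Hl.
generalize (filter_and _ _ Hl (ends_prod _ _ _ I u v Hu Hv)). intros H.
assert (PF : ProperFilter (filter_prod Fa Fb)) by (assert (P1 := ends_Fa _ _ _ I); assert (P2 := ends_Fb _ _ _ I); apply filter_prod_proper).
destruct (filter_ex _ H) as [[a b] [[y [Hy1 Hy2]] [Da [Db [Hau Hvb]]]]]; simpl in *.
assert (Hex : forall s t, D s -> D t -> s <= t -> ex_RInt f s t).
{ intros s t Ds Dt Hst. apply (ex_RInt_continuous f). intros z Hz.
  rewrite Rmin_left, Rmax_right in Hz by lra. apply Hf. apply (ends_convex _ _ _ I s t); auto. }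
destruct (Hex a u Da Hu Hau) as [i1 Hi1]. destruct (Hex v b Hv Db Hvb) as [i2 Hi2].
assert (E := is_RInt_Chasles _ _ _ _ _ _ (is_RInt_Chasles _ _ _ _ _ _ Hi1 Huvf) Hi2).
assert (E2 := is_RInt_unique _ _ _ _ E). rewrite (is_RInt_unique _ _ _ _ Hy1) in E2.
unfold plus in E2; simpl in E2.
assert (Hpos' : forall s t i, D s -> D t -> s <= t -> is_RInt f s t i -> 0 <= i).
{ intros s t i Ds Dt Hst Hi. 
  apply (is_RInt_le (fun _ => 0) f s t); auto. apply is_RInt_zero.
  intros x Hx. apply Hpos. apply (ends_convex _ _ _ I s t); auto; lra. }
assert (0 <= i1) by (apply (Hpos' a u); auto).
assert (0 <= i2) by (apply (Hpos' v b); auto). lra.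
Qed.

Lemma is_RInt_gen_ge0 D Fa Fb (I : integration_ends D Fa Fb) (f : R -> R) l :
  (forall x, D x -> 0 <= f x) -> (forall x, D x -> continuous f x) ->
  is_RInt_gen f Fa Fb l -> 0 <= l.
Proof.
intros. destruct (ends_inh _ _ _ I) as [u Hu].
apply (is_RInt_gen_ge_sub D Fa Fb I f l u u 0); auto with real.
apply (is_RInt_point f u).
Qed.

Lemma is_RInt_gen_gt0 D Fa Fb (I : integration_ends D Fa Fb) (f : R -> R) l :
  (forall x, D x -> 0 < f x) -> (forall x, D x -> continuous f x) ->
  is_RInt_gen f Fa Fb l -> 0 < l.
Proof.
intros Hp Hc Hl. destruct (ends_inh _ _ _ I) as [u Hu].
destruct (ends_open _ _ _ I u Hu) as [[e He] H].
assert (Hin : forall x, u <= x <= u + e / 2 -> D x).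
{ intros x Hx. apply H. unfold ball; simpl; unfold AbsRing_ball, abs, minus, plus, opp; simpl.
  apply Rabs_def1; lra. }
assert (Hex : ex_RInt f u (u + e/2)).
{ apply (ex_RInt_continuous f). intros z Hz.
  rewrite Rmin_left, Rmax_right in Hz by lra. apply Hc; auto. }
destruct Hex as [i Hi].
apply Rlt_le_trans with i.
- rewrite <- (is_RInt_unique _ _ _ _ Hi). apply RInt_gt_0; try lra.
  intros x Hx; apply Hp, Hin; lra. intros x Hx; apply Hc, Hin; lra.
- apply (is_RInt_gen_ge_sub D Fa Fb I f l u (u+e/2)); auto; try lra. apply Hin; lra.
  intros; apply Rlt_le; auto.
Qed.

Lemma is_RInt_gen_le D Fa Fb (I : integration_ends D Fa Fb) (f g : R -> R) lf lg :
  (forall x, D x -> f x <= g x) ->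
  (forall x, D x -> continuous f x) -> (forall x, D x -> continuous g x) ->
  is_RInt_gen f Fa Fb lf -> is_RInt_gen g Fa Fb lg -> lf <= lg.
Proof.
intros Hle Hf Hg If Ig.
destruct (ends_Fa _ _ _ I) as [EFa FFa]. destruct (ends_Fb _ _ _ I) as [EFb FFb].
assert (H := is_RInt_gen_minus _ _ _ _ Ig If).
apply (is_RInt_gen_ge0 D Fa Fb I) in H.
- unfold minus, plus, opp in H; simpl in H. lra.
- intros x Hx. unfold minus, plus, opp; simpl. specialize (Hle x Hx). lra.
- intros x Hx. apply (continuous_minus g f); auto.
Qed.

Lemma is_RInt_gen_ext_ends (V : NormedModule R_AbsRing) D Fa Fb (I : integration_ends D Fa Fb) (f g : R -> V) l :
  (forall x, D x -> f x = g x) -> is_RInt_gen f Fa Fb l -> is_RInt_gen g Fa Fb l.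
Proof.
intros H. destruct (ends_Fa _ _ _ I) as [EFa FFa]. destruct (ends_Fb _ _ _ I) as [EFb FFb].
destruct (ends_inh _ _ _ I) as [m Hm].
apply is_RInt_gen_ext.
generalize (ends_prod _ _ _ I m m Hm Hm). apply filter_imp.
intros [a b] [Da [Db [Ha Hb]]] x Hx; simpl in *. rewrite Rmin_left, Rmax_right in Hx by lra.
apply H. apply (ends_convex _ _ _ I a b); auto; lra.
Qed.

Lemma dominated_primitive_limit (F G : R -> R) (E : R -> Prop) (Fb : (R -> Prop) -> Prop) l
  (PF : ProperFilter Fb) : Fb E ->
  (forall u v, E u -> E v -> u <= v -> Rabs (F v - F u) <= Rabs (G v - G u)) ->
  filterlim G Fb (locally l) -> exists y, filterlim F Fb (locally y).
Proof.
intros HE H HG.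
apply (filterlim_locally_cauchy (F := Fb) F).
assert (HC : exists y, filterlim G Fb (locally y)) by (exists l; auto).
rewrite <- (filterlim_locally_cauchy (F := Fb) G) in HC.
intros eps. destruct (HC eps) as [P [HP HP2]].
exists (fun x => P x /\ E x). split. now apply filter_and.
intros u v [Pu Eu] [Pv Ev].
assert (B1 := HP2 u v Pu Pv). assert (B2 := HP2 v u Pv Pu).
unfold ball in *; simpl in *; unfold AbsRing_ball, abs, minus, plus, opp in *; simpl in *.
destruct (Rle_lt_dec u v) as [L|L].
- apply Rle_lt_trans with (2 := B1). apply (H u v); auto.
- change (Rabs (F v - F u) < eps). rewrite Rabs_minus_sym. apply Rle_lt_trans with (2 := B2). apply (H v u); auto; lra.
Qed.

(** A comparison test.  The majorants are given through primitives [G1], [G2]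
    with a limit at the relevant end: the primitive of [f] then satisfies the
    Cauchy criterion there. *)
Lemma ex_RInt_gen_dominated D Fa Fb (I : integration_ends D Fa Fb) (f : R -> R) m
  (g1 G1 g2 G2 : R -> R) l1 l2 :
  D m -> (forall x, D x -> continuous f x) ->
  (forall x, D x -> is_derive G1 x (g1 x) /\ continuous g1 x) ->
  (forall x, D x -> is_derive G2 x (g2 x) /\ continuous g2 x) ->
  (forall x, D x -> x <= m -> Rabs (f x) <= g1 x) ->
  (forall x, D x -> m <= x -> Rabs (f x) <= g2 x) ->
  filterlim G1 Fa (locally l1) -> filterlim G2 Fb (locally l2) ->
  exists l, is_RInt_gen f Fa Fb l.
Proof.
intros Hm Hf HG1 HG2 Hd1 Hd2 L1 L2.
assert (Hex : forall s t, D s -> D t -> ex_RInt f s t).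
{ intros s t Ds Dt. apply (ex_RInt_continuous f). intros z Hz. apply Hf.
  destruct (Rle_lt_dec s t).
  - rewrite Rmin_left, Rmax_right in Hz by lra. apply (ends_convex _ _ _ I s t); auto.
  - rewrite Rmin_right, Rmax_left in Hz by lra. apply (ends_convex _ _ _ I t s); auto. }
set (F := fun x => RInt f m x).
assert (HF : forall x, D x -> is_derive F x (f x)).
{ intros x Dx. apply (is_derive_RInt f F m x).
  - generalize (ends_open _ _ _ I x Dx). apply filter_imp. intros y Dy. 
    apply (RInt_correct f). apply Hex; auto.
  - auto. }
assert (HFd : forall u v, D u -> D v -> is_RInt f u v (F v - F u)).
{ intros u v Du Dv. unfold F.
  assert (E := RInt_Chasles f m u v (Hex m u Hm Du) (Hex u v Du Dv)).
  unfold plus in E; simpl in E.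
  replace (RInt f m v - RInt f m u) with (RInt f u v) by lra.
  apply (RInt_correct f). apply Hex; auto. }
assert (Hdom : forall (g G : R -> R) u v, (forall x, D x -> is_derive G x (g x) /\ continuous g x) ->
   D u -> D v -> u <= v -> (forall x, u <= x <= v -> Rabs (f x) <= g x) ->
   Rabs (F v - F u) <= Rabs (G v - G u)).
{ intros g G u v HG Du Dv Huv Hb.
  apply Rle_trans with (2 := Rle_abs _).
  apply (norm_RInt_le f g u v (F v - F u) (G v - G u)); auto.
  apply (is_RInt_derive G g u v); intros x Hx; rewrite Rmin_left, Rmax_right in Hx by lra;
  apply HG; apply (ends_convex _ _ _ I u v); auto. }
destruct (dominated_primitive_limit F G1 (fun x => D x /\ x <= m) Fa l1 (ends_Fa _ _ _ I)) as [la Hla]; auto.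
{ apply (ends_lo _ _ _ I); auto. }
{ intros u v [Du Hu] [Dv Hv] Huv. apply (Hdom g1); auto. intros x Hx. apply Hd1; try lra.
  apply (ends_convex _ _ _ I u v); auto. }
destruct (dominated_primitive_limit F G2 (fun x => D x /\ m <= x) Fb l2 (ends_Fb _ _ _ I)) as [lb Hlb]; auto.
{ apply (ends_hi _ _ _ I); auto. }
{ intros u v [Du Hu] [Dv Hv] Huv. apply (Hdom g2); auto. intros x Hx. apply Hd2; try lra.
  apply (ends_convex _ _ _ I u v); auto. }
exists (lb - la). apply (is_RInt_gen_primitive D Fa Fb I F f); auto.
Qed.

(** The error of replacing [k] by [kn n] is at most [eps n * W], uniformly in
    the ends of the interval of integration, so the two limits commute. *)
Lemma is_RInt_gen_uniform_limit D Fa Fb (I : integration_ends D Fa Fb) (w k : R -> R) (kn : nat -> R -> R)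
  (eps In : nat -> R) (W l : R) :
  (forall x, D x -> 0 <= w x) -> (forall x, D x -> continuous w x) ->
  is_RInt_gen w Fa Fb W ->
  (forall n x, D x -> continuous (kn n) x) ->
  (forall n, is_RInt_gen (fun x => w x * kn n x) Fa Fb (In n)) ->
  (forall n x, D x -> Rabs (k x - kn n x) <= eps n) ->
  is_lim_seq eps 0 -> is_lim_seq In l ->
  is_RInt_gen (fun x => w x * k x) Fa Fb l.
Proof.
intros Hw Hwc HW Hknc HIn Hk Heps HlIn.
destruct (ends_Fa _ _ _ I) as [EFa FFa]. destruct (ends_Fb _ _ _ I) as [EFb FFb].
destruct (ends_inh _ _ _ I) as [m Hm].
assert (Heps' : forall e : posreal, exists N, eps N < e /\ 0 <= eps N /\ Rabs (In N - l) < e).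
{ intros e. apply is_lim_seq_spec in Heps. apply is_lim_seq_spec in HlIn.
  specialize (Heps e). specialize (HlIn e).
  destruct (filter_ex _ (filter_and _ _ Heps HlIn)) as [N [H1 H2]].
  exists N. split; [|split]; auto.
  - rewrite Rminus_0_r in H1. apply Rle_lt_trans with (2 := H1). apply Rle_abs.
  - apply Rle_trans with (2 := Hk N m Hm). apply Rabs_pos. }
assert (Hkc : forall x, D x -> continuous k x).
{ intros x Dx. apply filterlim_locally. intros e.
  assert (He3 : 0 < e / 3) by (destruct e; simpl; lra).
  destruct (Heps' (mkposreal _ He3)) as [N [H1 _]]; simpl in H1.
  assert (Hc := Hknc N x Dx). 
  assert (Hc' := proj1 (filterlim_locally (kn N) (kn N x)) Hc (mkposreal _ He3)).
  generalize (filter_and _ _ Hc' (ends_open _ _ _ I x Dx)). apply filter_imp.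
  intros y [Hy Dy]. assert (A1 := Hk N x Dx). assert (A2 := Hk N y Dy).
  unfold ball in *; simpl in *; unfold AbsRing_ball, abs, minus, plus, opp in *; simpl in *.
  unfold Rabs in *. repeat destruct Rcase_abs; lra. }
assert (Hc : forall x, D x -> continuous (fun x => w x * k x) x).
{ intros x Dx. apply (continuous_mult w k); auto. }
assert (W0 : 0 <= W) by (apply (is_RInt_gen_ge0 D Fa Fb I w); auto).
intros P [e He]. unfold filtermapi.
set (d := e / (W + 3)).
assert (Hd : 0 < d) by (unfold d; apply Rdiv_lt_0_compat; [apply cond_pos|lra]).
destruct (Heps' (mkposreal _ Hd)) as [N [H1 [H2 H3]]]; simpl in *.
assert (HP1 : locally (In N) (fun y => Rabs (y - In N) < d)).
{ exists (mkposreal _ Hd). intros y Hy; exact Hy. }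
assert (HP2 : locally W (fun y => y < W + 1)).
{ apply (locally_interval _ W m_infty (W+1)); simpl; try easy; lra. }
assert (E1 := HIn N _ HP1). assert (E2 := HW _ HP2). unfold filtermapi in E1, E2.
generalize (filter_and _ _ (filter_and _ _ E1 E2) (ends_prod _ _ _ I m m Hm Hm)).
apply filter_imp. intros [a b] [[[y1 [Y1 Y1']] [y2 [Y2 Y2']]] [Da [Db [Ha Hb]]]]; simpl in *.
assert (Hex : ex_RInt (fun x => w x * k x) a b).
{ apply (ex_RInt_continuous (fun x => w x * k x)). intros z Hz.
  rewrite Rmin_left, Rmax_right in Hz by lra. apply Hc. apply (ends_convex _ _ _ I a b); auto. }
destruct Hex as [y Y]. exists y; split; auto.
apply He.
assert (Hb1 : Rabs (y - y1) <= y2 * eps N).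
{ apply (norm_RInt_le (fun x => minus (w x * k x) (w x * kn N x)) (fun x => eps N * w x) a b); try lra.
  - intros x Hx. assert (Dx : D x) by (apply (ends_convex _ _ _ I a b); auto).
    unfold norm; simpl; unfold abs, minus, plus, opp; simpl.
    replace (w x * k x + - (w x * kn N x)) with (w x * (k x - kn N x)) by ring.
    rewrite Rabs_mult, (Rabs_pos_eq (w x)) by auto.
    rewrite Rmult_comm. apply Rmult_le_compat_r; auto.
  - apply (is_RInt_minus (fun x => w x * k x) (fun x => w x * kn N x)); auto.
  - rewrite Rmult_comm. apply (is_RInt_scal w); auto. }
assert (Hy2 : 0 <= y2).
{ apply (is_RInt_le (fun _ => 0) w a b); auto; try lra. apply is_RInt_zero.
  intros x Hx. apply Hw. apply (ends_convex _ _ _ I a b); auto; lra. }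
unfold ball; simpl; unfold AbsRing_ball, abs, minus, plus, opp; simpl.
assert (Hb2 : y2 * eps N <= (W + 1) * d) by (apply Rmult_le_compat; lra).
replace (y + - l) with ((y - y1) + (y1 - In N) + (In N - l)) by ring.
apply Rle_lt_trans with (1 := Rabs_triang _ _).
apply Rle_lt_trans with (Rabs (y - y1) + Rabs (y1 - In N) + Rabs (In N - l)).
{ apply Rplus_le_compat_r, Rabs_triang. }
replace (pos e) with ((W + 1) * d + d + d) by (unfold d; field; lra). lra.
Qed.

(** * Real powers *)

Lemma is_derive_Rpower (p x : R) : 0 < x ->
  is_derive (fun t => Rpower t p) x (p * Rpower x (p - 1)).
Proof. intros Hx. apply is_derive_Reals. now apply derivable_pt_lim_power. Qed.

Lemma is_derive_Rpower_comp (f : R -> R) (p x l : R) : 0 < f x -> is_derive f x l ->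
  is_derive (fun t => Rpower (f t) p) x (p * Rpower (f x) (p - 1) * l).
Proof.
intros Hx Hf. evar_last.
apply (is_derive_comp (fun t => Rpower t p) f x _ _ (is_derive_Rpower p (f x) Hx) Hf).
unfold scal; simpl; unfold mult; simpl. ring.
Qed.

Lemma continuous_Rpower_comp (f : R -> R) (p x : R) : 0 < f x -> continuous f x ->
  continuous (fun t => Rpower (f t) p) x.
Proof.
intros Hx Hf. apply (continuous_comp f (fun t => Rpower t p)); auto.
apply (ex_derive_continuous (fun t => Rpower t p)). eexists. now apply is_derive_Rpower.
Qed.

Lemma Rpower_pos x p : 0 < Rpower x p.
Proof. apply exp_pos. Qed.

Lemma Rpower_S x p : 0 < x -> Rpower x p = x * Rpower x (p - 1).
Proof.
intros Hx. rewrite <- (Rpower_1 x) at 2 by auto. rewrite <- Rpower_plus. f_equal; ring.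
Qed.

Lemma Rpower_bounds p d t : 0 < d -> d <= t <= 1 -> exp (- (Rabs p * - ln d)) <= Rpower t p <= exp (Rabs p * - ln d).
Proof.
intros Hd Ht.
assert (L : 0 <= - ln t <= - ln d).
{ split.
  - destruct (proj2 Ht) as [H| ->]; [|rewrite ln_1; lra].
    assert (ln t < ln 1) by (apply ln_increasing; lra). rewrite ln_1 in H0; lra.
  - destruct (proj1 Ht) as [H| <-]; [|lra]. 
    assert (ln d < ln t) by (apply ln_increasing; lra). lra. }
assert (H : Rabs (p * ln t) <= Rabs p * - ln d).
{ rewrite Rabs_mult, <- (Rabs_Ropp (ln t)), (Rabs_pos_eq (- ln t)) by lra.
  apply Rmult_le_compat_l; try lra. apply Rabs_pos. }
apply Rabs_le_between in H.
assert (E : forall x y, x <= y -> exp x <= exp y).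
{ intros x y [Hxy| ->]; [|lra]. now apply Rlt_le, exp_increasing. }
split; apply E; lra.
Qed.

Lemma filterlim_Rpower_0 p : 0 < p -> filterlim (fun x => Rpower x p) (at_right 0) (locally 0).
Proof.
intros Hp. apply filterlim_locally. intros [e He].
assert (Hd : 0 < Rpower e (/ p)) by apply Rpower_pos.
exists (mkposreal _ Hd). intros x Hx Hx0. simpl in *.
unfold ball in *; simpl in *; unfold AbsRing_ball, abs, minus, plus, opp in *; simpl in *.
rewrite Ropp_0, Rplus_0_r in *. rewrite Rabs_pos_eq by (apply Rlt_le, Rpower_pos).
rewrite Rabs_pos_eq in Hx by lra.
replace e with (Rpower (Rpower e (/ p)) p).
2:{ rewrite Rpower_mult, Rinv_l, Rpower_1; lra. }
apply Rlt_Rpower_l; auto.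
Qed.

Lemma filterlim_Ropp_0 : filterlim Ropp (locally 0) (locally 0).
Proof.
assert (H := filterlim_opp (V := R_NormedModule) 0). unfold opp in H at 2; simpl in H.
now rewrite Ropp_0 in H.
Qed.

Lemma filterlim_left_coord : filterlim (fun x => (1 - x) / 2) (at_left 1) (at_right 0).
Proof.
intros P [e He]. assert (H2 : 0 < 2 * e) by (destruct e; simpl; lra).
exists (mkposreal _ H2). intros x Hx Hx1. simpl in *. apply He; try lra.
unfold ball in *; simpl in *; unfold AbsRing_ball, abs, minus, plus, opp in *; simpl in *.
apply Rabs_def2 in Hx. apply Rabs_def1; lra.
Qed.

Lemma filterlim_right_coord : filterlim (fun x => (1 + x) / 2) (at_right (-1)) (at_right 0).
Proof.
intros P [e He]. assert (H2 : 0 < 2 * e) by (destruct e; simpl; lra).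
exists (mkposreal _ H2). intros x Hx Hx1. simpl in *. apply He; try lra.
unfold ball in *; simpl in *; unfold AbsRing_ball, abs, minus, plus, opp in *; simpl in *.
apply Rabs_def2 in Hx. apply Rabs_def1; lra.
Qed.

Lemma filterlim_at_left_of_continuous (f : R -> R) a : continuous f a -> filterlim f (at_left a) (locally (f a)).
Proof.
intros H. apply filterlim_filter_le_1 with (2 := H). apply filter_le_within.
Qed.

Lemma filterlim_at_right_of_continuous (f : R -> R) a : continuous f a -> filterlim f (at_right a) (locally (f a)).
Proof.
intros H. apply filterlim_filter_le_1 with (2 := H). apply filter_le_within.
Qed.

(** The concave function [t^theta] lies below its tangent at [tau]; integrated
    against a weight, this yields log-convexity of the moments. *)
Lemma Rpower_le_tangent t tau theta : 0 < t -> 0 < tau -> 0 <= theta <= 1 ->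
  Rpower t theta <= Rpower tau theta * (1 - theta + theta * (t / tau)).
Proof.
intros Ht Htau Hth.
set (s := ln (t / tau)).
assert (Hr : 0 < t / tau) by (apply Rdiv_lt_0_compat; auto).
assert (Es : t / tau = exp s) by (unfold s; now rewrite exp_ln).
replace (Rpower t theta) with (Rpower tau theta * exp (theta * s)).
2:{ unfold Rpower. rewrite <- exp_plus. f_equal. unfold s, Rdiv.
    rewrite ln_mult, ln_Rinv; auto. ring. now apply Rinv_0_lt_compat. }
apply Rmult_le_compat_l; [apply Rlt_le, Rpower_pos|].
rewrite Es.
assert (A1 : exp (theta * s) * (1 + (1 - theta) * s) <= exp s).
{ replace (exp s) with (exp (theta * s) * exp ((1 - theta) * s)) by (rewrite <- exp_plus; f_equal; ring).
  apply Rmult_le_compat_l; [apply Rlt_le, exp_pos|]. apply exp_ineq1_le. }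
assert (A2 : exp (theta * s) * (1 + - theta * s) <= 1).
{ apply Rle_trans with (exp (theta * s) * exp (- theta * s)).
  apply Rmult_le_compat_l; [apply Rlt_le, exp_pos|]. apply exp_ineq1_le.
  rewrite <- exp_plus. replace (theta * s + - theta * s) with 0 by ring. rewrite exp_0. lra. }
assert (A3 := Rmult_le_compat_l theta _ _ (proj1 Hth) A1).
assert (Hth' : 0 <= 1 - theta) by lra.
assert (A4 := Rmult_le_compat_l (1 - theta) _ _ Hth' A2).
nra.
Qed.

(** * Euler's Gamma integral on the positive reals *)

Definition gamma_weight (s t : R) : R := Rpower t (s - 1) * exp (- t).
Definition RGamma (s : R) : R := RInt_gen (gamma_weight s) (at_right 0) (Rbar_locally p_infty).

Lemma gamma_weight_pos s t : 0 < gamma_weight s t.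
Proof. apply Rmult_lt_0_compat. apply Rpower_pos. apply exp_pos. Qed.

Lemma continuous_gamma_weight s t : 0 < t -> continuous (gamma_weight s) t.
Proof.
intros Ht. apply (continuous_mult (fun t => Rpower t (s - 1)) (fun t => exp (- t))).
- apply (continuous_Rpower_comp (fun t => t)); auto. apply continuous_id.
- apply (ex_derive_continuous (fun t => exp (- t))). now auto_derive.
Qed.

(** The exponential decay left over is what makes the Gamma integral converge
    at infinity. *)
Lemma Rpower_le_exp_half p : exists M, 0 <= M /\ forall t, 1 <= t -> Rpower t p <= M * exp (t / 2).
Proof.
set (K := 2 * (Rabs p + 1)).
assert (Hp := Rabs_pos p). assert (HK : 0 < K) by (unfold K; lra).
(* [K] makes the bound [ln t <= t / K - 1 + ln K] cost at most [t / 2]. *)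
exists (exp (Rabs p * ln K)). split. apply Rlt_le, exp_pos. 
intros t Ht. rewrite <- exp_plus. unfold Rpower.
destruct (Rle_lt_dec (p * ln t) (Rabs p * ln K + t / 2)) as [[H|H]|H].
- apply Rlt_le, exp_increasing; auto.
- rewrite H; lra.
- exfalso.
  assert (L0 : 0 <= ln t).
  { destruct Ht as [Ht| <-]. apply Rlt_le. rewrite <- ln_1. apply ln_increasing; lra. rewrite ln_1; lra. }
  assert (L1 : p * ln t <= Rabs p * ln t) by (apply Rmult_le_compat_r; auto; apply Rle_abs).
  assert (L2 : ln t <= t / K - 1 + ln K).
  { replace (ln t) with (ln (t / K) + ln K).
    2:{ unfold Rdiv. rewrite ln_mult, ln_Rinv; try lra. apply Rinv_0_lt_compat; auto. }
    assert (P : 0 < t / K) by (apply Rdiv_lt_0_compat; lra).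
    assert (Q := exp_ineq1_le (ln (t / K))). rewrite exp_ln in Q by auto. lra. }
  assert (L3 : Rabs p * ln t <= Rabs p * (t / K - 1 + ln K)) by (apply Rmult_le_compat_l; auto).
  assert (L4 : Rabs p * (t / K) <= t / 2).
  { replace (Rabs p * (t / K)) with ((Rabs p / (Rabs p + 1)) * (t / 2)) by (unfold K; field; lra).
    rewrite <- (Rmult_1_l (t / 2)) at 2. apply Rmult_le_compat_r; try lra.
    apply Rle_div_l; lra. }
  lra.
Qed.

Lemma filterlim_exp_half_infty M : filterlim (fun t => M * exp (- t / 2)) (Rbar_locally p_infty) (locally 0).
Proof.
assert (H : is_lim (fun t => exp (- t / 2)) p_infty 0).
{ apply (is_lim_comp exp (fun t => - t / 2) p_infty 0 m_infty).
  - apply is_lim_exp_m.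
  - apply is_lim_ext with (fun t => (-/2) * t). intros; field.
    evar_last. apply is_lim_scal_l. apply is_lim_id. simpl. 
    destruct (Rle_dec 0 (-/2)) as [H|H]; [exfalso; lra|reflexivity].
  - exists 0. intros; discriminate. }
assert (H2 := is_lim_scal_l _ M _ _ H). simpl in H2. rewrite Rmult_0_r in H2. exact H2.
Qed.

Lemma filterlim_Rpower_exp_infty p : filterlim (fun t => Rpower t p * exp (- t)) (Rbar_locally p_infty) (locally 0).
Proof.
destruct (Rpower_le_exp_half p) as [M [HM0 HM]].
apply (filterlim_le_le (F := Rbar_locally p_infty) (fun _ => 0) (fun t => Rpower t p * exp (- t)) (fun t => M * exp (- t / 2)) 0).
- exists 1. intros t Ht. split.
  + apply Rlt_le, Rmult_lt_0_compat. apply Rpower_pos. apply exp_pos.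
  + replace (exp (- t / 2)) with (exp (t / 2) * exp (- t)) by (rewrite <- exp_plus; f_equal; field).
    rewrite <- Rmult_assoc. apply Rmult_le_compat_r. apply Rlt_le, exp_pos. apply HM; lra.
- apply filterlim_const.
- apply filterlim_exp_half_infty.
Qed.

Lemma is_RGamma s : 0 < s ->
  is_RInt_gen (gamma_weight s) (at_right 0) (Rbar_locally p_infty) (RGamma s).
Proof.
intros Hs. destruct (Rpower_le_exp_half (s - 1)) as [M [HM0 HM]].
assert (H : exists l, is_RInt_gen (gamma_weight s) (at_right 0) (Rbar_locally p_infty) l).
{ apply (ex_RInt_gen_dominated _ _ _ ends_half_line (gamma_weight s) 1
     (fun t => Rpower t (s - 1)) (fun t => / s * Rpower t s)
     (fun t => M * exp (- t / 2)) (fun t => (- 2 * M) * exp (- t / 2)) (/ s * 0) 0); try lra.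
  - intros; now apply continuous_gamma_weight.
  - intros x Hx. split.
    + evar_last. apply (is_derive_scal (fun t => Rpower t s)). apply is_derive_Rpower; auto.
      simpl. field. lra.
    + apply (continuous_Rpower_comp (fun t => t)); auto. apply continuous_id.
  - intros x Hx. split.
    + auto_derive; auto. unfold Rdiv. field.
    + apply (ex_derive_continuous (fun t => M * exp (- t / 2))). now auto_derive.
  - intros x Hx Hx1. rewrite Rabs_pos_eq by (apply Rlt_le, gamma_weight_pos).
    unfold gamma_weight. rewrite <- (Rmult_1_r (Rpower x (s - 1))) at 2.
    apply Rmult_le_compat_l; [apply Rlt_le, Rpower_pos|].
    rewrite <- exp_0. apply Rlt_le, exp_increasing. lra.
  - intros x Hx Hx1. rewrite Rabs_pos_eq by (apply Rlt_le, gamma_weight_pos).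
    unfold gamma_weight.
    replace (exp (- x / 2)) with (exp (x / 2) * exp (- x)) by (rewrite <- exp_plus; f_equal; field).
    rewrite <- Rmult_assoc. apply Rmult_le_compat_r. apply Rlt_le, exp_pos. apply HM; lra.
  - apply (filterlim_comp _ _ _ (fun t => Rpower t s) (fun t => / s * t) _ (locally 0)).
    now apply filterlim_Rpower_0. apply (filterlim_scal_r (V := R_NormedModule) (/ s) 0).
  - apply filterlim_exp_half_infty. }
exact (RInt_gen_correct (V := R_CompleteNormedModule) _ H).
Qed.

Lemma RGamma_pos s : 0 < s -> 0 < RGamma s.
Proof.
intros Hs. apply (is_RInt_gen_gt0 _ _ _ ends_half_line (gamma_weight s)).
intros; apply gamma_weight_pos. intros; now apply continuous_gamma_weight. now apply is_RGamma.
Qed.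

Lemma RInt_gen_eq D Fa Fb (I : integration_ends D Fa Fb) (f : R -> R) (l1 l2 : R) :
  is_RInt_gen f Fa Fb l1 -> is_RInt_gen f Fa Fb l2 -> l1 = l2.
Proof.
intros H1 H2. assert (P1 := ends_Fa _ _ _ I). assert (P2 := ends_Fb _ _ _ I).
rewrite <- (is_RInt_gen_unique f l1 H1). now apply (is_RInt_gen_unique f l2).
Qed.

Lemma RGamma_1 : RGamma 1 = 1.
Proof.
apply (RInt_gen_eq _ _ _ ends_half_line (gamma_weight 1)).
apply is_RGamma; lra.
replace 1 with (0 - (-1)) at 2 by ring.
apply (is_RInt_gen_ext_ends _ _ _ _ ends_half_line (fun t => exp (- t))).
{ intros x Hx. unfold gamma_weight. rewrite Rminus_diag, Rpower_O; auto; try ring. rewrite Rmult_1_l; reflexivity. }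
apply (is_RInt_gen_primitive _ _ _ ends_half_line (fun t => - exp (- t))).
- intros x Hx. auto_derive; auto. ring.
- intros x Hx. apply (ex_derive_continuous (fun t => exp (- t))). now auto_derive.
- replace (-1) with (- exp (- 0)) by (rewrite Ropp_0, exp_0; ring).
  apply (filterlim_at_right_of_continuous (fun t => - exp (- t))).
  apply (ex_derive_continuous (fun t => - exp (- t))). now auto_derive.
- assert (H := filterlim_Rpower_exp_infty 0).
  apply (filterlim_comp _ _ _ (fun t => exp (- t)) Ropp _ (locally 0)).
  + apply filterlim_ext_loc with (2 := H). exists 1. intros t Ht. rewrite Rpower_O; lra.
  + replace (locally 0) with (locally (- 0)) at 2 by (f_equal; ring).
    apply (filterlim_opp (V := R_NormedModule) 0).
Qed.

(** [- t^s exp (-t)] vanishes at both ends. *)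
Lemma RGamma_succ s : 0 < s -> RGamma (s + 1) = s * RGamma s.
Proof.
intros Hs.
assert (H1 := is_RGamma s Hs). assert (Hs1 : 0 < s + 1) by lra. assert (H2 := is_RGamma (s + 1) Hs1).
assert (P1 := ends_Fa _ _ _ ends_half_line). assert (P2 := ends_Fb _ _ _ ends_half_line).
assert (H3 := is_RInt_gen_minus _ _ _ _ H2 (is_RInt_gen_scal _ s _ H1)).
assert (E : RGamma (s + 1) - s * RGamma s = - 0 - - 0).
2:{ lra. }
apply (RInt_gen_eq _ _ _ ends_half_line _ _ _ H3). clear H3.
apply (is_RInt_gen_primitive _ _ _ ends_half_line (fun t => - (Rpower t s * exp (- t)))).
- intros x Hx. unfold gamma_weight, scal, minus, plus, opp; simpl; unfold mult; simpl.
  evar_last. apply (is_derive_opp (fun t => Rpower t s * exp (- t))).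
  apply (is_derive_mult (fun t => Rpower t s) (fun t => exp (- t)) x (s * Rpower x (s - 1)) (- exp (- x))).
  now apply is_derive_Rpower. auto_derive; auto; ring. intros; apply Rmult_comm.
  unfold mult, plus, opp; simpl. replace (s + 1 - 1) with s by ring. ring.
- intros x Hx. apply (continuous_minus (gamma_weight (s + 1))). now apply continuous_gamma_weight.
  apply (continuous_scal_r s (gamma_weight s)). now apply continuous_gamma_weight.
- apply (filterlim_comp _ _ _ (fun t => Rpower t s * exp (- t)) Ropp _ (locally 0)).
  2: apply (filterlim_opp (V := R_NormedModule) 0).
  replace (locally 0) with (locally (0 * exp (- 0))) by (f_equal; ring).
  apply (filterlim_comp_2 (G := locally 0) (H := locally (exp (- 0))) (fun t => Rpower t s) (fun t => exp (- t)) Rmult).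
  + now apply filterlim_Rpower_0.
  + apply (filterlim_at_right_of_continuous (fun t => exp (- t))).
    apply (ex_derive_continuous (fun t => exp (- t))). now auto_derive.
  + apply (filterlim_mult (K := R_AbsRing) 0 (exp (- 0))).
- apply (filterlim_comp _ _ _ (fun t => Rpower t s * exp (- t)) Ropp _ (locally 0)).
  2: apply (filterlim_opp (V := R_NormedModule) 0).
  apply filterlim_Rpower_exp_infty.
Qed.

(** Tangent at [tau = s], the ratio of the two neighbouring moments. *)
Lemma RGamma_log_convex s theta : 0 < s -> 0 <= theta <= 1 ->
  RGamma (s + theta) <= Rpower s theta * RGamma s.
Proof.
intros Hs Hth.
assert (H1 := is_RGamma s Hs). assert (Hs1 : 0 < s + 1) by lra. assert (H2 := is_RGamma (s + 1) Hs1).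
assert (Hs2 : 0 < s + theta) by lra. assert (H3 := is_RGamma (s + theta) Hs2).
assert (P1 := ends_Fa _ _ _ ends_half_line). assert (P2 := ends_Fb _ _ _ ends_half_line).
assert (H4 := is_RInt_gen_plus _ _ _ _ (is_RInt_gen_scal _ (Rpower s theta * (1 - theta)) _ H1)
   (is_RInt_gen_scal _ (Rpower s theta * (theta / s)) _ H2)).
replace (Rpower s theta * RGamma s) with
  (plus (scal (Rpower s theta * (1 - theta)) (RGamma s)) (scal (Rpower s theta * (theta / s)) (RGamma (s + 1)))).
2:{ rewrite RGamma_succ by auto. unfold plus, scal; simpl; unfold mult; simpl. field. lra. }
apply (is_RInt_gen_le _ _ _ ends_half_line _ _ _ _) with (4 := H3) (5 := H4).
- intros t Ht. unfold plus, scal; simpl; unfold mult; simpl. unfold gamma_weight.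
  replace (s + theta - 1) with (theta + (s - 1)) by ring. rewrite Rpower_plus.
  replace (s + 1 - 1) with s by ring. rewrite (Rpower_S t s) by auto.
  assert (A := Rpower_le_tangent t s theta Ht Hs Hth).
  apply Rle_trans with (Rpower s theta * (1 - theta + theta * (t / s)) * (Rpower t (s - 1) * exp (- t))).
  + rewrite Rmult_assoc. apply Rmult_le_compat_r; auto. apply Rlt_le, gamma_weight_pos.
  + right. field. lra.
- intros; now apply continuous_gamma_weight.
- intros x Hx. apply (continuous_plus (fun x => scal _ (gamma_weight s x)));
  apply (continuous_scal_r _ (gamma_weight _)); now apply continuous_gamma_weight.
Qed.

(** * Euler's Beta integral *)

(** [y^(p-1) (1-y)^(q-1) dy] with [y = (1 - x) / 2], so that the integrals live
    on (-1, 1); the last [/ 2] is the Jacobian. *)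
Definition beta_weight (p q x : R) : R :=
  Rpower ((1 - x) / 2) (p - 1) * Rpower ((1 + x) / 2) (q - 1) / 2.
Definition RBeta (p q : R) : R := RInt_gen (beta_weight p q) (at_right (-1)) (at_left 1).

Lemma beta_weight_pos p q x : 0 < beta_weight p q x.
Proof.
apply Rdiv_lt_0_compat; try lra. apply Rmult_lt_0_compat; apply Rpower_pos.
Qed.

Lemma continuous_beta_weight p q x : -1 < x < 1 -> continuous (beta_weight p q) x.
Proof.
intros Hx. unfold beta_weight, Rdiv. apply (continuous_mult (fun x => Rpower ((1 - x) / 2) (p - 1) * Rpower ((1 + x) / 2) (q - 1)) (fun _ => / 2)).
2: apply continuous_const.
apply (continuous_mult (fun x => Rpower ((1 - x) / 2) (p - 1)) (fun x => Rpower ((1 + x) / 2) (q - 1))).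
- apply (continuous_Rpower_comp (fun x => (1 - x) / 2)); try lra.
  apply (ex_derive_continuous (fun x => (1 - x) / 2)). now auto_derive.
- apply (continuous_Rpower_comp (fun x => (1 + x) / 2)); try lra.
  apply (ex_derive_continuous (fun x => (1 + x) / 2)). now auto_derive.
Qed.

Lemma is_RBeta p q : 0 < p -> 0 < q ->
  is_RInt_gen (beta_weight p q) (at_right (-1)) (at_left 1) (RBeta p q).
Proof.
intros Hp Hq.
set (Cp := exp (Rabs (p - 1) * - ln (/ 2))). set (Cq := exp (Rabs (q - 1) * - ln (/ 2))).
assert (H : exists l, is_RInt_gen (beta_weight p q) (at_right (-1)) (at_left 1) l).
{ apply (ex_RInt_gen_dominated _ _ _ ends_m1_1 (beta_weight p q) 0
     (fun x => Cp / 2 * Rpower ((1 + x) / 2) (q - 1)) (fun x => Cp / q * Rpower ((1 + x) / 2) q)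
     (fun x => Cq / 2 * Rpower ((1 - x) / 2) (p - 1)) (fun x => - Cq / p * Rpower ((1 - x) / 2) p)
     (Cp / q * 0) (- Cq / p * 0)); try lra.
  - intros; now apply continuous_beta_weight.
  - intros x Hx. split.
    + evar_last. apply (is_derive_scal (fun x => Rpower ((1 + x) / 2) q)).
      apply (is_derive_Rpower_comp (fun x => (1 + x) / 2) q x (/ 2)); try lra.
      auto_derive; auto; field. simpl. field. lra.
    + apply (continuous_scal_r (Cp / 2) (fun x => Rpower ((1 + x) / 2) (q - 1))).
      apply (continuous_Rpower_comp (fun x => (1 + x) / 2)); try lra.
      apply (ex_derive_continuous (fun x => (1 + x) / 2)). now auto_derive.
  - intros x Hx. split.
    + evar_last. apply (is_derive_scal (fun x => Rpower ((1 - x) / 2) p)).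
      apply (is_derive_Rpower_comp (fun x => (1 - x) / 2) p x (- / 2)); try lra.
      auto_derive; auto; field. simpl. field. lra.
    + apply (continuous_scal_r (Cq / 2) (fun x => Rpower ((1 - x) / 2) (p - 1))).
      apply (continuous_Rpower_comp (fun x => (1 - x) / 2)); try lra.
      apply (ex_derive_continuous (fun x => (1 - x) / 2)). now auto_derive.
  - intros x Hx Hx1. rewrite Rabs_pos_eq by (apply Rlt_le, beta_weight_pos).
    unfold beta_weight.
    replace (Cp / 2 * Rpower ((1 + x) / 2) (q - 1)) with (Cp * Rpower ((1 + x) / 2) (q - 1) / 2) by field.
    apply Rmult_le_compat_r; try lra. apply Rmult_le_compat_r. apply Rlt_le, Rpower_pos.
    apply Rpower_bounds; lra.
  - intros x Hx Hx1. rewrite Rabs_pos_eq by (apply Rlt_le, beta_weight_pos).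
    unfold beta_weight.
    replace (Cq / 2 * Rpower ((1 - x) / 2) (p - 1)) with (Rpower ((1 - x) / 2) (p - 1) * Cq / 2) by field.
    apply Rmult_le_compat_r; try lra. apply Rmult_le_compat_l. apply Rlt_le, Rpower_pos.
    apply Rpower_bounds; lra.
  - apply (filterlim_comp _ _ _ (fun x => Rpower ((1 + x) / 2) q) (fun t => Cp / q * t) _ (locally 0)).
    apply (filterlim_comp _ _ _ (fun x => (1 + x) / 2) (fun t => Rpower t q) _ (at_right 0)).
    apply filterlim_right_coord. now apply filterlim_Rpower_0.
    apply (filterlim_scal_r (V := R_NormedModule) (Cp / q) 0).
  - apply (filterlim_comp _ _ _ (fun x => Rpower ((1 - x) / 2) p) (fun t => - Cq / p * t) _ (locally 0)).
    apply (filterlim_comp _ _ _ (fun x => (1 - x) / 2) (fun t => Rpower t p) _ (at_right 0)).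
    apply filterlim_left_coord. now apply filterlim_Rpower_0.
    apply (filterlim_scal_r (V := R_NormedModule) (- Cq / p) 0). }
exact (RInt_gen_correct (V := R_CompleteNormedModule) _ H).
Qed.

Lemma RBeta_pos p q : 0 < p -> 0 < q -> 0 < RBeta p q.
Proof.
intros Hp Hq. apply (is_RInt_gen_gt0 _ _ _ ends_m1_1 (beta_weight p q)).
intros; apply beta_weight_pos. intros; now apply continuous_beta_weight. now apply is_RBeta.
Qed.

(** The integrand is the derivative of [- y^p (1-y)^q g(y)], which vanishes at
    both ends because [g] is bounded. *)
Lemma beta_weight_parts p q (g g1 : R -> R) (M : R) : 0 < p -> 0 < q ->
  (forall y, 0 < y < 1 -> is_derive g y (g1 y)) ->
  (forall y, 0 < y < 1 -> continuous g1 y) ->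
  (forall y, 0 < y < 1 -> Rabs (g y) <= M) ->
  is_RInt_gen (fun x => beta_weight p q x *
     (let y := (1 - x) / 2 in (p * (1 - y) - q * y) * g y + y * (1 - y) * g1 y))
    (at_right (-1)) (at_left 1) 0.
Proof.
intros Hp Hq Hg Hg1 HM.
replace 0 with (0 - 0) by ring.
assert (P1 := ends_Fa _ _ _ ends_m1_1). assert (P2 := ends_Fb _ _ _ ends_m1_1).
assert (D0 : forall x, is_derive (fun x => (1 - x) / 2) x (- / 2)) by (intros; auto_derive; auto; field).
assert (Cg : forall x, -1 < x < 1 -> continuous (fun x => g ((1 - x) / 2)) x).
{ intros x Hx. apply (continuous_comp (fun x => (1 - x) / 2) g).
  apply (ex_derive_continuous (fun x => (1 - x) / 2)). eexists; apply D0.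
  apply (ex_derive_continuous g). eexists; apply Hg; lra. }
assert (Hlim : forall (F : (R -> Prop) -> Prop), ProperFilter F ->
   F (fun x => -1 < x < 1) -> 
   filterlim (fun x => M * (Rpower ((1 - x) / 2) p * Rpower ((1 + x) / 2) q)) F (locally 0) ->
   filterlim (fun x => - (Rpower ((1 - x) / 2) p * Rpower ((1 + x) / 2) q * g ((1 - x) / 2))) F (locally 0)).
{ intros F PF FD Hl. 
  apply (filterlim_le_le (F := F) (fun x => - (M * (Rpower ((1 - x) / 2) p * Rpower ((1 + x) / 2) q))) _
     (fun x => M * (Rpower ((1 - x) / 2) p * Rpower ((1 + x) / 2) q)) 0); auto.
  - revert FD. apply filter_imp. intros x Hx.
    assert (B : Rabs (g ((1 - x) / 2)) <= M) by (apply HM; lra).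
    apply Rabs_le_between in B.
    assert (Hpos : 0 < Rpower ((1 - x) / 2) p * Rpower ((1 + x) / 2) q) by (apply Rmult_lt_0_compat; apply Rpower_pos).
    nra.
  - apply (filterlim_comp _ _ _ _ Ropp _ (locally 0) _ Hl). 
    exact filterlim_Ropp_0. }
apply (is_RInt_gen_primitive _ _ _ ends_m1_1
  (fun x => - (Rpower ((1 - x) / 2) p * Rpower ((1 + x) / 2) q * g ((1 - x) / 2)))).
- intros x Hx. evar_last.
  apply (is_derive_opp (fun x => Rpower ((1 - x) / 2) p * Rpower ((1 + x) / 2) q * g ((1 - x) / 2))).
  apply (is_derive_mult (fun x => Rpower ((1 - x) / 2) p * Rpower ((1 + x) / 2) q) (fun x => g ((1 - x) / 2))).
  apply (is_derive_mult (fun x => Rpower ((1 - x) / 2) p) (fun x => Rpower ((1 + x) / 2) q)).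
  + apply (is_derive_Rpower_comp (fun x => (1 - x) / 2) p x (- / 2)); try lra. apply D0.
  + apply (is_derive_Rpower_comp (fun x => (1 + x) / 2) q x (/ 2)); try lra. auto_derive; auto; field.
  + intros; apply Rmult_comm.
  + apply (is_derive_comp g (fun x => (1 - x) / 2)). apply Hg; lra. apply D0.
  + intros; apply Rmult_comm.
  + unfold beta_weight, scal, mult, plus, opp; simpl; unfold mult; simpl.
    rewrite (Rpower_S _ p), (Rpower_S _ q) by lra. field.
- intros x Hx. apply (continuous_mult (beta_weight p q)). now apply continuous_beta_weight.
  apply (continuous_plus (fun x => (p * (1 - (1 - x) / 2) - q * ((1 - x) / 2)) * g ((1 - x) / 2))).
  + apply (continuous_mult (fun x => (p * (1 - (1 - x) / 2) - q * ((1 - x) / 2)))); auto.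
    apply (ex_derive_continuous (fun x => (p * (1 - (1 - x) / 2) - q * ((1 - x) / 2)))). now auto_derive.
  + apply (continuous_mult (fun x => ((1 - x) / 2) * (1 - (1 - x) / 2))).
    apply (ex_derive_continuous (fun x => ((1 - x) / 2) * (1 - (1 - x) / 2))). now auto_derive.
    apply (continuous_comp (fun x => (1 - x) / 2) g1).
    apply (ex_derive_continuous (fun x => (1 - x) / 2)). eexists; apply D0. apply Hg1; lra.
- apply Hlim; auto. apply filter_imp with (2 := ends_lo _ _ _ ends_m1_1 0 ltac:(lra)). tauto.
  replace (locally 0) with (locally (M * (Rpower ((1 - (-1)) / 2) p * 0))) by (f_equal; ring).
  apply (filterlim_comp _ _ _ (fun x => Rpower ((1 - x) / 2) p * Rpower ((1 + x) / 2) q) (fun t => M * t) _ (locally (Rpower ((1 - (-1)) / 2) p * 0))).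
  2: apply (filterlim_scal_r (V := R_NormedModule) M).
  apply (filterlim_comp_2 (G := locally (Rpower ((1 - (-1)) / 2) p)) (H := locally 0) (fun x => Rpower ((1 - x) / 2) p) (fun x => Rpower ((1 + x) / 2) q) Rmult).
  + apply (filterlim_at_right_of_continuous (fun x => Rpower ((1 - x) / 2) p)).
    apply (continuous_Rpower_comp (fun x => (1 - x) / 2)); try lra.
    apply (ex_derive_continuous (fun x => (1 - x) / 2)). eexists; apply D0.
  + apply (filterlim_comp _ _ _ (fun x => (1 + x) / 2) (fun t => Rpower t q) _ (at_right 0)).
    apply filterlim_right_coord. now apply filterlim_Rpower_0.
  + apply (filterlim_mult (K := R_AbsRing)).
- apply Hlim; auto. apply filter_imp with (2 := ends_hi _ _ _ ends_m1_1 0 ltac:(lra)). tauto.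
  replace (locally 0) with (locally (M * (0 * Rpower ((1 + 1) / 2) q))) by (f_equal; ring).
  apply (filterlim_comp _ _ _ (fun x => Rpower ((1 - x) / 2) p * Rpower ((1 + x) / 2) q) (fun t => M * t) _ (locally (0 * Rpower ((1 + 1) / 2) q))).
  2: apply (filterlim_scal_r (V := R_NormedModule) M).
  apply (filterlim_comp_2 (G := locally 0) (H := locally (Rpower ((1 + 1) / 2) q)) (fun x => Rpower ((1 - x) / 2) p) (fun x => Rpower ((1 + x) / 2) q) Rmult).
  + apply (filterlim_comp _ _ _ (fun x => (1 - x) / 2) (fun t => Rpower t p) _ (at_right 0)).
    apply filterlim_left_coord. now apply filterlim_Rpower_0.
  + apply (filterlim_at_left_of_continuous (fun x => Rpower ((1 + x) / 2) q)).
    apply (continuous_Rpower_comp (fun x => (1 + x) / 2)); try lra.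
    apply (ex_derive_continuous (fun x => (1 + x) / 2)). now auto_derive.
  + apply (filterlim_mult (K := R_AbsRing)).
Qed.

Lemma beta_weight_succ_l p q x : -1 < x < 1 -> beta_weight (p + 1) q x = (1 - x) / 2 * beta_weight p q x.
Proof.
intros Hx. unfold beta_weight. rewrite (Rpower_S _ (p + 1 - 1)) by lra.
replace (p + 1 - 1 - 1) with (p - 1) by ring. field.
Qed.

Lemma beta_weight_succ_r p q x : -1 < x < 1 -> beta_weight p (q + 1) x = (1 - (1 - x) / 2) * beta_weight p q x.
Proof.
intros Hx. unfold beta_weight. rewrite (Rpower_S _ (q + 1 - 1)) by lra.
replace (q + 1 - 1 - 1) with (q - 1) by ring. field.
Qed.

(** The sum of the two shifted integrals is the original one, and integration
    by parts with [g = 1] gives their ratio. *)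
Lemma RBeta_succ p q : 0 < p -> 0 < q ->
  RBeta (p + 1) q = p / (p + q) * RBeta p q /\ RBeta p (q + 1) = q / (p + q) * RBeta p q.
Proof.
intros Hp Hq.
assert (P1 := ends_Fa _ _ _ ends_m1_1). assert (P2 := ends_Fb _ _ _ ends_m1_1).
assert (Hp1 : 0 < p + 1) by lra. assert (Hq1 : 0 < q + 1) by lra.
assert (I0 := is_RBeta p q Hp Hq). assert (I1 := is_RBeta (p + 1) q Hp1 Hq).
assert (I2 := is_RBeta p (q + 1) Hp Hq1).
assert (E1 : RBeta (p + 1) q + RBeta p (q + 1) = RBeta p q).
{ apply (RInt_gen_eq _ _ _ ends_m1_1 (beta_weight p q)); auto.
  apply (is_RInt_gen_ext_ends _ _ _ _ ends_m1_1) with (2 := is_RInt_gen_plus _ _ _ _ I1 I2).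
  intros x Hx. rewrite beta_weight_succ_l, beta_weight_succ_r by auto. unfold plus; simpl. ring. }
assert (E2 : p * RBeta p (q + 1) - q * RBeta (p + 1) q = 0).
{ apply (RInt_gen_eq _ _ _ ends_m1_1) with
    (1 := is_RInt_gen_minus _ _ _ _ (is_RInt_gen_scal _ p _ I2) (is_RInt_gen_scal _ q _ I1)).
  apply (is_RInt_gen_ext_ends _ _ _ _ ends_m1_1) with 
    (2 := beta_weight_parts p q (fun _ => 1) (fun _ => 0) 1 Hp Hq
       (fun y _ => is_derive_const 1 y) (fun y _ => continuous_const 0 y) 
       (fun y _ => Req_le _ _ Rabs_R1)).
  intros x Hx. rewrite beta_weight_succ_l, beta_weight_succ_r by auto.
  unfold plus, minus, opp, scal; simpl; unfold mult; simpl. unfold plus; simpl. field. }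
assert (Hpq : p + q <> 0) by lra.
split.
- apply Rmult_eq_reg_l with (p + q); auto. replace ((p + q) * (p / (p + q) * RBeta p q)) with (p * RBeta p q) by (field; auto).
  rewrite <- E1. lra.
- apply Rmult_eq_reg_l with (p + q); auto. replace ((p + q) * (q / (p + q) * RBeta p q)) with (q * RBeta p q) by (field; auto).
  rewrite <- E1. lra.
Qed.

Lemma RBeta_1 q : 0 < q -> RBeta 1 q = / q.
Proof.
intros Hq. apply (RInt_gen_eq _ _ _ ends_m1_1 (beta_weight 1 q)).
apply is_RBeta; lra.
replace (/ q) with (/ q * Rpower ((1 + 1) / 2) q - / q * 0).
2:{ replace ((1 + 1) / 2) with 1 by field. unfold Rpower. rewrite ln_1, Rmult_0_r, exp_0. ring. }
apply (is_RInt_gen_primitive _ _ _ ends_m1_1 (fun x => / q * Rpower ((1 + x) / 2) q)).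
- intros x Hx. evar_last. apply (is_derive_scal (fun x => Rpower ((1 + x) / 2) q)).
  apply (is_derive_Rpower_comp (fun x => (1 + x) / 2) q x (/ 2)); try lra. auto_derive; auto; field.
  unfold beta_weight. rewrite Rminus_diag, Rpower_O by lra. simpl. field. lra.
- intros x Hx. now apply continuous_beta_weight.
- apply (filterlim_comp _ _ _ (fun x => Rpower ((1 + x) / 2) q) (fun t => / q * t) _ (locally 0)).
  2: apply (filterlim_scal_r (V := R_NormedModule) (/ q) 0).
  apply (filterlim_comp _ _ _ (fun x => (1 + x) / 2) (fun t => Rpower t q) _ (at_right 0)).
  apply filterlim_right_coord. now apply filterlim_Rpower_0.
- apply (filterlim_at_left_of_continuous (fun x => / q * Rpower ((1 + x) / 2) q)).
  apply (continuous_scal_r (/ q) (fun x => Rpower ((1 + x) / 2) q)).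
  apply (continuous_Rpower_comp (fun x => (1 + x) / 2)); try lra.
  apply (ex_derive_continuous (fun x => (1 + x) / 2)). now auto_derive.
Qed.

Lemma RBeta_log_convex s q theta : 0 < s -> 0 < q -> 0 <= theta <= 1 ->
  RBeta (s + theta) q <= Rpower (s / (s + q)) theta * RBeta s q.
Proof.
intros Hs Hq Hth.
set (tau := s / (s + q)). assert (Htau : 0 < tau) by (apply Rdiv_lt_0_compat; lra).
assert (Hs1 : 0 < s + 1) by lra. assert (Hs2 : 0 < s + theta) by lra.
assert (H1 := is_RBeta s q Hs Hq). assert (H2 := is_RBeta (s + 1) q Hs1 Hq).
assert (H3 := is_RBeta (s + theta) q Hs2 Hq).
assert (P1 := ends_Fa _ _ _ ends_m1_1). assert (P2 := ends_Fb _ _ _ ends_m1_1).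
assert (H4 := is_RInt_gen_plus _ _ _ _ (is_RInt_gen_scal _ (Rpower tau theta * (1 - theta)) _ H1)
   (is_RInt_gen_scal _ (Rpower tau theta * (theta / tau)) _ H2)).
replace (Rpower tau theta * RBeta s q) with
  (plus (scal (Rpower tau theta * (1 - theta)) (RBeta s q)) (scal (Rpower tau theta * (theta / tau)) (RBeta (s + 1) q))).
2:{ rewrite (proj1 (RBeta_succ s q Hs Hq)). fold tau. unfold plus, scal; simpl; unfold mult; simpl. field. lra. }
apply (is_RInt_gen_le _ _ _ ends_m1_1 _ _ _ _) with (4 := H3) (5 := H4).
- intros x Hx. unfold plus, scal; simpl; unfold mult; simpl. rewrite beta_weight_succ_l by auto.
  assert (Hy : 0 < (1 - x) / 2) by lra.
  assert (A := Rpower_le_tangent ((1 - x) / 2) tau theta Hy Htau Hth).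
  apply Rle_trans with (Rpower tau theta * (1 - theta + theta * ((1 - x) / 2 / tau)) * beta_weight s q x).
  + replace (beta_weight (s + theta) q x) with (Rpower ((1 - x) / 2) theta * beta_weight s q x).
    apply Rmult_le_compat_r; auto. apply Rlt_le, beta_weight_pos.
    unfold beta_weight. replace (s + theta - 1) with (theta + (s - 1)) by ring. rewrite Rpower_plus. field.
  + right. field. lra.
- intros; now apply continuous_beta_weight.
- intros x Hx. apply (continuous_plus (fun x => scal _ (beta_weight s q x)));
  apply (continuous_scal_r _ (beta_weight _ _)); now apply continuous_beta_weight.
Qed.

(** The quotient of the two sides of Euler's identity: it has period 1 in [p]. *)
Definition euler_quotient (p q : R) : R := RGamma p * RGamma q / (RGamma (p + q) * RBeta p q).

Lemma euler_quotient_succ p q : 0 < p -> 0 < q -> euler_quotient (p + 1) q = euler_quotient p q.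
Proof.
intros Hp Hq. unfold euler_quotient.
replace (p + 1 + q) with (p + q + 1) by ring.
rewrite !RGamma_succ by lra. rewrite (proj1 (RBeta_succ p q Hp Hq)).
assert (G1 : 0 < RGamma (p + q)) by (apply RGamma_pos; lra). assert (B := RBeta_pos p q Hp Hq).
field. repeat split; lra.
Qed.

Lemma euler_quotient_nat p q n : 0 < p -> 0 < q -> euler_quotient (p + INR n) q = euler_quotient p q.
Proof.
intros Hp Hq. induction n as [|n IH]; [simpl; now rewrite Rplus_0_r|].
rewrite S_INR, <- Rplus_assoc, euler_quotient_succ; auto. assert (H := pos_INR n); lra.
Qed.

Lemma Rpower_1mul t theta : 0 < t -> Rpower t theta * Rpower t (1 - theta) = t.
Proof. intros Ht. rewrite <- Rpower_plus. replace (theta + (1 - theta)) with 1 by ring. now apply Rpower_1. Qed.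

(** Interpolating the recurrences by log-convexity costs only a factor that
    tends to 1 as [s] grows; periodicity then removes it. *)
Lemma euler_quotient_step s q theta : 0 < s -> 0 < q -> 0 <= theta <= 1 ->
  euler_quotient (s + theta) q <= (s + theta) / s * euler_quotient s q.
Proof.
intros Hs Hq Hth.
assert (G1 := RGamma_pos s Hs). assert (G2 := RGamma_pos q Hq).
assert (G3 : 0 < RGamma (s + q)) by (apply RGamma_pos; lra).
assert (G4 : 0 < RGamma (s + theta + q)) by (apply RGamma_pos; lra).
assert (B1 := RBeta_pos s q Hs Hq). assert (B2 : 0 < RBeta (s + theta) q) by (apply RBeta_pos; lra).
assert (A1 := RGamma_log_convex s theta Hs Hth).
assert (A2 : (s + q) * RGamma (s + q) <= Rpower (s + theta + q) (1 - theta) * RGamma (s + theta + q)).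
{ rewrite <- RGamma_succ by lra. replace (s + q + 1) with (s + theta + q + (1 - theta)) by ring.
  apply RGamma_log_convex; lra. }
assert (A3 : s / (s + q) * RBeta s q <= Rpower ((s + theta) / (s + theta + q)) (1 - theta) * RBeta (s + theta) q).
{ rewrite <- (proj1 (RBeta_succ s q Hs Hq)). replace (s + 1) with (s + theta + (1 - theta)) by ring.
  apply RBeta_log_convex; lra. }
assert (A4 : Rpower (s + theta + q) (1 - theta) * Rpower ((s + theta) / (s + theta + q)) (1 - theta) = Rpower (s + theta) (1 - theta)).
{ rewrite Rpower_mult_distr; try lra. f_equal. field. lra. apply Rdiv_lt_0_compat; lra. }
assert (A5 := Rpower_1mul s theta Hs).
assert (A6 : Rpower (s + theta) (1 - theta) * s <= (s + theta) * Rpower s (1 - theta)).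
{ assert (T : Rpower ((s + theta) / s) (1 - theta) <= (s + theta) / s).
  { assert (1 <= (s + theta) / s) by (apply Rle_div_r; lra).
    rewrite <- (Rpower_1 ((s + theta) / s)) at 2 by lra. apply Rle_Rpower; lra. }
  replace (s + theta) with (s * ((s + theta) / s)) at 1 by (field; lra).
  rewrite <- Rpower_mult_distr; try lra. 2: apply Rdiv_lt_0_compat; lra.
  assert (0 < Rpower s (1 - theta)) by apply Rpower_pos.
  replace ((s + theta) * Rpower s (1 - theta)) with (Rpower s (1 - theta) * ((s + theta) / s) * s) by (field; lra).
  apply Rmult_le_compat_r; try lra. apply Rmult_le_compat_l; lra. }
assert (P1 : 0 < Rpower s theta) by apply Rpower_pos.
assert (P2 : 0 < Rpower s (1 - theta)) by apply Rpower_pos.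
assert (P3 : 0 < Rpower (s + theta + q) (1 - theta)) by apply Rpower_pos.
assert (P4 : 0 < Rpower ((s + theta) / (s + theta + q)) (1 - theta)) by apply Rpower_pos.
assert (P5 : 0 < Rpower (s + theta) (1 - theta)) by apply Rpower_pos.
unfold euler_quotient.
assert (M : s * (RGamma (s + q) * RBeta s q) <= Rpower (s + theta) (1 - theta) * (RGamma (s + theta + q) * RBeta (s + theta) q)).
{ rewrite <- A4. 
  apply Rle_trans with ((s + q) * RGamma (s + q) * (s / (s + q) * RBeta s q)).
  - right; field; lra.
  - apply Rle_trans with (Rpower (s + theta + q) (1 - theta) * RGamma (s + theta + q) * (Rpower ((s + theta) / (s + theta + q)) (1 - theta) * RBeta (s + theta) q)).
    + apply Rmult_le_compat; auto.
      * apply Rlt_le, Rmult_lt_0_compat; lra.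
      * apply Rlt_le, Rmult_lt_0_compat; auto. apply Rdiv_lt_0_compat; lra.
    + right; ring. }
apply Rle_div_l. { apply Rmult_lt_0_compat; auto. }
replace ((s + theta) / s * (RGamma s * RGamma q / (RGamma (s + q) * RBeta s q)) * (RGamma (s + theta + q) * RBeta (s + theta) q))
 with (RGamma s * RGamma q * ((s + theta) * (RGamma (s + theta + q) * RBeta (s + theta) q) / (s * (RGamma (s + q) * RBeta s q)))) by (field; lra).
apply Rle_trans with (Rpower s theta * RGamma s * RGamma q).
{ apply Rmult_le_compat_r; lra. }
replace (Rpower s theta * RGamma s * RGamma q) with (RGamma s * RGamma q * Rpower s theta) by ring.
apply Rmult_le_compat_l. { apply Rlt_le, Rmult_lt_0_compat; auto. }
apply Rle_div_r. { repeat apply Rmult_lt_0_compat; auto. }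
set (U := RGamma (s + theta + q) * RBeta (s + theta) q) in *.
assert (HU : 0 < U) by (apply Rmult_lt_0_compat; auto).
apply Rle_trans with (Rpower s theta * (Rpower (s + theta) (1 - theta) * U)).
{ apply Rmult_le_compat_l; lra. }
rewrite <- Rmult_assoc. apply Rmult_le_compat_r; try lra.
apply Rmult_le_reg_r with s; auto.
replace ((s + theta) * s) with (Rpower s theta * ((s + theta) * Rpower s (1 - theta))).
{ rewrite Rmult_assoc. apply Rmult_le_compat_l; lra. }
transitivity ((s + theta) * (Rpower s theta * Rpower s (1 - theta))); [ring|now rewrite A5].
Qed.

Lemma euler_quotient_le p q theta : 0 < p -> 0 < q -> 0 <= theta <= 1 ->
  euler_quotient (p + theta) q <= euler_quotient p q.
Proof.
intros Hp Hq Hth.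
assert (H : is_lim_seq (fun n => (1 + theta * / (INR n + p)) * euler_quotient p q) ((1 + theta * 0) * euler_quotient p q)).
{ apply (is_lim_seq_scal_r _ (euler_quotient p q) (Finite (1 + theta * 0))).
  apply (is_lim_seq_plus' (fun _ => 1)). apply is_lim_seq_const.
  apply (is_lim_seq_scal_l _ theta (Finite 0)).
  assert (H : is_lim_seq (fun n => INR n + p) p_infty).
  { apply (is_lim_seq_plus _ _ p_infty (Finite p)). apply is_lim_seq_INR. apply is_lim_seq_const. easy. }
  apply (is_lim_seq_inv _ _ H). easy. }
replace (euler_quotient p q) with ((1 + theta * 0) * euler_quotient p q) by ring.
assert (C := is_lim_seq_const (euler_quotient (p + theta) q)).
apply (is_lim_seq_le _ _ _ _) with (2 := C) (3 := H).
intros n. assert (Hn := pos_INR n).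
rewrite <- (euler_quotient_nat (p + theta) q n) by lra. rewrite <- (euler_quotient_nat p q n) by lra.
replace (p + theta + INR n) with (p + INR n + theta) by ring.
replace (1 + theta * / (INR n + p)) with ((p + INR n + theta) / (p + INR n)) by (field; lra).
apply euler_quotient_step; lra.
Qed.

(** Monotone and of period 1 in [p], the quotient is constant; at [p = 1] it
    equals 1. *)
Lemma RBeta_RGamma p q : 0 < p -> 0 < q -> RBeta p q * RGamma (p + q) = RGamma p * RGamma q.
Proof.
intros Hp Hq.
assert (Hc : forall r theta, 0 < r -> 0 <= theta <= 1 -> euler_quotient (r + theta) q = euler_quotient r q).
{ intros r th Hr Hth. apply Rle_antisym. apply euler_quotient_le; auto.
  rewrite <- (euler_quotient_succ r) by auto. replace (r + 1) with (r + th + (1 - th)) by ring.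
  apply euler_quotient_le; lra. }
assert (Hd : forall n r delta, 0 < r -> 0 <= delta <= INR n -> euler_quotient (r + delta) q = euler_quotient r q).
{ induction n as [|n IH]; intros r de Hr Hde.
  - simpl in Hde. replace (r + de) with r by lra. auto.
  - rewrite S_INR in Hde. destruct (Rle_lt_dec de 1). apply Hc; lra.
    replace (r + de) with (r + (de - 1) + 1) by ring. rewrite euler_quotient_succ by lra.
    apply IH; lra. }
assert (E : euler_quotient p q = 1).
{ rewrite <- (euler_quotient_succ p) by auto. replace (p + 1) with (1 + p) by ring.
  destruct (INR_unbounded p) as [n Hn].
  rewrite (Hd n) by lra. unfold euler_quotient. rewrite RGamma_1, RBeta_1 by auto.
  replace (1 + q) with (q + 1) by ring. rewrite RGamma_succ by auto.
  assert (G := RGamma_pos q Hq). field. lra. }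
unfold euler_quotient in E.
assert (G1 : 0 < RGamma (p + q)) by (apply RGamma_pos; lra). assert (B := RBeta_pos p q Hp Hq).
assert (E2 : RGamma p * RGamma q / (RGamma (p + q) * RBeta p q) * (RGamma (p + q) * RBeta p q) = RGamma p * RGamma q) by (field; lra).
rewrite E in E2. lra.
Qed.

Lemma C_ext (z w : C) : Re z = Re w -> Im z = Im w -> z = w.
Proof. destruct z, w; simpl; intros; subst; auto. Qed.

(** * Complex-valued functions of a real variable *)

(** The derivative is taken componentwise, which gives access to the rules for
    real functions and supports products of complex-valued functions. *)
Definition Cderiv (f : R -> C) (x : R) (l : C) : Prop :=
  is_derive (fun t => Re (f t)) x (Re l) /\ is_derive (fun t => Im (f t)) x (Im l).

Lemma Cderiv_const c x : Cderiv (fun _ => c) x 0.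
Proof. split; [exact (is_derive_const (Re c) x)|exact (is_derive_const (Im c) x)]. Qed.

Lemma Cderiv_RtoC (g : R -> R) x l : is_derive g x l -> Cderiv (fun t => RtoC (g t)) x (RtoC l).
Proof. intros H; split; [exact H|exact (is_derive_const 0 x)]. Qed.

Lemma Cderiv_plus f g x lf lg : Cderiv f x lf -> Cderiv g x lg ->
  Cderiv (fun t => f t + g t)%C x (lf + lg)%C.
Proof.
intros [H1 H2] [H3 H4]. split.
apply (is_derive_plus (fun t => Re (f t)) (fun t => Re (g t))); auto.
apply (is_derive_plus (fun t => Im (f t)) (fun t => Im (g t))); auto.
Qed.

Lemma Cderiv_opp f x lf : Cderiv f x lf -> Cderiv (fun t => - f t)%C x (- lf)%C.
Proof.
intros [H1 H2]. split.
apply (is_derive_opp (fun t => Re (f t))); auto.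
apply (is_derive_opp (fun t => Im (f t))); auto.
Qed.

Lemma Cderiv_minus f g x lf lg : Cderiv f x lf -> Cderiv g x lg ->
  Cderiv (fun t => f t - g t)%C x (lf - lg)%C.
Proof. intros; apply Cderiv_plus; auto; now apply Cderiv_opp. Qed.

Lemma Cderiv_mult f g x lf lg : Cderiv f x lf -> Cderiv g x lg ->
  Cderiv (fun t => f t * g t)%C x (lf * g x + f x * lg)%C.
Proof.
intros [H1 H2] [H3 H4].
assert (HM : forall (u v : R -> R) du dv, is_derive u x du -> is_derive v x dv ->
   is_derive (fun t => u t * v t) x (du * v x + u x * dv)).
{ intros u v du dv Hu Hv. apply (is_derive_mult u v); auto. intros; apply Rmult_comm. }
split.
- evar_last. exact (is_derive_minus _ _ _ _ _ (HM _ _ _ _ H1 H3) (HM _ _ _ _ H2 H4)).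
  unfold minus, plus, opp, Re, Im; simpl. ring.
- evar_last. exact (is_derive_plus _ _ _ _ _ (HM _ _ _ _ H1 H4) (HM _ _ _ _ H2 H3)).
  unfold plus, Re, Im; simpl. ring.
Qed.

Lemma Cderiv_scal c f x lf : Cderiv f x lf -> Cderiv (fun t => c * f t)%C x (c * lf)%C.
Proof.
intros H. replace (c * lf)%C with (0 * f x + c * lf)%C by ring.
apply (Cderiv_mult (fun _ => c)); auto. apply Cderiv_const.
Qed.

Lemma Cderiv_comp f (g : R -> R) x lf lg : Cderiv f (g x) lf -> is_derive g x lg ->
  Cderiv (fun t => f (g t)) x (RtoC lg * lf)%C.
Proof.
intros [H1 H2] H. split.
- evar_last. apply (is_derive_comp (fun t => Re (f t)) g x _ _ H1 H).
  unfold scal, Re; simpl; unfold mult; simpl. ring.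
- evar_last. apply (is_derive_comp (fun t => Im (f t)) g x _ _ H2 H).
  unfold scal, Im; simpl; unfold mult; simpl. ring.
Qed.

Lemma Cderiv_eq f x l l' : Cderiv f x l -> l = l' -> Cderiv f x l'.
Proof. now intros H <-. Qed.

Definition Ccont (f : R -> C) (x : R) : Prop :=
  continuous (fun t => Re (f t)) x /\ continuous (fun t => Im (f t)) x.

Lemma Cderiv_cont f x l : Cderiv f x l -> Ccont f x.
Proof.
intros [H1 H2]. split.
apply (ex_derive_continuous (fun t => Re (f t))); eexists; eauto.
apply (ex_derive_continuous (fun t => Im (f t))); eexists; eauto.
Qed.

Lemma im_le_Cmod c : Rabs (Im c) <= Cmod c.
Proof. apply Rle_trans with (2 := Rmax_Cmod c). apply Rmax_r. Qed.

Lemma Cmod_le_Re_Im c : Cmod c <= Rabs (Re c) + Rabs (Im c).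
Proof.
replace c with (RtoC (Re c) + Ci * RtoC (Im c))%C at 1.
2:{ apply C_ext; simpl; ring. }
apply Rle_trans with (1 := Cmod_triangle _ _).
rewrite Cmod_mult, Cmod_Ci, !Cmod_R. lra.
Qed.

Lemma Ccont_bounded f a b : a <= b -> (forall x, a <= x <= b -> Ccont f x) ->
  exists M, 0 <= M /\ forall x, a <= x <= b -> Cmod (f x) <= M.
Proof.
intros Hab Hf.
assert (HB : forall u : R -> R, (forall x, a <= x <= b -> continuous u x) ->
  exists M, forall x, a <= x <= b -> Rabs (u x) <= M).
{ intros u Hu. destruct (continuity_ab_maj (fun x => Rabs (u x)) a b Hab) as [m [Hm _]].
  - intros c Hc. apply continuity_pt_filterlim. apply (continuous_comp u Rabs).
    now apply Hu. apply continuous_Rabs.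
  - exists (Rabs (u m)). exact Hm. }
destruct (HB (fun t => Re (f t))) as [M1 H1]. exact (fun x Hx => proj1 (Hf x Hx)).
destruct (HB (fun t => Im (f t))) as [M2 H2]. exact (fun x Hx => proj2 (Hf x Hx)).
exists (M1 + M2). split.
- assert (A1 := H1 a (conj (Rle_refl a) Hab)). assert (A2 := H2 a (conj (Rle_refl a) Hab)).
  assert (B1 := Rabs_pos (Re (f a))). assert (B2 := Rabs_pos (Im (f a))). lra.
- intros x Hx. specialize (H1 x Hx). specialize (H2 x Hx).
  assert (A := Cmod_le_Re_Im (f x)). simpl in *. lra.
Qed.

(** * Complex series *)

Definition is_Cseries (u : nat -> C) (s : C) : Prop :=
  is_series (fun n => Re (u n)) (Re s) /\ is_series (fun n => Im (u n)) (Im s).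

Lemma is_Cseries_unique u s : is_Cseries u s -> CSeries u = s.
Proof.
intros [H1 H2]. apply C_ext; simpl; now apply is_series_unique.
Qed.

Lemma is_Cseries_ext u v s : (forall n, u n = v n) -> is_Cseries u s -> is_Cseries v s.
Proof.
intros E [H1 H2]; split; [apply is_series_ext with (2 := H1)|apply is_series_ext with (2 := H2)];
intros; now rewrite E.
Qed.

Lemma is_Cseries_plus u v s t : is_Cseries u s -> is_Cseries v t ->
  is_Cseries (fun n => u n + v n)%C (s + t)%C.
Proof.
intros [H1 H2] [H3 H4]; split.
apply (is_series_plus (fun n => Re (u n)) (fun n => Re (v n))); auto.
apply (is_series_plus (fun n => Im (u n)) (fun n => Im (v n))); auto.
Qed.

Lemma is_Cseries_scal c u s : is_Cseries u s -> is_Cseries (fun n => c * u n)%C (c * s)%C.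
Proof.
intros [H1 H2]; split.
- apply (is_series_minus (fun n => Re c * Re (u n)) (fun n => Im c * Im (u n))).
  apply (is_series_scal_l (Re c) _ _ H1). apply (is_series_scal_l (Im c) _ _ H2).
- apply (is_series_plus (fun n => Re c * Im (u n)) (fun n => Im c * Re (u n))).
  apply (is_series_scal_l (Re c) _ _ H2). apply (is_series_scal_l (Im c) _ _ H1).
Qed.

Lemma is_Cseries_dominated u (b : nat -> R) : (forall n, Cmod (u n) <= b n) -> ex_series b ->
  is_Cseries u (CSeries u).
Proof.
intros H Hb. split; simpl; apply Series_correct; apply (ex_series_le (K := R_AbsRing) (V := R_CompleteNormedModule) _ b) with (2 := Hb); intros n;
 apply Rle_trans with (2 := H n). apply re_le_Cmod. apply im_le_Cmod.
Qed.

(** * Pochhammer symbols *)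

Lemma RtoC_S n : RtoC (INR (S n)) = (RtoC (INR n) + 1)%C.
Proof. now rewrite S_INR, RtoC_plus. Qed.

Lemma pochhammer_S z n : pochhammer z (S n) = (pochhammer z n * (z + INR n))%C.
Proof. reflexivity. Qed.

Lemma pochhammer_add z m n : pochhammer z (m + n) = (pochhammer z m * pochhammer (z + INR m) n)%C.
Proof.
induction n as [|n IH]. rewrite Nat.add_0_r; simpl; ring.
rewrite Nat.add_succ_r, !pochhammer_S, IH, plus_INR, RtoC_plus. ring.
Qed.

Lemma pochhammer_S_l z n : pochhammer z (S n) = (z * pochhammer (z + 1) n)%C.
Proof. change (S n) with (1 + n)%nat. rewrite pochhammer_add. simpl. ring. Qed.

Lemma pochhammer_pos c n : 0 < c -> exists r, 0 < r /\ pochhammer (RtoC c) n = RtoC r.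
Proof.
intros Hc. induction n as [|n [r [Hr IH]]]. exists 1; split; [lra|auto].
exists (r * (c + INR n)). split. apply Rmult_lt_0_compat; auto. assert (H := pos_INR n); lra.
rewrite pochhammer_S, IH, RtoC_mult, RtoC_plus. auto.
Qed.

Lemma RtoC_neq0 r : r <> 0 -> RtoC r <> RtoC 0.
Proof. intros H E. apply H. now apply RtoC_inj. Qed.

Lemma pochhammer_neq0 c n : 0 < c -> pochhammer (RtoC c) n <> 0.
Proof.
intros Hc. destruct (pochhammer_pos c n Hc) as [r [Hr ->]]. apply RtoC_neq0. lra.
Qed.

Lemma pochhammer_1 n : pochhammer 1 n = RtoC (INR (fact n)).
Proof.
induction n as [|n IH]; auto.
rewrite pochhammer_S, IH. change (fact (S n)) with ((S n) * fact n)%nat.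
rewrite mult_INR, RtoC_mult, RtoC_S. ring.
Qed.

Lemma fact_neq0 n : RtoC (INR (fact n)) <> 0.
Proof. apply RtoC_neq0. apply INR_fact_neq_0. Qed.

Lemma fact_S_C n : RtoC (INR (fact (S n))) = ((RtoC (INR n) + 1) * RtoC (INR (fact n)))%C.
Proof.
change (fact (S n)) with ((S n) * fact n)%nat. now rewrite mult_INR, RtoC_mult, RtoC_S.
Qed.

Lemma INR_S_neq0 n : (RtoC (INR n) + 1)%C <> 0.
Proof. rewrite <- RtoC_S. apply RtoC_neq0. now apply not_0_INR. Qed.

Lemma real_plus_nat_neq0 c n : 0 < c -> (RtoC c + RtoC (INR n))%C <> 0.
Proof. intros Hc. rewrite <- RtoC_plus. apply RtoC_neq0. assert (H := pos_INR n). lra. Qed.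

Lemma pochhammer_double a k :
  pochhammer (2 * a) (2 * k) = (4 ^ k * pochhammer a k * pochhammer (a + / 2) k)%C.
Proof.
induction k as [|k IH]. simpl; ring.
replace (2 * S k)%nat with (S (S (2 * k))) by lia.
rewrite !pochhammer_S, IH, RtoC_S, mult_INR, RtoC_mult.
change (INR 2) with (1 + 1). rewrite RtoC_plus.
change ((4 ^ S k)%C) with (4 * 4 ^ k)%C. field.
Qed.

(** * Coefficient sequences of subexponential growth *)

(** A growth class closed under products, shifts and differentiation, whose
    power series all converge on (-1, 1). *)
Definition subexp (h : nat -> C) : Prop :=
  forall q, 1 < q -> exists M, 0 <= M /\ forall n, Cmod (h n) <= M * q ^ n.

Lemma subexp_scal c h : subexp h -> subexp (fun n => c * h n)%C.
Proof.
intros H q Hq. destruct (H q Hq) as [M [M0 HM]]. exists (Cmod c * M). assert (C0 := Cmod_ge_0 c).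
split. now apply Rmult_le_pos. intros n. rewrite Cmod_mult, Rmult_assoc. apply Rmult_le_compat_l; auto.
Qed.

Lemma subexp_mult g h : subexp g -> subexp h -> subexp (fun n => g n * h n)%C.
Proof.
intros Hg Hh q Hq.
assert (Hs : 1 < sqrt q) by (rewrite <- sqrt_1; apply sqrt_lt_1; lra).
destruct (Hg _ Hs) as [M [M0 HM]]. destruct (Hh _ Hs) as [N [N0 HN]].
exists (M * N). split. now apply Rmult_le_pos.
intros n. rewrite Cmod_mult.
replace (M * N * q ^ n) with ((M * sqrt q ^ n) * (N * sqrt q ^ n)).
apply Rmult_le_compat; auto; apply Cmod_ge_0.
rewrite <- (sqrt_sqrt q) at 3 by lra. rewrite Rpow_mult_distr. ring.
Qed.

Lemma subexp_shift h : subexp h -> subexp (fun n => h (S n)).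
Proof.
intros H q Hq. destruct (H q Hq) as [M [M0 HM]]. exists (M * q). split.
apply Rmult_le_pos; lra. intros n. rewrite Rmult_assoc. apply HM.
Qed.

Lemma subexp_ext g h : (forall n, g n = h n) -> subexp g -> subexp h.
Proof.
intros E H q Hq. destruct (H q Hq) as [M [M0 HM]]. exists M. split; auto.
intros n. rewrite <- E. apply HM.
Qed.

(** Consecutive ratios [(p + n) / (c + n)] tend to 1: they are at most [q] from
    some rank [N] on, and at most [L] before. *)
Lemma subexp_pochhammer p c : 0 < c -> subexp (fun n => pochhammer p n / pochhammer (RtoC c) n)%C.
Proof.
intros Hc q Hq.
assert (P0 := Cmod_ge_0 p).
set (L := Cmod p / c + 1). 
assert (L1 : 1 <= L). { assert (0 <= Cmod p / c) by (apply Rdiv_le_0_compat; auto). unfold L; lra. }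
destruct (INR_unbounded (Cmod p / (q - 1))) as [N HN].
assert (HL : forall n, 0 <= L ^ n) by (intros; apply pow_le; lra).
assert (Hqn : forall n, 0 <= q ^ n) by (intros; apply pow_le; lra).
exists (L ^ N). split; auto.
assert (H : forall n, Cmod (pochhammer p n / pochhammer (RtoC c) n) <= L ^ (min n N) * q ^ n).
{ induction n as [|n IH].
  - simpl. replace (1 / 1)%C with (RtoC 1) by field. rewrite Cmod_1. lra.
  - rewrite !pochhammer_S.
    replace (pochhammer p n * (p + INR n) / (pochhammer (RtoC c) n * (RtoC c + INR n)))%C
      with ((pochhammer p n / pochhammer (RtoC c) n) * ((p + INR n) / (RtoC c + INR n)))%C.
    2:{ field. split. now apply real_plus_nat_neq0. now apply pochhammer_neq0. }
    rewrite Cmod_mult. 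
    assert (Pn := pos_INR n).
    assert (Hr : Cmod ((p + INR n) / (RtoC c + INR n)) <= (Cmod p + INR n) / (c + INR n)).
    { rewrite Cmod_div by now apply real_plus_nat_neq0.
      rewrite <- RtoC_plus, Cmod_R, (Rabs_pos_eq (c + INR n)) by lra.
      apply Rmult_le_compat_r. apply Rlt_le, Rinv_0_lt_compat; lra.
      apply Rle_trans with (1 := Cmod_triangle _ _). rewrite Cmod_R, (Rabs_pos_eq (INR n)); lra. }
    assert (M0 := Cmod_ge_0 (pochhammer p n / pochhammer (RtoC c) n)).
    assert (M1 := Cmod_ge_0 ((p + INR n) / (RtoC c + INR n))).
    destruct (Nat.lt_ge_cases n N) as [H|H].
    + rewrite Nat.min_l in * by lia.
      assert (Hr2 : (Cmod p + INR n) / (c + INR n) <= L).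
      { apply Rle_div_l; try lra. unfold L.
        assert (Cmod p / c * c = Cmod p) by (field; lra).
        assert (0 <= Cmod p / c * INR n). { apply Rmult_le_pos; auto. apply Rdiv_le_0_compat; auto. }
        nra. }
      replace (L ^ S n * q ^ S n) with (L ^ n * q ^ n * (L * q)) by (simpl; ring).
      apply Rmult_le_compat; auto. apply Rle_trans with (1 := Hr). apply Rle_trans with (1 := Hr2). nra.
    + rewrite Nat.min_r in * by lia.
      assert (Hr2 : (Cmod p + INR n) / (c + INR n) <= q).
      { apply Rle_div_l; try lra. apply le_INR in H.
        assert (Cmod p <= (q - 1) * INR n). 
        { assert (Cmod p / (q - 1) <= INR n) by lra. apply Rle_div_l in H0; lra. }
        nra. }
      replace (L ^ N * q ^ S n) with (L ^ N * q ^ n * q) by (simpl; ring).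
      apply Rmult_le_compat; auto. apply Rle_trans with (1 := Hr); auto. }
intros n. apply Rle_trans with (1 := H n). apply Rmult_le_compat_r; auto.
apply Rle_pow; auto. apply Nat.le_min_r.
Qed.

Lemma subexp_binom p : subexp (fun n => pochhammer p n / INR (fact n))%C.
Proof.
apply subexp_ext with (2 := subexp_pochhammer p 1 ltac:(lra)). intros n; now rewrite pochhammer_1.
Qed.

Lemma subexp_succ : subexp (fun n => RtoC (INR (S n))).
Proof.
apply subexp_ext with (2 := subexp_binom 2). intros n. symmetry.
replace (pochhammer 2 n) with (RtoC (INR (fact (S n)))).
rewrite fact_S_C, RtoC_S. field. apply fact_neq0.
rewrite <- pochhammer_1, pochhammer_S_l. replace (1 + 1)%C with (RtoC 2). ring.
rewrite <- RtoC_plus; f_equal; ring.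
Qed.

(** * Complex power series of a real variable *)

Definition CPSeries (h : nat -> C) (z : R) : C := CSeries (fun n => h n * RtoC z ^ n)%C.
Definition CPderiv (h : nat -> C) (n : nat) : C := (RtoC (INR (S n)) * h (S n))%C.

Lemma subexp_CPderiv h : subexp h -> subexp (CPderiv h).
Proof. intros H. apply subexp_mult. apply subexp_succ. now apply subexp_shift. Qed.

Lemma subexp_geometric h z : subexp h -> 0 <= z < 1 ->
  exists M r, 0 <= M /\ 0 <= r < 1 /\ forall n, Cmod (h n) * z ^ n <= M * r ^ n.
Proof.
intros H Hz.
assert (Hq : 1 < 2 / (1 + z)) by (apply Rlt_div_r; lra).
destruct (H _ Hq) as [M [M0 HM]].
exists M, (2 / (1 + z) * z). split; auto. split. split.
apply Rmult_le_pos; lra. replace (2 / (1 + z) * z) with ((2 * z) / (1 + z)) by (field; lra).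
apply Rlt_div_l; lra.
intros n. rewrite Rpow_mult_distr, <- Rmult_assoc. apply Rmult_le_compat_r; auto. now apply pow_le.
Qed.

Lemma Rabs_lt_1 z : -1 < z < 1 -> 0 <= Rabs z < 1.
Proof. intros H. split. apply Rabs_pos. apply Rabs_def1; lra. Qed.

Lemma is_CPSeries h z : subexp h -> -1 < z < 1 ->
  is_Cseries (fun n => h n * RtoC z ^ n)%C (CPSeries h z).
Proof.
intros H Hz. destruct (subexp_geometric h (Rabs z) H (Rabs_lt_1 z Hz)) as [M [r [M0 [Hr HM]]]].
apply (is_Cseries_dominated _ (fun n => M * r ^ n)).
- intros n. rewrite Cmod_mult, Cmod_pow, Cmod_R. apply HM.
- apply (ex_series_scal_l (K := R_AbsRing) M (fun n => r ^ n)). apply ex_series_geom. rewrite Rabs_pos_eq; lra.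
Qed.

Lemma CPSeries_Re h z : Re (CPSeries h z) = PSeries (fun n => Re (h n)) z.
Proof.
change (Series (fun n => Re (h n * RtoC z ^ n)%C) = PSeries (fun n => Re (h n)) z).
apply Series_ext. intros n. now rewrite <- RtoC_pow, re_scal_r.
Qed.

Lemma CPSeries_Im h z : Im (CPSeries h z) = PSeries (fun n => Im (h n)) z.
Proof.
change (Series (fun n => Im (h n * RtoC z ^ n)%C) = PSeries (fun n => Im (h n)) z).
apply Series_ext. intros n. now rewrite <- RtoC_pow, im_scal_r.
Qed.

Lemma Cderiv_CPSeries h z : subexp h -> -1 < z < 1 -> Cderiv (CPSeries h) z (CPSeries (CPderiv h) z).
Proof.
intros H Hz. assert (Hz1 := Rabs_lt_1 z Hz).
assert (Hq : 1 < 2 / (1 + Rabs z)) by (apply Rlt_div_r; lra).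
destruct (H _ Hq) as [M [M0 HM]].
assert (HR : forall f : C -> R, (forall c, Rabs (f c) <= Cmod c) ->
   Rbar_lt (Rabs z) (CV_radius (fun n => f (h n)))).
{ intros f Hf. apply Rbar_lt_le_trans with (Finite ((1 + Rabs z) / 2)); [simpl; lra|].
  apply (CV_radius_bounded (fun n => f (h n))). exists M. intros n.
  rewrite Rabs_mult, <- RPow_abs, (Rabs_pos_eq ((1 + Rabs z) / 2)) by lra.
  apply Rle_trans with (M * (2 / (1 + Rabs z)) ^ n * ((1 + Rabs z) / 2) ^ n).
  - apply Rmult_le_compat_r. apply pow_le; lra. apply Rle_trans with (2 := HM n). apply Hf.
  - rewrite Rmult_assoc, <- Rpow_mult_distr.
    replace (2 / (1 + Rabs z) * ((1 + Rabs z) / 2)) with 1 by (field; lra). rewrite pow1; lra. }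
split.
- apply is_derive_ext with (PSeries (fun n => Re (h n))). intros; now rewrite CPSeries_Re.
  rewrite CPSeries_Re. evar_last. apply is_derive_PSeries. apply (HR Re). apply re_le_Cmod.
  apply PSeries_ext. intros n. unfold PS_derive, CPderiv. now rewrite re_scal_l.
- apply is_derive_ext with (PSeries (fun n => Im (h n))). intros; now rewrite CPSeries_Im.
  rewrite CPSeries_Im. evar_last. apply is_derive_PSeries. apply (HR Im). apply im_le_Cmod.
  apply PSeries_ext. intros n. unfold PS_derive, CPderiv. now rewrite im_scal_l.
Qed.

Lemma is_Cseries_0 : is_Cseries (fun _ => RtoC 0) 0.
Proof.
assert (H : is_series (fun _ : nat => 0) 0).
{ apply (is_series_ext (fun n : nat => 0 * 0 ^ n)). intros n; exact (Rmult_0_l _).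
  assert (G := is_series_scal_l 0 _ _ (is_series_geom 0 ltac:(rewrite Rabs_R0; lra))).
  unfold scal in G; simpl in G; unfold mult in G; simpl in G. now rewrite Rmult_0_l in G. }
split; exact H.
Qed.

Lemma is_Cseries_decr_1 u s : is_Cseries u s -> is_Cseries (fun n => u (S n)) (s - u O)%C.
Proof.
intros [H1 H2]. split.
- apply (is_series_incr_1 (fun n => Re (u n))). evar_last. exact H1. unfold plus, Re; simpl. ring.
- apply (is_series_incr_1 (fun n => Im (u n))). evar_last. exact H2. unfold plus, Im; simpl. ring.
Qed.

(** Multiplication by the variable shifts the coefficients; this is how the
    differential equations below are read off the recurrences. *)
Lemma CPSeries_shift h g z : subexp g -> -1 < z < 1 -> g O = 0 -> (forall n, g (S n) = h n) ->
  CPSeries g z = (RtoC z * CPSeries h z)%C.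
Proof.
intros Hg Hz H0 HS.
assert (Hh : subexp h) by (apply subexp_ext with (2 := subexp_shift g Hg); auto).
assert (A := is_Cseries_decr_1 _ _ (is_CPSeries g z Hg Hz)).
assert (B := is_Cseries_scal (RtoC z) _ _ (is_CPSeries h z Hh Hz)).
assert (E : (CPSeries g z - g O * RtoC z ^ O)%C = (RtoC z * CPSeries h z)%C).
{ rewrite <- (is_Cseries_unique _ _ A). apply is_Cseries_unique.
  apply is_Cseries_ext with (2 := B). intros n. rewrite HS. simpl. ring. }
rewrite <- E, H0. simpl. ring.
Qed.

Lemma CPSeries_0 h : subexp h -> CPSeries h 0 = h O.
Proof.
intros Hh. assert (A := is_Cseries_decr_1 _ _ (is_CPSeries h 0 Hh ltac:(lra))).
assert (E : (CPSeries h 0 - h O * RtoC 0 ^ O)%C = 0).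
{ rewrite <- (is_Cseries_unique _ _ A). apply is_Cseries_unique.
  apply is_Cseries_ext with (2 := is_Cseries_0). intros n. simpl. ring. }
replace (CPSeries h 0) with ((CPSeries h 0 - h O * RtoC 0 ^ O) + h O)%C by (simpl; ring).
rewrite E. ring.
Qed.

Lemma CPSeries_lin3 a b c f g h z : -1 < z < 1 -> subexp f -> subexp g -> subexp h ->
  (forall n, a * f n + b * g n + c * h n = 0)%C ->
  (a * CPSeries f z + b * CPSeries g z + c * CPSeries h z = 0)%C.
Proof.
intros Hz Hf Hg Hh H.
assert (A := is_Cseries_plus _ _ _ _ (is_Cseries_plus _ _ _ _ 
  (is_Cseries_scal a _ _ (is_CPSeries f z Hf Hz)) (is_Cseries_scal b _ _ (is_CPSeries g z Hg Hz)))
  (is_Cseries_scal c _ _ (is_CPSeries h z Hh Hz))).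
rewrite <- (is_Cseries_unique _ _ A). apply is_Cseries_unique.
apply is_Cseries_ext with (2 := is_Cseries_0). intros n.
replace (a * (f n * RtoC z ^ n) + b * (g n * RtoC z ^ n) + c * (h n * RtoC z ^ n))%C
 with ((a * f n + b * g n + c * h n) * RtoC z ^ n)%C by ring.
rewrite H. ring.
Qed.

Lemma CPSeries_scal c f z : -1 < z < 1 -> subexp f -> CPSeries (fun n => c * f n)%C z = (c * CPSeries f z)%C.
Proof.
intros Hz Hf. apply is_Cseries_unique. 
apply is_Cseries_ext with (2 := is_Cseries_scal c _ _ (is_CPSeries f z Hf Hz)). intros; ring.
Qed.

(** * The hypergeometric equation *)

Definition hyp_coeff (a b : C) (c : R) (n : nat) : C :=
  (pochhammer a n * pochhammer b n / (pochhammer (RtoC c) n * INR (fact n)))%C.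

Lemma hyp2F1_CPSeries a b c z : hyp2F1 a b (RtoC c) (RtoC z) = CPSeries (hyp_coeff a b c) z.
Proof. reflexivity. Qed.

Lemma subexp_hyp_coeff a b c : 0 < c -> subexp (hyp_coeff a b c).
Proof.
intros Hc. apply subexp_ext with (2 := subexp_mult _ _ (subexp_pochhammer a c Hc) (subexp_binom b)).
intros n. unfold hyp_coeff. field. split. apply fact_neq0. now apply pochhammer_neq0.
Qed.

Lemma hyp_coeff_0 a b c : hyp_coeff a b c O = 1.
Proof. unfold hyp_coeff; simpl. field. Qed.

Lemma hyp_coeff_S a b c n : 0 < c ->
  ((RtoC (INR n) + 1) * (RtoC c + INR n) * hyp_coeff a b c (S n) = (a + INR n) * (b + INR n) * hyp_coeff a b c n)%C.
Proof.
intros Hc. unfold hyp_coeff. rewrite !pochhammer_S, fact_S_C. field.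
repeat split. apply fact_neq0. now apply pochhammer_neq0. apply INR_S_neq0. now apply real_plus_nat_neq0.
Qed.

Lemma hyp_coeff_deriv a b c n : 0 < c ->
  CPderiv (hyp_coeff a b c) n = (a * b / RtoC c * hyp_coeff (a + 1) (b + 1) (c + 1) n)%C.
Proof.
intros Hc. unfold CPderiv, hyp_coeff. rewrite fact_S_C, RtoC_S, !(pochhammer_S_l _ n), RtoC_plus.
field. repeat split. apply fact_neq0. rewrite <- RtoC_plus. apply pochhammer_neq0; lra.
apply RtoC_neq0; lra. apply INR_S_neq0.
Qed.

(** The equation collects, in each degree, the two-term recurrence
    [hyp_coeff_S] of the coefficients. *)
Lemma hyp_ode a b c z : 0 < c -> -1 < z < 1 ->
  let h := hyp_coeff a b c in
  (RtoC z * (1 - RtoC z) * CPSeries (CPderiv (CPderiv h)) z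
   + (RtoC c - (a + b + 1) * RtoC z) * CPSeries (CPderiv h) z = a * b * CPSeries h z)%C.
Proof.
intros Hc Hz h.
assert (Sh : subexp h) by now apply subexp_hyp_coeff.
assert (S1 := subexp_CPderiv _ Sh). assert (S2 := subexp_CPderiv _ S1).
set (g1 := fun n => (RtoC (INR n) * h n)%C).
set (g2 := fun n => (RtoC (INR n) * CPderiv h n)%C).
set (g3 := fun n => (RtoC (INR n) * (RtoC (INR n) - 1) * h n)%C).
assert (SN : subexp (fun n => RtoC (INR n))).
{ intros q Hq. destruct (subexp_succ q Hq) as [M [M0 HM]]. exists M; split; auto. intros n.
  apply Rle_trans with (2 := HM n). rewrite !Cmod_R, !Rabs_pos_eq by apply pos_INR. rewrite S_INR; lra. }
assert (SN1 : subexp (fun n => RtoC (INR n) - 1)%C).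
{ intros q Hq. destruct (subexp_succ q Hq) as [M [M0 HM]]. exists M; split; auto. intros n.
  apply Rle_trans with (2 := HM n). assert (Hn := pos_INR n). rewrite <- RtoC_minus, !Cmod_R. 
  rewrite S_INR, (Rabs_pos_eq (INR n + 1)) by lra. apply Rabs_le; lra. }
assert (Sg1 : subexp g1) by now apply subexp_mult.
assert (Sg2 : subexp g2) by now apply subexp_mult.
assert (Sg3 : subexp g3) by (apply subexp_mult; auto; now apply subexp_mult).
assert (E1 : CPSeries g1 z = (RtoC z * CPSeries (CPderiv h) z)%C).
{ apply CPSeries_shift; auto. unfold g1; simpl; ring. }
assert (E2 : CPSeries g2 z = (RtoC z * CPSeries (CPderiv (CPderiv h)) z)%C).
{ apply CPSeries_shift; auto. unfold g2; simpl; ring. }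
assert (E3 : CPSeries g3 z = (RtoC z * CPSeries g2 z)%C).
{ apply CPSeries_shift; auto. unfold g3; simpl; ring. intros n. unfold g3, g2, CPderiv. rewrite !RtoC_S. ring. }
assert (L1 := CPSeries_lin3 1 (RtoC c) (-1) g2 (CPderiv h) (fun n => (a + INR n) * (b + INR n) * h n)%C z Hz Sg2 S1).
assert (Sab : subexp (fun n => (a + INR n) * (b + INR n) * h n)%C).
{ apply subexp_ext with (fun n => (RtoC (INR n) + 1) * (RtoC c + INR n) * h (S n))%C.
  intros n. now apply hyp_coeff_S.
  apply subexp_ext with (fun n => 1 * CPderiv h n * (RtoC c + INR n))%C.
  intros n. unfold CPderiv. rewrite RtoC_S. ring.
  apply subexp_mult. apply subexp_scal, S1.
  intros q Hq. destruct (subexp_succ q Hq) as [M [M0 HM]]. exists ((c + 1) * M). split. apply Rmult_le_pos; lra.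
  intros n. rewrite Rmult_assoc. apply Rle_trans with ((c + 1) * Cmod (RtoC (INR (S n)))).
  assert (Hn := pos_INR n).
  rewrite <- RtoC_plus, !Cmod_R, !Rabs_pos_eq; rewrite ?S_INR; try lra. nra. apply Rmult_le_compat_l; auto; lra. }
specialize (L1 Sab).
assert (L2 := CPSeries_lin3 1 (a + b + 1) (a * b) g3 g1 h z Hz Sg3 Sg1 Sh).
assert (E4 : CPSeries (fun n => (a + INR n) * (b + INR n) * h n)%C z = (CPSeries g3 z + (a + b + 1) * CPSeries g1 z + a * b * CPSeries h z)%C).
{ assert (A := is_Cseries_plus _ _ _ _ (is_Cseries_plus _ _ _ _ 
    (is_CPSeries g3 z Sg3 Hz) (is_Cseries_scal (a + b + 1) _ _ (is_CPSeries g1 z Sg1 Hz)))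
    (is_Cseries_scal (a * b) _ _ (is_CPSeries h z Sh Hz))).
  apply is_Cseries_unique. apply is_Cseries_ext with (2 := A). intros n. unfold g3, g1. ring. }
rewrite E4, E3, E2, E1 in L1.
assert (L1' : (1 * (RtoC z * CPSeries (CPderiv (CPderiv h)) z) + RtoC c * CPSeries (CPderiv h) z +
 -1 * (RtoC z * (RtoC z * CPSeries (CPderiv (CPderiv h)) z) + (a + b + 1) * (RtoC z * CPSeries (CPderiv h) z) +
        a * b * CPSeries h z))%C = 0).
{ apply L1. intros n. assert (HS := hyp_coeff_S a b c n Hc). fold h in HS. rewrite <- HS. unfold g2, CPderiv. rewrite !RtoC_S. ring. }
apply Ceq_minus. rewrite <- L1'. ring.
Qed.

Ltac push_RtoC :=
  repeat (rewrite RtoC_plus || rewrite RtoC_minus || rewrite RtoC_mult || rewrite RtoC_opp || rewrite RtoC_pow).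

(** * Uniqueness at the singular point 0 *)

Lemma nondecreasing_of_derive (f f1 : R -> R) a b : a <= b ->
  (forall x, a <= x <= b -> is_derive f x (f1 x)) -> (forall x, a <= x <= b -> 0 <= f1 x) -> f a <= f b.
Proof.
intros Hab Hd Hp. destruct (MVT_gen f a b f1) as [x [Hx Hv]].
- intros x Hx. rewrite Rmin_left, Rmax_right in Hx by lra. apply Hd; lra.
- intros x Hx. rewrite Rmin_left, Rmax_right in Hx by lra.
  apply continuity_pt_filterlim. apply (ex_derive_continuous f). eexists. apply Hd; lra.
- rewrite Rmin_left, Rmax_right in Hx by lra. specialize (Hp x ltac:(lra)). nra.
Qed.

(** Comparison of derivatives from the left end, where only the limit of [f] is
    known; [g] is merely nonnegative, so it may be a real power of [z]. *)
Lemma le_of_derive_le (f f1 g g1 : R -> R) z1 :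
  (forall z, 0 < z <= z1 -> is_derive f z (f1 z)) ->
  (forall z, 0 < z <= z1 -> is_derive g z (g1 z)) ->
  (forall z, 0 < z <= z1 -> Rabs (f1 z) <= g1 z) -> (forall z, 0 < z <= z1 -> 0 <= g z) ->
  filterlim f (at_right 0) (locally 0) -> forall z, 0 < z <= z1 -> Rabs (f z) <= g z.
Proof.
intros Hf Hg Hb Hg0 Hl z Hz.
apply Rnot_lt_le. intros Hlt. set (d := Rabs (f z) - g z). assert (Hd : 0 < d) by (unfold d; lra).
assert (HP : locally 0 (fun y => Rabs y < d)).
{ exists (mkposreal _ Hd). intros y Hy. unfold ball in Hy; simpl in Hy; 
  unfold AbsRing_ball, abs, minus, plus, opp in Hy; simpl in Hy. now rewrite Ropp_0, Rplus_0_r in Hy. }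
specialize (Hl _ HP). unfold filtermap in Hl.
assert (P1 : ProperFilter (at_right 0)) by apply at_right_proper_filter.
destruct (filter_ex _ (filter_and _ _ Hl (ends_lo _ _ _ ends_half_line z (proj1 Hz)))) as [y [Hy [Hy0 Hyz]]].
assert (A1 : g y - f y <= g z - f z).
{ apply (nondecreasing_of_derive (fun x => g x - f x) (fun x => g1 x - f1 x)); auto.
  - intros x Hx. apply (is_derive_minus g f); [apply Hg|apply Hf]; lra.
  - intros x Hx. specialize (Hb x ltac:(lra)). apply Rabs_le_between in Hb. lra. }
assert (A2 : g y + f y <= g z + f z).
{ apply (nondecreasing_of_derive (fun x => g x + f x) (fun x => g1 x + f1 x)); auto.
  - intros x Hx. apply (is_derive_plus g f); [apply Hg|apply Hf]; lra.
  - intros x Hx. specialize (Hb x ltac:(lra)). apply Rabs_le_between in Hb. lra. }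
specialize (Hg0 y ltac:(lra)). apply Rabs_def2 in Hy. unfold d in Hy.
unfold Rabs in Hy; destruct Rcase_abs in Hy; lra.
Qed.

Lemma Cmod_le_of_Cderiv_le (f f1 : R -> C) (g g1 : R -> R) z1 :
  (forall z, 0 < z <= z1 -> Cderiv f z (f1 z)) ->
  (forall z, 0 < z <= z1 -> is_derive g z (g1 z)) ->
  (forall z, 0 < z <= z1 -> Cmod (f1 z) <= g1 z) -> (forall z, 0 < z <= z1 -> 0 <= g z) ->
  filterlim (fun z => Cmod (f z)) (at_right 0) (locally 0) ->
  forall z, 0 < z <= z1 -> Cmod (f z) <= 2 * g z.
Proof.
intros Hf Hg Hb Hg0 Hl z Hz.
assert (Hlim : forall u : C -> R, (forall c, Rabs (u c) <= Cmod c) -> filterlim (fun z => u (f z)) (at_right 0) (locally 0)).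
{ intros u Hu.
  assert (Hl' : filterlim (fun z => - Cmod (f z)) (at_right 0) (locally 0)).
  { exact (filterlim_comp _ _ _ _ Ropp _ (locally 0) _ Hl filterlim_Ropp_0). }
  apply (filterlim_le_le (F := at_right 0) (fun z => - Cmod (f z)) _ (fun z => Cmod (f z)) 0); auto.
  apply filter_forall. intros y. apply Rabs_le_between. apply Hu. }
apply Rle_trans with (1 := Cmod_le_Re_Im _).
assert (A1 : Rabs (Re (f z)) <= g z).
{ apply (le_of_derive_le (fun z => Re (f z)) (fun z => Re (f1 z)) g g1 z1); auto.
  - intros y Hy; now apply Hf.
  - intros y Hy. apply Rle_trans with (1 := re_le_Cmod _); auto.
  - apply (Hlim Re). apply re_le_Cmod. }
assert (A2 : Rabs (Im (f z)) <= g z).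
{ apply (le_of_derive_le (fun z => Im (f z)) (fun z => Im (f1 z)) g g1 z1); auto.
  - intros y Hy; now apply Hf.
  - intros y Hy. apply Rle_trans with (1 := im_le_Cmod _); auto.
  - apply (Hlim Im). apply im_le_Cmod. }
lra.
Qed.

Lemma Rpower_plus_nat x c n : 0 < x -> Rpower x (c + INR n) = Rpower x c * x ^ n.
Proof. intros Hx. now rewrite Rpower_plus, Rpower_pow. Qed.

Lemma is_derive_pow_id n x : is_derive (fun t => t ^ S n) x (INR (S n) * x ^ n).
Proof.
evar_last. apply (is_derive_pow (fun t => t) (S n) x 1). apply (is_derive_id (K := R_AbsRing)).
simpl pred. ring.
Qed.

Lemma filterlim_eq (f : R -> R) F (a b : R) : a = b -> filterlim f F (locally a) -> filterlim f F (locally b).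
Proof. now intros ->. Qed.

(** With [p = z^c (1-z)^(2-c)] and [q = z^(c-1) (1-z)^(1-c)] the equation reads
    [(p K')' = q e K].  Integrating from 0, where [p] vanishes, turns a bound
    [B (L z)^n / n!] for [K] into one of order [z^n] for [K'], and a second
    integration into the same bound for [K] with [n + 1].  Letting [n] grow
    leaves only 0. *)
Lemma hypergeometric_ode_unique (K K1 K2 : R -> C) (c : R) (e : C) z1 : 0 < c -> 0 < z1 < 1 ->
  (forall z, 0 <= z <= z1 -> Cderiv K z (K1 z)) ->
  (forall z, 0 <= z <= z1 -> Cderiv K1 z (K2 z)) ->
  (forall z, 0 <= z <= z1 -> (RtoC z * (1 - RtoC z) * K2 z + (RtoC c - 2 * RtoC z) * K1 z = e * K z)%C) ->
  K 0 = 0 -> forall z, 0 <= z <= z1 -> K z = 0.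
Proof.
intros Hc Hz1 HK HK1 Hode HK0.
destruct (Ccont_bounded K 0 z1) as [B [B0 HB]]; [lra|intros x Hx; eapply Cderiv_cont; now apply HK|].
destruct (Ccont_bounded K1 0 z1) as [D [D0 HD]]; [lra|intros x Hx; eapply Cderiv_cont; now apply HK1|].
set (p := fun z => Rpower z c * Rpower (1 - z) (2 - c)).
set (q := fun z => Rpower z (c - 1) * Rpower (1 - z) (1 - c)).
set (m := exp (- (Rabs (2 - c) * - ln (1 - z1)))).
set (M2 := exp (Rabs (2 - c) * - ln (1 - z1))).
set (M := exp (Rabs (1 - c) * - ln (1 - z1))).
assert (m0 : 0 < m) by apply exp_pos. assert (M0 : 0 < M) by apply exp_pos.
assert (M20 : 0 < M2) by apply exp_pos.
assert (Hm : forall z, 0 < z <= z1 -> m <= Rpower (1 - z) (2 - c) <= M2) by (intros; apply Rpower_bounds; lra).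
assert (HM : forall z, 0 < z <= z1 -> Rpower (1 - z) (1 - c) <= M) by (intros; apply Rpower_bounds; lra).
assert (Hpq : forall z, 0 < z <= z1 -> p z = q z * (z * (1 - z))).
{ intros z Hz. unfold p, q. rewrite (Rpower_S z c), (Rpower_S (1 - z) (2 - c)) by lra.
  replace (2 - c - 1) with (1 - c) by ring. ring. }
assert (Hp' : forall z, 0 < z <= z1 -> is_derive p z (q z * (c - 2 * z))).
{ intros z Hz. evar_last.
  apply (is_derive_mult (fun z => Rpower z c) (fun z => Rpower (1 - z) (2 - c))).
  apply is_derive_Rpower; lra. 
  apply (is_derive_Rpower_comp (fun z => 1 - z) (2 - c) z (-1)); try lra. auto_derive; auto; ring.
  intros; apply Rmult_comm.
  unfold plus, mult; simpl. unfold q. rewrite (Rpower_S z c), (Rpower_S (1 - z) (2 - c)) by lra.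
  replace (2 - c - 1) with (1 - c) by ring. ring. }
set (P := fun z => (RtoC (p z) * K1 z)%C).
assert (HP : forall z, 0 < z <= z1 -> Cderiv P z (RtoC (q z) * (e * K z))%C).
{ intros z Hz. eapply Cderiv_eq. apply (Cderiv_mult (fun z => RtoC (p z)) K1).
  apply Cderiv_RtoC. now apply Hp'. apply HK1; lra.
  rewrite <- Hode by lra. rewrite Hpq by auto. push_RtoC. ring. }
assert (HPlim : filterlim (fun z => Cmod (P z)) (at_right 0) (locally 0)).
{ apply (filterlim_le_le (F := at_right 0) (fun _ => 0) _ (fun z => (M2 * D) * Rpower z c) 0).
  - apply filter_imp with (2 := ends_lo _ _ _ ends_half_line z1 (proj1 Hz1)).
    intros z Hz. split. apply Cmod_ge_0. unfold P. rewrite Cmod_mult, Cmod_R.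
    rewrite Rabs_pos_eq by (unfold p; apply Rmult_le_pos; apply Rlt_le, Rpower_pos).
    unfold p. specialize (Hm z Hz). specialize (HD z ltac:(lra)).
    assert (C0 := Cmod_ge_0 (K1 z)). assert (R0 := Rpower_pos z c).
    replace (M2 * D * Rpower z c) with (Rpower z c * M2 * D) by ring.
    apply Rmult_le_compat; auto. apply Rmult_le_pos; lra. apply Rmult_le_compat_l; lra.
  - apply filterlim_const.
  - apply (filterlim_eq _ _ (M2 * D * 0) 0); [ring|].
    apply (filterlim_comp _ _ _ (fun t => Rpower t c) (fun t => M2 * D * t) _ (locally 0)).
    now apply filterlim_Rpower_0. apply (filterlim_scal_r (V := R_NormedModule) (M2 * D) 0). }
assert (HKlim : filterlim (fun z => Cmod (K z)) (at_right 0) (locally 0)).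
{ assert (HC := Cderiv_cont K 0 _ (HK 0 ltac:(lra))).
  assert (H1 := filterlim_at_right_of_continuous _ 0 (proj1 HC)).
  assert (H2 := filterlim_at_right_of_continuous _ 0 (proj2 HC)).
  apply (filterlim_le_le (F := at_right 0) (fun _ => 0) _ (fun z => Rabs (Re (K z)) + Rabs (Im (K z))) 0).
  - apply filter_forall. intros z. split. apply Cmod_ge_0. apply Cmod_le_Re_Im.
  - apply filterlim_const.
  - apply (filterlim_eq _ _ (Rabs (Re (K 0)) + Rabs (Im (K 0))) 0).
    { rewrite HK0; simpl. rewrite Rabs_R0; ring. }
    apply (filterlim_comp_2 (G := locally (Rabs (Re (K 0)))) (H := locally (Rabs (Im (K 0)))) 
      (fun z => Rabs (Re (K z))) (fun z => Rabs (Im (K z))) Rplus).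
    + apply (filterlim_comp _ _ _ (fun z => Re (K z)) Rabs _ (locally (Re (K 0)))); auto. apply continuous_Rabs.
    + apply (filterlim_comp _ _ _ (fun z => Im (K z)) Rabs _ (locally (Im (K 0)))); auto. apply continuous_Rabs.
    + apply (filterlim_plus (V := R_NormedModule)). }
set (E := Cmod e). assert (E0 : 0 <= E) by apply Cmod_ge_0.
set (L := 4 * M * E / (c * m)).
assert (L0 : 0 <= L). { unfold L. apply Rdiv_le_0_compat. nra. apply Rmult_lt_0_compat; auto. }
assert (HI : forall n z, 0 < z <= z1 -> Cmod (K z) <= B * L ^ n * z ^ n / INR (fact n)).
{ induction n as [|n IH].
  - intros z Hz. simpl. unfold Rdiv. rewrite Rinv_1, !Rmult_1_r. apply HB; lra.
  - assert (F0 : 0 < INR (fact n)) by apply INR_fact_lt_0.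
    assert (Ln : 0 <= L ^ n) by now apply pow_le.
    set (k1 := M * E * B * L ^ n / (INR (fact n) * c)).
    assert (k10 : 0 <= k1).
    { unfold k1. apply Rdiv_le_0_compat. repeat apply Rmult_le_pos; lra. now apply Rmult_lt_0_compat. }
    assert (S1 : forall z, 0 < z <= z1 -> Cmod (P z) <= 2 * (k1 * Rpower z (c + INR n))).
    { apply (Cmod_le_of_Cderiv_le P (fun z => (RtoC (q z) * (e * K z))%C) (fun z => k1 * Rpower z (c + INR n))
         (fun z => k1 * ((c + INR n) * Rpower z (c + INR n - 1)))); auto.
      - intros z Hz. apply (is_derive_scal (fun z => Rpower z (c + INR n))). apply is_derive_Rpower; lra.
      - intros z Hz. rewrite !Cmod_mult, Cmod_R. fold E.
        rewrite Rabs_pos_eq by (unfold q; apply Rmult_le_pos; apply Rlt_le, Rpower_pos).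
        replace (c + INR n - 1) with (c - 1 + INR n) by ring. rewrite Rpower_plus_nat by lra.
        unfold q. specialize (HM z Hz). specialize (IH z Hz).
        assert (R0 := Rpower_pos z (c - 1)). assert (R1 := Rpower_pos (1 - z) (1 - c)).
        assert (C0 := Cmod_ge_0 (K z)). assert (N0 := pos_INR n).
        assert (Z0 : 0 <= z ^ n) by (apply pow_le; lra).
        apply Rle_trans with (Rpower z (c - 1) * M * (E * (B * L ^ n * z ^ n / INR (fact n)))).
        + apply Rmult_le_compat; auto. apply Rmult_le_pos; lra. apply Rmult_le_pos; lra.
          apply Rmult_le_compat_l; lra. apply Rmult_le_compat_l; lra.
        + replace (Rpower z (c - 1) * M * (E * (B * L ^ n * z ^ n / INR (fact n)))) with
           (k1 * (c * (Rpower z (c - 1) * z ^ n))) by (unfold k1; field; lra).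
          apply Rmult_le_compat_l; auto. apply Rmult_le_compat_r; try lra. apply Rmult_le_pos; lra.
      - intros z Hz. apply Rmult_le_pos; auto. apply Rlt_le, Rpower_pos. }
    set (k2 := 2 * k1 / m).
    assert (k20 : 0 <= k2) by (unfold k2; apply Rdiv_le_0_compat; lra).
    assert (S2 : forall z, 0 < z <= z1 -> Cmod (K1 z) <= k2 * z ^ n).
    { intros z Hz. specialize (S1 z Hz). unfold P in S1. rewrite Cmod_mult, Cmod_R in S1.
      rewrite Rabs_pos_eq in S1 by (unfold p; apply Rmult_le_pos; apply Rlt_le, Rpower_pos).
      rewrite Rpower_plus_nat in S1 by lra. unfold p in S1. specialize (Hm z Hz).
      assert (R0 := Rpower_pos z c). assert (C0 := Cmod_ge_0 (K1 z)).
      apply Rmult_le_reg_l with (Rpower z c * m). now apply Rmult_lt_0_compat.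
      apply Rle_trans with (Rpower z c * Rpower (1 - z) (2 - c) * Cmod (K1 z)).
      - apply Rmult_le_compat_r; auto. apply Rmult_le_compat_l; lra.
      - apply Rle_trans with (1 := S1). right. unfold k2. field. lra. }
    assert (N1 : 0 < INR (S n)) by (apply lt_0_INR; lia).
    intros z Hz.
    assert (S3 : Cmod (K z) <= 2 * (k2 / INR (S n) * z ^ S n)).
    { apply (Cmod_le_of_Cderiv_le K K1 (fun z => k2 / INR (S n) * z ^ S n) (fun z => k2 * z ^ n) z1); auto.
      - intros y Hy. apply HK; lra.
      - intros y Hy. evar_last. apply (is_derive_scal (fun t => t ^ S n)). apply is_derive_pow_id. 
        field. lra.
      - intros y Hy. apply Rmult_le_pos. apply Rdiv_le_0_compat; lra. apply pow_le; lra. }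
    apply Rle_trans with (1 := S3). right. unfold k2, k1, L.
    change (fact (S n)) with (S n * fact n)%nat. rewrite mult_INR. rewrite <- !tech_pow_Rmult. field. 
    repeat split; lra. }
intros z Hz. destruct (Rle_lt_or_eq_dec 0 z (proj1 Hz)) as [Hz0| <-]; auto.
apply Cmod_eq_0. apply Rle_antisym; [|apply Cmod_ge_0].
assert (Hl : is_lim_seq (fun n => B * ((L * z) ^ n / INR (fact n))) (B * 0)).
{ apply (is_lim_seq_scal_l _ B 0). apply is_lim_seq_Reals. apply cv_speed_pow_fact. }
rewrite Rmult_0_r in Hl.
apply (is_lim_seq_le (fun _ => Cmod (K z)) _ (Cmod (K z)) 0) with (3 := Hl); [|apply is_lim_seq_const].
intros n. apply Rle_trans with (1 := HI n z ltac:(lra)). right. rewrite Rpow_mult_distr. unfold Rdiv; ring.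
Qed.

(** * The quadratic transformation *)

(** Both sides solve the hypergeometric equation with parameters [- beta],
    [beta + 1], [c] and take the value 1 at [z = 0], where [z = (1 - t) / 2] and
    [1 - t^2 = 4 z (1 - z)].  The restriction [t > 0] keeps [z] below the
    critical point 1/2 of [4 z (1 - z)]. *)
Lemma quadratic_transformation (c t : R) (beta : C) : 0 < c -> 0 < t < 1 ->
  CPSeries (hyp_coeff (- beta) (beta + 1) c) ((1 - t) / 2)
  = (RtoC (Rpower ((1 + t) / 2) (c - 1))
     * CPSeries (hyp_coeff ((RtoC c + beta) / 2) ((RtoC c - beta - 1) / 2) c) (1 - t ^ 2))%C.
Proof.
intros Hc Ht.
set (a := ((RtoC c + beta) / 2)%C). set (b := ((RtoC c - beta - 1) / 2)%C).
set (h := hyp_coeff (- beta) (beta + 1) c). set (g := hyp_coeff a b c).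
assert (Sh : subexp h) by now apply subexp_hyp_coeff. assert (Sg : subexp g) by now apply subexp_hyp_coeff.
assert (Sh1 := subexp_CPderiv _ Sh). assert (Sg1 := subexp_CPderiv _ Sg).
assert (Sh2 := subexp_CPderiv _ Sh1). assert (Sg2 := subexp_CPderiv _ Sg1).
set (X := fun z => 4 * z * (1 - z)). set (X1 := fun z => 4 * (1 - 2 * z)).
set (r := fun z => Rpower (1 - z) (c - 1)).
set (r1 := fun z => - (c - 1) * Rpower (1 - z) (c - 2)).
set (r2 := fun z => (c - 1) * (c - 2) * Rpower (1 - z) (c - 3)).
set (G0 := fun z => CPSeries g (X z)). set (G1 := fun z => CPSeries (CPderiv g) (X z)).
set (G2 := fun z => CPSeries (CPderiv (CPderiv g)) (X z)).
set (f0 := fun z => (RtoC (r z) * G0 z)%C).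
set (f1 := fun z => (RtoC (r1 z) * G0 z + RtoC (r z) * (RtoC (X1 z) * G1 z))%C).
set (f2 := fun z => (RtoC (r2 z) * G0 z + RtoC (r1 z) * (RtoC (X1 z) * G1 z)
   + (RtoC (r1 z) * (RtoC (X1 z) * G1 z) + RtoC (r z) * (RtoC (-8) * G1 z + RtoC (X1 z) * (RtoC (X1 z) * G2 z))))%C).
set (z1 := (1 - t) / 2).
assert (HX : forall z, 0 <= z <= z1 -> 0 <= X z < 1).
{ intros z Hz. unfold X, z1 in *. split; nra. }
assert (Dr : forall z, 0 <= z <= z1 -> is_derive r z (r1 z)).
{ intros z Hz. unfold z1 in Hz. evar_last.
  apply (is_derive_Rpower_comp (fun z => 1 - z) (c - 1) z (-1)); try lra. auto_derive; auto; ring.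
  unfold r1. replace (c - 1 - 1) with (c - 2) by ring. ring. }
assert (Dr1 : forall z, 0 <= z <= z1 -> is_derive r1 z (r2 z)).
{ intros z Hz. unfold z1 in Hz. evar_last.
  apply (is_derive_scal (fun z => Rpower (1 - z) (c - 2))).
  apply (is_derive_Rpower_comp (fun z => 1 - z) (c - 2) z (-1)); try lra. auto_derive; auto; ring.
  unfold r2. replace (c - 2 - 1) with (c - 3) by ring. simpl; ring. }
assert (DX : forall z, is_derive X z (X1 z)) by (intros; unfold X, X1; auto_derive; auto; ring).
assert (DX1 : forall z, is_derive X1 z (-8)) by (intros; unfold X1; auto_derive; auto; ring).
assert (DG0 : forall z, 0 <= z <= z1 -> Cderiv G0 z (RtoC (X1 z) * G1 z)%C).
{ intros z Hz. apply (Cderiv_comp (CPSeries g) X); auto. apply Cderiv_CPSeries; auto. specialize (HX z Hz). lra. }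
assert (DG1 : forall z, 0 <= z <= z1 -> Cderiv G1 z (RtoC (X1 z) * G2 z)%C).
{ intros z Hz. apply (Cderiv_comp (CPSeries (CPderiv g)) X); auto. apply Cderiv_CPSeries; auto. specialize (HX z Hz). lra. }
assert (Df0 : forall z, 0 <= z <= z1 -> Cderiv f0 z (f1 z)).
{ intros z Hz. apply (Cderiv_mult (fun z => RtoC (r z)) G0); auto. apply Cderiv_RtoC; auto. }
assert (Df1 : forall z, 0 <= z <= z1 -> Cderiv f1 z (f2 z)).
{ intros z Hz. apply (Cderiv_plus (fun z => RtoC (r1 z) * G0 z)%C).
  - apply (Cderiv_mult (fun z => RtoC (r1 z)) G0); auto. apply Cderiv_RtoC; auto.
  - apply (Cderiv_mult (fun z => RtoC (r z)) (fun z => RtoC (X1 z) * G1 z)%C); auto. apply Cderiv_RtoC; auto.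
    apply (Cderiv_mult (fun z => RtoC (X1 z)) G1); auto. apply Cderiv_RtoC; auto. }
assert (Hode : forall z, 0 <= z <= z1 -> (RtoC z * (1 - RtoC z) * f2 z + (RtoC c - 2 * RtoC z) * f1 z = - beta * (beta + 1) * f0 z)%C).
{ intros z Hz. 
  assert (H := hyp_ode a b c (X z) Hc ltac:(specialize (HX z Hz); lra)). cbv zeta in H.
  fold g in H. fold (G0 z) in H. fold (G1 z) in H. fold (G2 z) in H.
  unfold f2, f1, f0, r, r1, r2. unfold z1 in Hz.
  rewrite (Rpower_S (1 - z) (c - 1)), (Rpower_S (1 - z) (c - 1 - 1)) by lra.
  rewrite (Rpower_S (1 - z) (c - 2)) by lra.
  replace (c - 1 - 1 - 1) with (c - 3) by ring. replace (c - 2 - 1) with (c - 3) by ring.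
  set (s := Rpower (1 - z) (c - 3)). 
  revert H. generalize (G0 z) (G1 z) (G2 z). intros u0 u1 u2 H.
  apply Ceq_minus in H. apply Ceq_minus. 
  (* the equation for the right side is that of [g] at [X z], times [4 r z] *)
  rewrite <- (Cmult_0_r (4 * (1 - RtoC z) * (1 - RtoC z) * RtoC s)), <- H.
  unfold X, X1, a, b. push_RtoC. field. }
assert (Hode2 : forall z, 0 <= z <= z1 -> (RtoC z * (1 - RtoC z) * CPSeries (CPderiv (CPderiv h)) z + (RtoC c - 2 * RtoC z) * CPSeries (CPderiv h) z = - beta * (beta + 1) * CPSeries h z)%C).
{ intros z Hz. unfold z1 in Hz. assert (H := hyp_ode (- beta) (beta + 1) c z Hc ltac:(lra)). cbv zeta in H.
  fold h in H. rewrite <- H. ring. }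
assert (E : (CPSeries h z1 - f0 z1)%C = 0).
{ apply (hypergeometric_ode_unique (fun z => CPSeries h z - f0 z)%C (fun z => CPSeries (CPderiv h) z - f1 z)%C
    (fun z => CPSeries (CPderiv (CPderiv h)) z - f2 z)%C c (- beta * (beta + 1)) z1); auto.
  - unfold z1; lra.
  - intros z Hz. apply Cderiv_minus; auto. apply Cderiv_CPSeries; auto. unfold z1 in Hz; lra.
  - intros z Hz. apply Cderiv_minus; auto. apply Cderiv_CPSeries; auto. unfold z1 in Hz; lra.
  - intros z Hz. apply Ceq_minus. specialize (Hode z Hz). specialize (Hode2 z Hz).
    apply Ceq_minus in Hode. apply Ceq_minus in Hode2. rewrite <- (Cplus_opp_r 0). rewrite <- Hode2 at 1. rewrite <- Hode. ring.
  - unfold f0, G0, r, X. replace (4 * 0 * (1 - 0)) with 0 by ring. rewrite !CPSeries_0 by auto.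
    unfold h, g. rewrite !hyp_coeff_0. rewrite Rminus_0_r. unfold Rpower. rewrite ln_1, Rmult_0_r, exp_0. ring.
  - unfold z1; lra. }
apply Ceq_minus in E. rewrite E. unfold f0, r, G0, X, z1.
replace (1 - (1 - t) / 2) with ((1 + t) / 2) by field.
replace (4 * ((1 - t) / 2) * ((1 + t) / 2)) with (1 - t ^ 2) by (simpl; field). reflexivity.
Qed.

(** * Complex powers and the binomial series *)

Lemma Cexp_plus z w : Cexp (z + w) = (Cexp z * Cexp w)%C.
Proof.
destruct z as [z1 z2], w as [w1 w2].
unfold Cexp. apply C_ext; simpl; rewrite exp_plus, ?cos_plus, ?sin_plus; ring.
Qed.

Lemma Cexp_RtoC x : Cexp (RtoC x) = RtoC (exp x).
Proof. unfold Cexp. apply C_ext; simpl; rewrite ?cos_0, ?sin_0; ring. Qed.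

Lemma Cexp_neq0 z : Cexp z <> 0.
Proof.
intros H. assert (E : (Cexp z * Cexp (- z))%C = 1).
{ rewrite <- Cexp_plus, Cplus_opp_r, Cexp_RtoC, exp_0. auto. }
rewrite H, Cmult_0_l in E. apply RtoC_inj in E. lra.
Qed.

Lemma Cderiv_Cexp w x l : Cderiv w x l -> Cderiv (fun t => Cexp (w t)) x (l * Cexp (w x))%C.
Proof.
intros [H1 H2].
assert (He : is_derive (fun t => exp (Re (w t))) x (Re l * exp (Re (w x)))).
{ apply (is_derive_comp exp (fun t => Re (w t))); auto. apply is_derive_exp. }
assert (Hc : is_derive (fun t => cos (Im (w t))) x (Im l * - sin (Im (w x)))).
{ apply (is_derive_comp cos (fun t => Im (w t))); auto. apply is_derive_cos. }
assert (Hs : is_derive (fun t => sin (Im (w t))) x (Im l * cos (Im (w x)))).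
{ apply (is_derive_comp sin (fun t => Im (w t))); auto. apply is_derive_sin. }
split.
- evar_last. exact (is_derive_mult _ _ _ _ _ He Hc Rmult_comm).
  unfold Cexp, plus, mult, Re, Im; simpl. ring.
- evar_last. exact (is_derive_mult _ _ _ _ _ He Hs Rmult_comm).
  unfold Cexp, plus, mult, Re, Im; simpl. ring.
Qed.

Lemma cpow_plus x a b : cpow x (a + b) = (cpow x a * cpow x b)%C.
Proof. unfold cpow. rewrite <- Cexp_plus. f_equal. ring. Qed.

Lemma cpow_RtoC x p : cpow x (RtoC p) = RtoC (Rpower x p).
Proof. unfold cpow, Rpower. now rewrite <- RtoC_mult, Cexp_RtoC. Qed.

Lemma cpow_neq0 x a : cpow x a <> 0.
Proof. apply Cexp_neq0. Qed.

Lemma cpow_0 x : cpow x 0 = 1.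
Proof. unfold cpow. now rewrite Cmult_0_l, Cexp_RtoC, exp_0. Qed.

Lemma cpow_opp x a : cpow x (- a) = (/ cpow x a)%C.
Proof.
assert (E : (cpow x (- a) * cpow x a)%C = 1).
{ rewrite <- cpow_plus. replace (- a + a)%C with (RtoC 0) by ring. apply cpow_0. }
replace (/ cpow x a)%C with ((cpow x (- a) * cpow x a) * / cpow x a)%C. field. apply cpow_neq0.
rewrite E. ring.
Qed.

Lemma cpow_nat x n : 0 < x -> cpow x (RtoC (INR n)) = (RtoC x ^ n)%C.
Proof. intros Hx. rewrite cpow_RtoC, Rpower_pow, RtoC_pow; auto. Qed.

Lemma cpow_sqrt x a : 0 < x -> cpow (sqrt x) a = cpow x (a / 2).
Proof.
intros Hx. rewrite <- Rpower_sqrt by auto. unfold cpow, Rpower. rewrite ln_exp, RtoC_mult.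
f_equal. rewrite RtoC_inv. field. lra.
Qed.

Definition binom_coeff (a : C) (n : nat) : C := (pochhammer a n / INR (fact n))%C.

(** The series solves [(1-v) f' = a f], so its product with [(1-v)^a] is constant. *)
Lemma binomial_series a v : 0 <= v < 1 -> CPSeries (binom_coeff a) v = cpow (1 - v) (- a).
Proof.
intros Hv. set (h := binom_coeff a). assert (Sh : subexp h) by apply subexp_binom.
assert (Sh1 := subexp_CPderiv _ Sh).
assert (HS : forall n, ((RtoC (INR n) + 1) * h (S n) = (a + INR n) * h n)%C).
{ intros n. unfold h, binom_coeff. rewrite pochhammer_S, fact_S_C. field. split. apply fact_neq0. apply INR_S_neq0. }
assert (Hode : forall x, -1 < x < 1 -> ((1 - RtoC x) * CPSeries (CPderiv h) x = a * CPSeries h x)%C).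
{ intros x Hx. set (g := fun n => (RtoC (INR n) * h n)%C).
  assert (Sg : subexp g).
  { apply subexp_ext with (fun n => CPderiv h n + (- a) * h n)%C.
    intros n. unfold CPderiv, g. rewrite RtoC_S, HS. ring.
    intros q Hq. destruct (Sh1 q Hq) as [M [M0 HM]]. destruct (subexp_scal (- a) h Sh q Hq) as [N [N0 HN]].
    exists (M + N). split; [lra|]. intros n. apply Rle_trans with (1 := Cmod_triangle _ _).
    rewrite Rmult_plus_distr_r. apply Rplus_le_compat; auto. }
  assert (E1 : CPSeries g x = (RtoC x * CPSeries (CPderiv h) x)%C).
  { apply CPSeries_shift; auto. unfold g; simpl; ring. }
  assert (L := CPSeries_lin3 1 (-1) (- a) (CPderiv h) g h x Hx Sh1 Sg Sh).
  rewrite E1 in L. apply Ceq_minus. rewrite <- L. ring.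
  intros n. unfold CPderiv, g. rewrite RtoC_S, HS. ring. }
set (F := fun x => (CPSeries h x * cpow (1 - x) a)%C).
assert (DF : forall x, 0 <= x <= v -> Cderiv F x 0).
{ intros x Hx. eapply Cderiv_eq. apply (Cderiv_mult (CPSeries h) (fun x => cpow (1 - x) a)).
  apply Cderiv_CPSeries; auto; lra.
  apply (Cderiv_Cexp (fun x => a * RtoC (ln (1 - x)))%C x (a * RtoC (- / (1 - x)))%C).
  apply (Cderiv_scal a (fun x => RtoC (ln (1 - x)))). apply Cderiv_RtoC. auto_derive; try lra. 
  field; lra.
  fold (cpow (1 - x) a). specialize (Hode x ltac:(lra)).
  assert (N : (1 - RtoC x)%C <> 0). { rewrite <- RtoC_minus. apply RtoC_neq0; lra. }
  replace (CPSeries (CPderiv h) x) with (a * CPSeries h x / (1 - RtoC x))%C.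
  rewrite RtoC_opp, RtoC_inv, RtoC_minus by lra. field; auto. rewrite <- Hode. field; auto. }
assert (E : F v = F 0).
{ destruct (Rle_lt_or_eq_dec 0 v (proj1 Hv)) as [Hv0| <-]; auto. symmetry.
  apply C_ext.
  apply (eq_is_derive (fun x => Re (F x)) 0 v); auto. intros x Hx. apply (DF x Hx).
  apply (eq_is_derive (fun x => Im (F x)) 0 v); auto. intros x Hx. apply (DF x Hx). }
unfold F in E. rewrite CPSeries_0, Rminus_0_r in E by auto.
replace (cpow 1 a) with (RtoC 1) in E.
2:{ unfold cpow. rewrite ln_1, Cmult_0_r, Cexp_RtoC, exp_0. auto. }
rewrite cpow_opp. replace (CPSeries h v) with (CPSeries h v * cpow (1 - v) a / cpow (1 - v) a)%C by (field; apply cpow_neq0).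
rewrite E. unfold h, binom_coeff. simpl. field. apply cpow_neq0.
Qed.

(** * Rearranging a double series along its diagonals *)

(* The type of [sum_n] is a projection convertible to [R], which [ring] does not see through. *)
Ltac Rring := match goal with |- ?a = ?b => change (@eq R a b) end; ring.

Lemma sum_n_S (f : nat -> R) n : sum_n f (S n) = sum_n f n + f (S n).
Proof. exact (sum_Sn f n). Qed.

Lemma sum_n_0 (f : nat -> R) : sum_n f 0 = f 0%nat.
Proof. exact (sum_O f). Qed.

Lemma sum_n_le_loc (f g : nat -> R) N : (forall n, (n <= N)%nat -> f n <= g n) -> sum_n f N <= sum_n g N.
Proof.
induction N as [|N IH]; intros H. rewrite !sum_n_0. apply H; lia.
rewrite !sum_n_S. apply Rplus_le_compat. apply IH. intros; apply H; lia. apply H; lia.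
Qed.

Lemma sum_n_nonneg_mono (f : nat -> R) M N : (M <= N)%nat -> (forall n, 0 <= f n) -> sum_n f M <= sum_n f N.
Proof.
intros H Hf. induction H as [|N H IH]. lra. rewrite sum_n_S. specialize (Hf (S N)). lra.
Qed.

Lemma sum_n_Rabs (f : nat -> R) N : Rabs (sum_n f N) <= sum_n (fun n => Rabs (f n)) N.
Proof.
induction N as [|N IH]. rewrite !sum_n_0. lra.
rewrite !sum_n_S. apply Rle_trans with (1 := Rabs_triang _ _). lra.
Qed.

Lemma sum_n_plus_R (f g : nat -> R) N : sum_n (fun n => f n + g n) N = sum_n f N + sum_n g N.
Proof. exact (sum_n_plus f g N). Qed.

Lemma sum_n_ext_R (f g : nat -> R) N : (forall n, (n <= N)%nat -> f n = g n) -> sum_n f N = sum_n g N.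
Proof. intros H. exact (sum_n_ext_loc f g N H). Qed.

Lemma is_series_lim (x : nat -> R) X : is_series x X -> is_lim_seq (sum_n x) X.
Proof. auto. Qed.

Lemma sum_n_diag (A : nat -> nat -> R) M :
  sum_n (fun N => sum_n (fun n => A n (N - n)%nat) N) M = sum_n (fun n => sum_n (A n) (M - n)) M.
Proof.
induction M as [|M IH]. now rewrite !sum_n_0.
rewrite !sum_n_S, IH. rewrite Nat.sub_diag, sum_n_0.
rewrite (sum_n_ext_R (fun n => sum_n (A n) (S M - n)) (fun n => sum_n (A n) (M - n) + A n (S M - n)%nat) M).
2:{ intros n Hn. replace (S M - n)%nat with (S (M - n)) by lia. now rewrite sum_n_S. }
rewrite sum_n_plus_R. Rring.
Qed.

Lemma is_series_sum_le (b : nat -> R) B N : (forall n, 0 <= b n) -> is_series b B -> sum_n b N <= B.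
Proof.
intros Hb HB. apply (is_lim_seq_le (fun _ => sum_n b N) (fun n => sum_n b (n + N)) (sum_n b N) B).
- intros n. apply sum_n_nonneg_mono; auto; lia.
- apply is_lim_seq_const.
- apply (is_lim_seq_incr_n (sum_n b) N). apply is_series_lim, HB.
Qed.

(** [T M K] truncates the rows at distance [K] beyond the diagonal [M].  It
    differs from the triangle [T M 0] by entries on later diagonals only, hence
    by less than a tail of [b]; letting [K] and then [M] grow compares the sum
    of the rows with the sum of the diagonals. *)
Lemma is_series_diagonal (A : nat -> nat -> R) (row b : nat -> R) S :
  (forall n, is_series (A n) (row n)) -> is_series row S ->
  (forall N, sum_n (fun n => Rabs (A n (N - n)%nat)) N <= b N) -> ex_series b ->
  is_series (fun N => sum_n (fun n => A n (N - n)%nat) N) S.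
Proof.
intros Hrow HS Hb [B HB].
assert (b0 : forall n, 0 <= b n).
{ intros N. apply Rle_trans with (2 := Hb N). apply Rle_trans with (2 := sum_n_Rabs _ _). apply Rabs_pos. }
set (T := fun M K => sum_n (fun n => sum_n (A n) (M - n + K)) M).
assert (HT : forall M K, Rabs (T M K - T M O) <= sum_n b (M + K) - sum_n b M).
{ intros M. induction K as [|K IH].
  - rewrite Nat.add_0_r, !Rminus_diag, Rabs_R0. lra.
  - assert (E : T M (Datatypes.S K) = T M K + sum_n (fun n => A n (M + Datatypes.S K - n)%nat) M).
    { unfold T. rewrite <- sum_n_plus_R. apply sum_n_ext_R. intros n Hn.
      rewrite Nat.add_succ_r, sum_n_S. do 2 f_equal. lia. }
    rewrite E. replace (M + Datatypes.S K)%nat with (Datatypes.S (M + K)) by lia.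
    rewrite (sum_n_S b).
    set (y := sum_n (fun n => A n (Datatypes.S (M + K) - n)%nat) M).
    replace (T M K + y - T M O) with ((T M K - T M O) + y) by Rring.
    apply Rle_trans with (1 := Rabs_triang _ _).
    assert (H1 : Rabs y <= b (Datatypes.S (M + K))).
    { apply Rle_trans with (1 := sum_n_Rabs _ _). apply Rle_trans with (2 := Hb _).
      apply sum_n_nonneg_mono. lia. intros; apply Rabs_pos. }
    lra. }
assert (HT2 : forall M, Rabs (sum_n row M - T M O) <= B - sum_n b M).
{ intros M. 
  assert (L : is_lim_seq (fun K => T M K) (sum_n row M)).
  { assert (G : forall m k, (forall n, (n <= m)%nat -> (n <= k)%nat) -> is_lim_seq (fun K => sum_n (fun n => sum_n (A n) (k - n + K)) m) (sum_n row m)).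
    { induction m as [|m IHm]; intros k Hk.
      - rewrite sum_n_0. apply is_lim_seq_ext with (fun K => sum_n (A O) (K + (k - 0))).
        intros K. rewrite sum_n_0. f_equal. lia.
        apply (is_lim_seq_incr_n (sum_n (A O)) (k - 0)). apply is_series_lim, Hrow.
      - rewrite sum_n_S. apply is_lim_seq_ext with (fun K => sum_n (fun n => sum_n (A n) (k - n + K)) m + sum_n (A (Datatypes.S m)) (K + (k - Datatypes.S m))).
        intros K. rewrite sum_n_S. do 2 f_equal. lia.
        apply is_lim_seq_plus'. apply IHm. intros; apply Hk; lia.
        apply (is_lim_seq_incr_n (sum_n (A (Datatypes.S m))) (k - Datatypes.S m)). apply is_series_lim, Hrow. }
    apply (G M M); auto. }
  assert (L2 : is_lim_seq (fun K => Rabs (T M K - T M O)) (Rabs (sum_n row M - T M O))).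
  { apply (is_lim_seq_abs _ (Finite _)). apply (is_lim_seq_minus' _ _ _ _ L). apply is_lim_seq_const. }
  apply (is_lim_seq_le _ _ _ _) with (2 := L2) (3 := is_lim_seq_const (B - sum_n b M)).
  intros K. apply Rle_trans with (1 := HT M K). 
  assert (sum_n b (M + K) <= B) by (apply is_series_sum_le; auto). lra. }
assert (L3 : is_lim_seq (fun M => B - sum_n b M) 0).
{ replace (Finite 0) with (Finite (B - B)) by (f_equal; ring). 
  apply (is_lim_seq_minus' _ _ B B). apply is_lim_seq_const. apply is_series_lim, HB. }
change (is_lim_seq (sum_n (fun N => sum_n (fun n => A n (N - n)%nat) N)) S).
assert (L4 : is_lim_seq (fun M => sum_n row M - T M O) 0).
{ apply is_lim_seq_abs_0. apply (is_lim_seq_le_le (fun _ => 0) _ (fun M => B - sum_n b M)); auto.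
  intros M. split. apply Rabs_pos. apply HT2. apply is_lim_seq_const. }
apply is_lim_seq_ext with (fun M => sum_n row M - (sum_n row M - T M O)).
- intros M. rewrite sum_n_diag. unfold T.
  rewrite (sum_n_ext_R (fun n => sum_n (A n) (M - n + 0)) (fun n => sum_n (A n) (M - n))). Rring.
  intros n Hn. f_equal; lia.
- replace (Finite S) with (Finite (S - 0)) by (f_equal; ring).
  apply is_lim_seq_minus'; auto.
Qed.

Fixpoint Csum (f : nat -> C) (N : nat) : C :=
  match N with O => f O | S N => (Csum f N + f (S N))%C end.

Lemma Csum_Re f N : Re (Csum f N) = sum_n (fun n => Re (f n)) N.
Proof. induction N as [|N IH]. now rewrite sum_n_0. now rewrite sum_n_S, <- IH. Qed.

Lemma Csum_Im f N : Im (Csum f N) = sum_n (fun n => Im (f n)) N.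
Proof. induction N as [|N IH]. now rewrite sum_n_0. now rewrite sum_n_S, <- IH. Qed.

Lemma Csum_ext f g N : (forall n, (n <= N)%nat -> f n = g n) -> Csum f N = Csum g N.
Proof.
induction N as [|N IH]; intros H; simpl. apply H; lia. rewrite IH. now rewrite H by lia. intros; apply H; lia.
Qed.

Lemma Csum_plus f g N : Csum (fun n => f n + g n)%C N = (Csum f N + Csum g N)%C.
Proof. induction N as [|N IH]; simpl; auto. rewrite IH; ring. Qed.

Lemma Csum_scal c f N : Csum (fun n => c * f n)%C N = (c * Csum f N)%C.
Proof. induction N as [|N IH]; simpl; auto. rewrite IH; ring. Qed.

Lemma Csum_S_l f N : Csum f (S N) = (f O + Csum (fun n => f (S n)) N)%C.
Proof. induction N as [|N IH]. reflexivity. change (Csum f (S (S N))) with (Csum f (S N) + f (S (S N)))%C. rewrite IH. simpl. ring. Qed.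

Lemma is_Cseries_diagonal (A : nat -> nat -> C) (row : nat -> C) (b : nat -> R) S :
  (forall n, is_Cseries (A n) (row n)) -> is_Cseries row S ->
  (forall N, sum_n (fun n => Cmod (A n (N - n)%nat)) N <= b N) -> ex_series b ->
  is_Cseries (fun N => Csum (fun n => A n (N - n)%nat) N) S.
Proof.
intros Hrow [H1 H2] Hb Eb. split.
- apply is_series_ext with (fun N => sum_n (fun n => Re (A n (N - n)%nat)) N).
  intros N; now rewrite Csum_Re.
  apply (is_series_diagonal (fun n m => Re (A n m)) (fun n => Re (row n)) b); auto.
  exact (fun n => proj1 (Hrow n)).
  intros N. apply Rle_trans with (2 := Hb N). apply sum_n_le_loc. intros; apply re_le_Cmod.
- apply is_series_ext with (fun N => sum_n (fun n => Im (A n (N - n)%nat)) N).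
  intros N; now rewrite Csum_Im.
  apply (is_series_diagonal (fun n m => Im (A n m)) (fun n => Im (row n)) b); auto.
  exact (fun n => proj2 (Hrow n)).
  intros N. apply Rle_trans with (2 := Hb N). apply sum_n_le_loc. intros; apply im_le_Cmod.
Qed.

(** * Bernstein polynomials with hypergeometric coefficients *)

(** The polynomial with Bernstein coefficients [(b)_n / (c)_n], [n <= N],
    encoded by Pascal's recurrence rather than by its sum ([bern_divpow]):
    the derivative, the bound and the Beta integral are then inductions without
    binomial coefficients. *)
Fixpoint bern (N : nat) (b : C) (c y : R) : C :=
  match N with
  | O => 1%C
  | S N => ((1 - RtoC y) * bern N b c y + RtoC y * (b / RtoC c) * bern N (b + 1) (c + 1) y)%C
  end.

(** On Bernstein coefficients this is [(b + n) - (c + n) = b - c]; it collects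
    the terms in the derivative of the recurrence. *)
Lemma bern_contiguous N : forall b c y, 0 < c ->
  (b * bern N (b + 1) (c + 1) y - RtoC c * bern N b c y = (b - RtoC c) * bern N b (c + 1) y)%C.
Proof.
induction N as [|N IH]; intros b c y Hc; simpl. ring.
assert (N0 : RtoC c <> 0) by (apply RtoC_neq0; lra).
assert (N1 : (RtoC c + 1)%C <> 0) by (rewrite <- RtoC_plus; apply RtoC_neq0; lra).
assert (H1 := IH b c y Hc). assert (H2 := IH (b + 1)%C (c + 1) y ltac:(lra)).
rewrite RtoC_plus in *.
replace (b * ((1 - RtoC y) * bern N (b + 1) (c + 1) y + RtoC y * ((b + 1) / (RtoC c + 1)) * bern N (b + 1 + 1) (c + 1 + 1) y) -
  RtoC c * ((1 - RtoC y) * bern N b c y + RtoC y * (b / RtoC c) * bern N (b + 1) (c + 1) y))%C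
 with ((1 - RtoC y) * (b * bern N (b + 1) (c + 1) y - RtoC c * bern N b c y)
   + RtoC y * (b / (RtoC c + 1)) * ((b + 1) * bern N (b + 1 + 1) (c + 1 + 1) y - (RtoC c + 1) * bern N (b + 1) (c + 1) y))%C
 by (field; auto).
rewrite H1, H2. field; auto.
Qed.

Lemma Cderiv_bern_0 b c y : Cderiv (bern 0 b c) y 0.
Proof. apply (Cderiv_const 1). Qed.

Lemma Cderiv_bern_S N : forall b c y, 0 < c ->
  Cderiv (bern (S N) b c) y ((RtoC (INR N) + 1) * ((b - RtoC c) / RtoC c) * bern N b (c + 1) y)%C.
Proof.
induction N as [|N IH]; intros b c y Hc.
- assert (N0 : RtoC c <> 0) by (apply RtoC_neq0; lra).
  eapply Cderiv_eq. simpl. apply Cderiv_plus.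
  apply (Cderiv_mult (fun y => 1 - RtoC y)%C (fun _ => RtoC 1)).
  apply (Cderiv_minus (fun _ => RtoC 1) (fun y => RtoC y) y 0 (RtoC 1)). apply Cderiv_const.
  apply Cderiv_RtoC, (is_derive_id (K := R_AbsRing)). apply Cderiv_const.
  apply (Cderiv_mult (fun y => RtoC y * (b / RtoC c))%C (fun _ => RtoC 1)). 
  apply (Cderiv_mult (fun y => RtoC y) (fun _ => (b / RtoC c)%C) y (RtoC 1)). 
  apply Cderiv_RtoC, (is_derive_id (K := R_AbsRing)). apply Cderiv_const. apply Cderiv_const.
  simpl. field; auto.
- assert (N0 : RtoC c <> 0) by (apply RtoC_neq0; lra).
  assert (N1 : (RtoC c + 1)%C <> 0) by (rewrite <- RtoC_plus; apply RtoC_neq0; lra).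
  assert (D1 := IH b c y Hc). assert (D2 := IH (b + 1)%C (c + 1) y ltac:(lra)).
  assert (Con := bern_contiguous (S N) b c y Hc).
  eapply Cderiv_eq.
  apply (Cderiv_plus (fun y => (1 - RtoC y) * bern (S N) b c y)%C (fun y => RtoC y * (b / RtoC c) * bern (S N) (b + 1) (c + 1) y)%C).
  apply (Cderiv_mult (fun y => 1 - RtoC y)%C). 
  apply (Cderiv_minus (fun _ => RtoC 1) (fun y => RtoC y) y 0 (RtoC 1)). apply Cderiv_const.
  apply Cderiv_RtoC, (is_derive_id (K := R_AbsRing)). exact D1.
  apply (Cderiv_mult (fun y => RtoC y * (b / RtoC c))%C). 
  apply (Cderiv_mult (fun y => RtoC y) (fun _ => (b / RtoC c)%C) y (RtoC 1)).
  apply Cderiv_RtoC, (is_derive_id (K := R_AbsRing)). apply Cderiv_const. exact D2.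
  clear D1 D2 IH.
  assert (E : bern (S N) b (c + 1) y = ((1 - RtoC y) * bern N b (c + 1) y + RtoC y * (b / RtoC (c + 1)) * bern N (b + 1) (c + 1 + 1) y)%C) by reflexivity.
  rewrite !RtoC_S.
  transitivity ((b * bern (S N) (b + 1) (c + 1) y - RtoC c * bern (S N) b c y) / RtoC c
     + (RtoC (INR N) + 1) * ((b - RtoC c) / RtoC c) * ((1 - RtoC y) * bern N b (c + 1) y + RtoC y * (b / RtoC (c + 1)) * bern N (b + 1) (c + 1 + 1) y))%C.
  + rewrite RtoC_plus. field; auto.
  + rewrite <- E, Con. field; auto.
Qed.

(** A Bernstein polynomial is a convex combination of its coefficients.  The
    scalar [k] carries the factor [b / c] of the recurrence through the
    induction, also when [b = 0]. *)
Lemma bern_bound N : forall (k b : C) (c y q M : R), 0 < c -> 0 <= y <= 1 -> 1 <= q ->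
  (forall n, Cmod (k * (pochhammer b n / pochhammer (RtoC c) n)) <= M * q ^ n) ->
  Cmod (k * bern N b c y) <= M * q ^ N.
Proof.
induction N as [|N IH]; intros k b c y q M Hc Hy Hq H.
- specialize (H O). simpl in *. replace (1 / 1)%C with (RtoC 1) in H by field. exact H.
- simpl bern. 
  assert (H1 := IH k b c y q M Hc Hy Hq H).
  assert (H2 := IH (k * (b / RtoC c))%C (b + 1)%C (c + 1) y q (M * q) ltac:(lra) Hy Hq).
  assert (H3 : Cmod (k * (b / RtoC c) * bern N (b + 1) (c + 1) y) <= M * q * q ^ N).
  { apply H2. intros n. specialize (H (S n)). rewrite !(pochhammer_S_l _ n) in H.
    replace (k * (b / RtoC c) * (pochhammer (b + 1) n / pochhammer (RtoC (c + 1)) n))%C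
      with (k * (b * pochhammer (b + 1) n / (RtoC c * pochhammer (RtoC c + 1) n)))%C.
    simpl in H. lra. rewrite RtoC_plus. field. split. rewrite <- RtoC_plus. apply pochhammer_neq0; lra.
    apply RtoC_neq0; lra. }
  replace (k * ((1 - RtoC y) * bern N b c y + RtoC y * (b / RtoC c) * bern N (b + 1) (c + 1) y))%C
   with (RtoC (1 - y) * (k * bern N b c y) + RtoC y * (k * (b / RtoC c) * bern N (b + 1) (c + 1) y))%C
   by (rewrite RtoC_minus; ring).
  apply Rle_trans with (1 := Cmod_triangle _ _).
  rewrite (Cmod_mult (RtoC (1 - y))), (Cmod_mult (RtoC y)), !Cmod_R, !Rabs_pos_eq by lra.
  assert (Q : 0 <= q ^ N) by (apply pow_le; lra).
  assert (C0 := Cmod_ge_0 (k * bern N b c y)).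
  assert (M0 : 0 <= M * q ^ N) by lra.
  simpl. 
  assert (A1 : (1 - y) * Cmod (k * bern N b c y) <= (1 - y) * (M * q ^ N * q)).
  { apply Rmult_le_compat_l; try lra. nra. }
  assert (A2 : y * Cmod (k * (b / RtoC c) * bern N (b + 1) (c + 1) y) <= y * (M * q ^ N * q)).
  { apply Rmult_le_compat_l; try lra. }
  nra.
Qed.

Definition divpow (u : R) (n : nat) : R := u ^ n / INR (fact n).

Lemma divpow_S u n : INR (S n) * divpow u (S n) = u * divpow u n.
Proof.
unfold divpow. change (fact (S n)) with (S n * fact n)%nat. rewrite mult_INR. simpl pow.
field. split. apply INR_fact_neq_0. now apply not_0_INR.
Qed.

(** Multiplying by [N + 1 = n + (N + 1 - n)] splits the sum into the two terms
    of Pascal's recurrence. *)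
Lemma bern_divpow u v N : forall k b c, 0 < c -> 0 < u + v ->
  Csum (fun n => k * (pochhammer b n / pochhammer (RtoC c) n) * RtoC (divpow u n * divpow v (N - n)))%C N
  = (k * RtoC (divpow (u + v) N) * bern N b c (u / (u + v)))%C.
Proof.
induction N as [|N IH]; intros k b c Hc Huv.
- simpl. unfold divpow; simpl. replace (1 / 1) with 1 by field. rewrite Rmult_1_r. field.
- set (w := fun n => (k * (pochhammer b n / pochhammer (RtoC c) n))%C).
  assert (NS : RtoC (INR (S N)) <> 0) by (apply RtoC_neq0; now apply not_0_INR).
  assert (N0 : RtoC c <> 0) by (apply RtoC_neq0; lra).
  assert (E : (RtoC (INR (S N)) * Csum (fun n => w n * RtoC (divpow u n * divpow v (S N - n))) (S N)
    = RtoC u * Csum (fun n => w (S n) * RtoC (divpow u n * divpow v (N - n))) N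
     + RtoC v * Csum (fun n => w n * RtoC (divpow u n * divpow v (N - n))) N)%C).
  { transitivity (Csum (fun n => RtoC (INR n) * (w n * RtoC (divpow u n * divpow v (S N - n)))) (S N)
      + Csum (fun n => RtoC (INR (S N - n)) * (w n * RtoC (divpow u n * divpow v (S N - n)))) (S N))%C.
    - rewrite <- Csum_plus, <- Csum_scal. apply Csum_ext. intros n Hn.
      replace (RtoC (INR (S N))) with (RtoC (INR n) + RtoC (INR (S N - n)))%C. ring.
      rewrite <- RtoC_plus, <- plus_INR. do 2 f_equal. lia.
    - f_equal.
      + rewrite Csum_S_l. change (INR 0) with 0. rewrite !Cmult_0_l, Cplus_0_l, <- Csum_scal. apply Csum_ext. intros n Hn.
        replace (S N - S n)%nat with (N - n)%nat by lia.
        rewrite (RtoC_mult (divpow u (S n))).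
        transitivity (w (S n) * (RtoC (INR (S n) * divpow u (S n))) * RtoC (divpow v (N - n)))%C.
        rewrite RtoC_mult; ring. rewrite divpow_S, !RtoC_mult. ring.
      + change (Csum (fun n => RtoC (INR (S N - n)) * (w n * RtoC (divpow u n * divpow v (S N - n))))%C (S N))
         with (Csum (fun n => RtoC (INR (S N - n)) * (w n * RtoC (divpow u n * divpow v (S N - n))))%C N
            + RtoC (INR (S N - S N)) * (w (S N) * RtoC (divpow u (S N) * divpow v (S N - S N))))%C.
        rewrite Nat.sub_diag. change (INR 0) with 0. rewrite Cmult_0_l, Cplus_0_r, <- Csum_scal. apply Csum_ext. intros n Hn.
        replace (S N - n)%nat with (S (N - n)) by lia.
        rewrite (RtoC_mult (divpow u n)).
        transitivity (w n * RtoC (divpow u n) * (RtoC (INR (S (N - n)) * divpow v (S (N - n)))))%C.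
        rewrite RtoC_mult; ring. rewrite divpow_S, !RtoC_mult. ring. }
  rewrite (Csum_ext (fun n => w (S n) * RtoC (divpow u n * divpow v (N - n)))%C
    (fun n => (k * (b / RtoC c)) * (pochhammer (b + 1) n / pochhammer (RtoC (c + 1)) n) * RtoC (divpow u n * divpow v (N - n)))%C) in E.
  2:{ intros n Hn. unfold w. rewrite !(pochhammer_S_l _ n), RtoC_plus. field. split; auto.
      rewrite <- RtoC_plus; apply pochhammer_neq0; lra. }
  unfold w in E. rewrite (IH (k * (b / RtoC c))%C (b + 1)%C (c + 1)) in E by lra. rewrite IH in E by lra.
  set (s := Csum (fun n => k * (pochhammer b n / pochhammer (RtoC c) n) * RtoC (divpow u n * divpow v (S N - n)))%C (S N)) in *.
  replace s with (RtoC (INR (S N)) * s / RtoC (INR (S N)))%C by (field; auto). rewrite E.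
  simpl bern.
  replace (RtoC (divpow (u + v) (S N))) with (RtoC (u + v) * RtoC (divpow (u + v) N) / RtoC (INR (S N)))%C.
  2:{ rewrite <- RtoC_mult, <- divpow_S, RtoC_mult. field; auto. }
  assert (Nuv : (RtoC u + RtoC v)%C <> 0) by (rewrite <- RtoC_plus; apply RtoC_neq0; lra).
  rewrite RtoC_div, RtoC_plus by lra. field. auto.
Qed.

Lemma sum_divpow u v N : sum_n (fun n => divpow u n * divpow v (N - n)) N = divpow (u + v) N.
Proof.
rewrite sum_n_Reals. unfold divpow at 3. rewrite binomial. unfold Rdiv. rewrite Rmult_comm, scal_sum.
apply sum_eq. intros n Hn. unfold divpow, Binomial.C. field. repeat split; apply INR_fact_neq_0.
Qed.

(** Two subexponential factors cost [q * q] in the ratio of a geometric majorant. *)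
Lemma exists_square_margin zeta : 0 < zeta < 1 -> exists q, 1 < q /\ 0 <= q * q * zeta < 1.
Proof.
intros Hz.
assert (H1 : 1 < 2 / (1 + zeta)) by (apply Rlt_div_r; lra).
exists (sqrt (2 / (1 + zeta))). split.
- assert (X := sqrt_lt_1 1 (2 / (1 + zeta)) ltac:(lra) ltac:(lra) H1). now rewrite sqrt_1 in X.
- rewrite sqrt_sqrt by lra. replace (2 / (1 + zeta) * zeta) with (2 * zeta / (1 + zeta)) by (field; lra).
  split. apply Rdiv_le_0_compat; lra. apply Rlt_div_l; lra.
Qed.

(** In the double series with entries
    [(a)_(n+m) (b)_n / (c)_n * u^n / n! * v^m / m!], [u = zeta y],
    [v = zeta (1 - y)], the rows are binomial series in [v] and the diagonals
    are the polynomials [bern].  The diagonals of absolute values are dominated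
    by a geometric series because [u + v = zeta < 1]. *)
Lemma bern_generating a b c zeta y : 0 < c -> 0 < zeta < 1 -> 0 <= y <= 1 ->
  is_Cseries (fun N => binom_coeff a N * RtoC (zeta ^ N) * bern N b c y)%C
    (cpow (1 - zeta * (1 - y)) (- a) * CPSeries (hyp_coeff a b c) (zeta * y / (1 - zeta * (1 - y))))%C.
Proof.
intros Hc Hz Hy.
set (u := zeta * y). set (v := zeta * (1 - y)).
assert (Hu : 0 <= u) by (unfold u; nra). assert (Hv : 0 <= v < 1) by (unfold v; split; nra).
assert (Huv : u + v = zeta) by (unfold u, v; ring).
assert (HX : 0 <= u / (1 - v) < 1).
{ split. apply Rdiv_le_0_compat; lra. apply Rlt_div_l; lra. }
set (A := fun n m => (pochhammer a (n + m) * (pochhammer b n / pochhammer (RtoC c) n) * RtoC (divpow u n * divpow v m))%C).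
apply is_Cseries_ext with (fun N => Csum (fun n => A n (N - n)%nat) N).
{ intros N. transitivity (Csum (fun n => pochhammer a N * (pochhammer b n / pochhammer (RtoC c) n) * RtoC (divpow u n * divpow v (N - n)))%C N).
  - apply Csum_ext. intros n Hn. unfold A. do 3 f_equal. lia.
  - rewrite bern_divpow by lra. rewrite Huv. replace (u / zeta) with y by (unfold u; field; lra).
    unfold binom_coeff, divpow. rewrite RtoC_div by apply INR_fact_neq_0. field. apply fact_neq0. }
destruct (exists_square_margin zeta Hz) as [s [Hs Hs2]].
destruct (subexp_binom a s Hs) as [M1 [M10 HM1]].
destruct (subexp_pochhammer b c Hc s Hs) as [M2 [M20 HM2]].
apply (is_Cseries_diagonal A (fun n => cpow (1 - v) (- a) * (hyp_coeff a b c n * RtoC (u / (1 - v)) ^ n))%C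
   (fun N => M1 * M2 * (s * s * zeta) ^ N)).
- intros n.
  assert (HB := is_CPSeries (binom_coeff (a + INR n)) v (subexp_binom _) ltac:(lra)).
  rewrite binomial_series in HB by lra.
  assert (HB2 := is_Cseries_scal (pochhammer a n * (pochhammer b n / pochhammer (RtoC c) n) * RtoC (divpow u n)) _ _ HB).
  replace (cpow (1 - v) (- a) * (hyp_coeff a b c n * RtoC (u / (1 - v)) ^ n))%C with 
    (pochhammer a n * (pochhammer b n / pochhammer (RtoC c) n) * RtoC (divpow u n) * cpow (1 - v) (- (a + INR n)))%C.
  + apply is_Cseries_ext with (2 := HB2). intros m. unfold A, binom_coeff.
    rewrite pochhammer_add, RtoC_mult. unfold divpow. rewrite !RtoC_div by apply INR_fact_neq_0.
    rewrite !RtoC_pow. field. repeat split; try apply fact_neq0. now apply pochhammer_neq0.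
  + unfold hyp_coeff, divpow. replace (- (a + INR n))%C with (- a + - INR n)%C by ring.
    rewrite cpow_plus, (cpow_opp _ (INR n)), cpow_nat by lra.
    rewrite RtoC_div by apply INR_fact_neq_0. rewrite RtoC_pow.
    assert (N1 : RtoC (1 - v) <> 0) by (apply RtoC_neq0; lra).
    assert (EX : (RtoC (u / (1 - v)) ^ n = RtoC u ^ n / RtoC (1 - v) ^ n)%C).
    { rewrite RtoC_div by lra. unfold Cdiv. now rewrite Cpow_mult_l, Cpow_inv by auto. }
    rewrite EX. field.
    repeat split; solve [apply fact_neq0 | now apply pochhammer_neq0 | now apply Cpow_nz].
- apply is_Cseries_scal. apply is_CPSeries. now apply subexp_hyp_coeff. lra.
- intros N. apply Rle_trans with (sum_n (fun n => (M1 * M2 * (s * s) ^ N * INR (fact N)) * (divpow u n * divpow v (N - n))) N).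
  + apply sum_n_le_loc. intros n Hn. unfold A. replace (n + (N - n))%nat with N by lia.
    rewrite !Cmod_mult, Cmod_R.
    assert (D0 : 0 <= divpow u n * divpow v (N - n)).
    { apply Rmult_le_pos; apply Rdiv_le_0_compat; try apply INR_fact_lt_0; apply pow_le; lra. }
    rewrite (Rabs_pos_eq _ D0). apply Rmult_le_compat_r; auto.
    specialize (HM1 N). specialize (HM2 n). rewrite Cmod_div, Cmod_R in HM1 by apply fact_neq0.
    assert (F0 := INR_fact_lt_0 N). rewrite Rabs_pos_eq in HM1 by lra.
    assert (S0 : forall k, 0 <= s ^ k) by (intros; apply pow_le; lra).
    replace (M1 * M2 * (s * s) ^ N * INR (fact N)) with ((M1 * s ^ N * INR (fact N)) * (M2 * s ^ N)) by (rewrite Rpow_mult_distr; ring).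
    apply Rmult_le_compat; try apply Cmod_ge_0.
    apply Rle_div_l; auto.
    apply Rle_trans with (1 := HM2). apply Rmult_le_compat_l; auto. apply Rle_pow; lra || lia.
  + rewrite (sum_n_mult_l (K := R_Ring)). unfold mult; simpl. rewrite sum_divpow, Huv. unfold divpow.
    rewrite (Rpow_mult_distr (s * s)). right. field. apply INR_fact_neq_0.
- apply (ex_series_scal_l (K := R_AbsRing) (M1 * M2) (fun n => (s * s * zeta) ^ n)). apply ex_series_geom.
  rewrite Rabs_pos_eq; lra.
Qed.

(** * Integration against the Beta weight *)

Definition beta_integral (p q : R) (f : R -> C) (v : C) : Prop :=
  is_RInt_gen (fun x => beta_weight p q x * Re (f ((1 - x) / 2))) (at_right (-1)) (at_left 1) (Re v) /\
  is_RInt_gen (fun x => beta_weight p q x * Im (f ((1 - x) / 2))) (at_right (-1)) (at_left 1) (Im v).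

Lemma beta_integral_ext p q f g v : (forall y, 0 < y < 1 -> f y = g y) ->
  beta_integral p q f v -> beta_integral p q g v.
Proof.
intros E [H1 H2]. split.
- apply (is_RInt_gen_ext_ends _ _ _ _ ends_m1_1) with (2 := H1). intros x Hx. rewrite E; auto; lra.
- apply (is_RInt_gen_ext_ends _ _ _ _ ends_m1_1) with (2 := H2). intros x Hx. rewrite E; auto; lra.
Qed.

Lemma beta_integral_eq p q f v w : beta_integral p q f v -> v = w -> beta_integral p q f w.
Proof. now intros H <-. Qed.

Lemma beta_integral_plus p q f g v w : beta_integral p q f v -> beta_integral p q g w ->
  beta_integral p q (fun y => f y + g y)%C (v + w)%C.
Proof.
assert (P1 := ends_Fa _ _ _ ends_m1_1). assert (P2 := ends_Fb _ _ _ ends_m1_1).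
intros [H1 H2] [H3 H4]. split.
- apply (is_RInt_gen_ext_ends _ _ _ _ ends_m1_1) with (2 := is_RInt_gen_plus _ _ _ _ H1 H3).
  intros x Hx. unfold plus, Re; simpl. ring.
- apply (is_RInt_gen_ext_ends _ _ _ _ ends_m1_1) with (2 := is_RInt_gen_plus _ _ _ _ H2 H4).
  intros x Hx. unfold plus, Im; simpl. ring.
Qed.

Lemma beta_integral_scal p q c f v : beta_integral p q f v -> beta_integral p q (fun y => c * f y)%C (c * v)%C.
Proof.
assert (P1 := ends_Fa _ _ _ ends_m1_1). assert (P2 := ends_Fb _ _ _ ends_m1_1).
intros [H1 H2]. split.
- apply (is_RInt_gen_ext_ends _ _ _ _ ends_m1_1) with (2 := is_RInt_gen_minus _ _ _ _ (is_RInt_gen_scal _ (Re c) _ H1) (is_RInt_gen_scal _ (Im c) _ H2)).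
  intros x Hx. unfold minus, plus, opp, scal, mult, Re, Im; simpl. unfold plus, mult; simpl. ring.
- apply (is_RInt_gen_ext_ends _ _ _ _ ends_m1_1) with (2 := is_RInt_gen_plus _ _ _ _ (is_RInt_gen_scal _ (Re c) _ H2) (is_RInt_gen_scal _ (Im c) _ H1)).
  intros x Hx. unfold plus, opp, scal, mult, Re, Im; simpl. unfold mult; simpl. ring.
Qed.

Lemma beta_integral_succ_l p q f v : beta_integral (p + 1) q f v -> beta_integral p q (fun y => RtoC y * f y)%C v.
Proof.
intros [H1 H2]. split.
- apply (is_RInt_gen_ext_ends _ _ _ _ ends_m1_1) with (2 := H1). intros x Hx.
  rewrite beta_weight_succ_l, re_scal_l by auto. Rring.
- apply (is_RInt_gen_ext_ends _ _ _ _ ends_m1_1) with (2 := H2). intros x Hx.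
  rewrite beta_weight_succ_l, im_scal_l by auto. Rring.
Qed.

Lemma beta_integral_succ_r p q f v : beta_integral p (q + 1) f v -> beta_integral p q (fun y => (1 - RtoC y) * f y)%C v.
Proof.
intros [H1 H2]. split.
- apply (is_RInt_gen_ext_ends _ _ _ _ ends_m1_1) with (2 := H1). intros x Hx.
  rewrite beta_weight_succ_r, <- RtoC_minus, re_scal_l by auto. Rring.
- apply (is_RInt_gen_ext_ends _ _ _ _ ends_m1_1) with (2 := H2). intros x Hx.
  rewrite beta_weight_succ_r, <- RtoC_minus, im_scal_l by auto. Rring.
Qed.

Lemma beta_integral_1 p q : 0 < p -> 0 < q -> beta_integral p q (fun _ => RtoC 1) (RtoC (RBeta p q)).
Proof.
intros Hp Hq. assert (P1 := ends_Fa _ _ _ ends_m1_1). assert (P2 := ends_Fb _ _ _ ends_m1_1).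
assert (H := is_RBeta p q Hp Hq). split.
- apply (is_RInt_gen_ext_ends _ _ _ _ ends_m1_1) with (2 := H). intros x Hx. simpl. ring.
- assert (H0 := is_RInt_gen_scal _ 0 _ H). unfold scal in H0 at 2; simpl in H0; unfold mult in H0; simpl in H0.
  rewrite Rmult_0_l in H0.
  apply (is_RInt_gen_ext_ends _ _ _ _ ends_m1_1) with (2 := H0). intros x Hx. unfold scal; simpl. unfold mult; simpl. ring.
Qed.

Lemma beta_integral_parts p q (g g1 : R -> C) M : 0 < p -> 0 < q ->
  (forall y, 0 < y < 1 -> Cderiv g y (g1 y)) -> (forall y, 0 < y < 1 -> Ccont g1 y) ->
  (forall y, 0 < y < 1 -> Cmod (g y) <= M) ->
  beta_integral p q (fun y => (RtoC p * (1 - RtoC y) - RtoC q * RtoC y) * g y + RtoC y * (1 - RtoC y) * g1 y)%C 0.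
Proof.
intros Hp Hq Hg Hg1 HM.
assert (A1 := beta_weight_parts p q (fun y => Re (g y)) (fun y => Re (g1 y)) M Hp Hq
  (fun y Hy => proj1 (Hg y Hy)) (fun y Hy => proj1 (Hg1 y Hy)) (fun y Hy => Rle_trans _ _ _ (re_le_Cmod _) (HM y Hy))).
assert (A2 := beta_weight_parts p q (fun y => Im (g y)) (fun y => Im (g1 y)) M Hp Hq
  (fun y Hy => proj2 (Hg y Hy)) (fun y Hy => proj2 (Hg1 y Hy)) (fun y Hy => Rle_trans _ _ _ (im_le_Cmod _) (HM y Hy))).
split.
- apply (is_RInt_gen_ext_ends _ _ _ _ ends_m1_1) with (2 := A1). intros x Hx. cbv zeta. set (y := (1 - x) / 2).
  rewrite <- RtoC_minus, <- !RtoC_mult, <- RtoC_minus.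
  change (Re ?a) with (fst a). simpl. ring.
- apply (is_RInt_gen_ext_ends _ _ _ _ ends_m1_1) with (2 := A2). intros x Hx. cbv zeta. set (y := (1 - x) / 2).
  rewrite <- RtoC_minus, <- !RtoC_mult, <- RtoC_minus.
  change (Im ?a) with (snd a). simpl. ring.
Qed.

(** The factors [1 - y] and [y] in the recurrence of [bern] raise one parameter
    of the weight, and [d / (c + d)] and [c / (c + d) * (b / c)] add up to
    [(b + d) / (c + d)], the first factor of the next Pochhammer quotient. *)
Lemma beta_integral_bern N : forall b c d, 0 < c -> 0 < d ->
  beta_integral c d (bern N b c) (RtoC (RBeta c d) * (pochhammer (b + RtoC d) N / pochhammer (RtoC (c + d)) N))%C.
Proof.
induction N as [|N IH]; intros b c d Hc Hd.
- eapply beta_integral_eq. apply beta_integral_1; auto. simpl. field.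
- assert (H1 := beta_integral_succ_r _ _ _ _ (IH b c (d + 1) Hc ltac:(lra))).
  assert (H2 := beta_integral_succ_l _ _ _ _ (beta_integral_scal _ _ (b / RtoC c) _ _ (IH (b + 1)%C (c + 1) d ltac:(lra) Hd))).
  eapply beta_integral_eq. 
  apply beta_integral_ext with (2 := beta_integral_plus _ _ _ _ _ _ H1 H2).
  intros y Hy. simpl. ring.
  destruct (RBeta_succ c d Hc Hd) as [-> ->].
  replace (c + (d + 1)) with (c + d + 1) by ring. replace (c + 1 + d) with (c + d + 1) by ring.
  rewrite !(pochhammer_S_l _ N). 
  replace (b + RtoC (d + 1))%C with (b + RtoC d + 1)%C by (rewrite RtoC_plus; ring).
  replace (b + 1 + RtoC d)%C with (b + RtoC d + 1)%C by ring.
  rewrite !RtoC_mult, !RtoC_div by lra.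
  assert (N1 := pochhammer_neq0 (c + d + 1) N ltac:(lra)). assert (Ncd : RtoC (c + d) <> 0) by (apply RtoC_neq0; lra).
  assert (Nc : RtoC c <> 0) by (apply RtoC_neq0; lra).
  rewrite (RtoC_plus (c + d) 1) in N1 |- *.
  field. auto.
Qed.

(** * Jacobi polynomials *)

(** [P_k^(p-1,q-1) (1 - 2 y)]; shifting the indices by one makes [p] and [q] the
    parameters of the orthogonality weight. *)
Definition jac (k : nat) (p q y : R) : C :=
  (pochhammer (RtoC p) k / INR (fact k) *
   CPSeries (hyp_coeff (- INR k) (RtoC (INR k + p + q - 1)) p) y)%C.
Definition jac1 (k : nat) (p q y : R) : C :=
  (pochhammer (RtoC p) k / INR (fact k) *
   CPSeries (CPderiv (hyp_coeff (- INR k) (RtoC (INR k + p + q - 1)) p)) y)%C.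
Definition jac2 (k : nat) (p q y : R) : C :=
  (pochhammer (RtoC p) k / INR (fact k) *
   CPSeries (CPderiv (CPderiv (hyp_coeff (- INR k) (RtoC (INR k + p + q - 1)) p))) y)%C.

Lemma Cderiv_jac k p q y : 0 < p -> -1 < y < 1 -> Cderiv (jac k p q) y (jac1 k p q y).
Proof.
intros Hp Hy. apply Cderiv_scal. apply Cderiv_CPSeries; auto. now apply subexp_hyp_coeff.
Qed.

Lemma Cderiv_jac1 k p q y : 0 < p -> -1 < y < 1 -> Cderiv (jac1 k p q) y (jac2 k p q y).
Proof.
intros Hp Hy. apply Cderiv_scal. apply Cderiv_CPSeries; auto. apply subexp_CPderiv. now apply subexp_hyp_coeff.
Qed.

Lemma jac_0 p q y : 0 < p -> -1 < y < 1 -> jac 0 p q y = 1.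
Proof.
intros Hp Hy. unfold jac. replace (CPSeries _ y) with (RtoC 1). simpl. field.
symmetry. apply is_Cseries_unique.
apply is_Cseries_ext with (fun n => match n with O => RtoC 1 | _ => RtoC 0 end).
- intros [|n]. rewrite hyp_coeff_0. simpl; ring.
  unfold hyp_coeff. rewrite (pochhammer_S_l (- INR 0)). simpl INR.
  replace (- RtoC 0)%C with (RtoC 0) by ring. unfold Cdiv. ring.
- assert (Z := is_Cseries_0). split.
  + apply is_series_decr_1. evar_last. apply is_series_ext with (2 := proj1 Z). reflexivity. unfold plus, opp; simpl. ring.
  + apply is_series_decr_1. evar_last. apply is_series_ext with (2 := proj2 Z). reflexivity. unfold plus, opp; simpl. ring.
Qed.

(** The bound holds up to [y = 1] because only finitely many coefficients are
    nonzero; integration by parts needs it at that end. *)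
Lemma CPSeries_finite_bound h k : subexp h -> (forall n, (k < n)%nat -> h n = 0) ->
  exists M, forall y, 0 < y < 1 -> Cmod (CPSeries h y) <= M.
Proof.
intros Sh Hk. destruct (Sh 2 ltac:(lra)) as [M [M0 HM]].
set (b := fun n => M * 4 ^ k * (/ 2) ^ n).
assert (P : forall x n, 0 < x -> 0 < x ^ n) by (intros; now apply pow_lt).
assert (Hb : forall n, Cmod (h n) <= b n).
{ intros n. unfold b. destruct (Nat.le_gt_cases n k) as [H|H].
  - apply Rle_trans with (1 := HM n). rewrite Rmult_assoc. apply Rmult_le_compat_l; auto.
    replace (2 ^ n) with (4 ^ n * (/2) ^ n) by (rewrite <- Rpow_mult_distr; f_equal; field).
    apply Rmult_le_compat_r. apply Rlt_le, P; lra. apply Rle_pow; lra || auto.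
  - rewrite Hk, Cmod_0 by auto. repeat apply Rmult_le_pos; auto; apply Rlt_le, P; lra. }
assert (Eb : ex_series b).
{ apply (ex_series_scal_l (K := R_AbsRing) (M * 4 ^ k) (fun n => (/2) ^ n)). apply ex_series_geom. rewrite Rabs_pos_eq; lra. }
exists (2 * Series b). intros y Hy.
assert (Hu : forall n, Cmod (h n * RtoC y ^ n) <= b n).
{ intros n. rewrite Cmod_mult, Cmod_pow, Cmod_R, Rabs_pos_eq by lra.
  apply Rle_trans with (2 := Hb n). rewrite <- (Rmult_1_r (Cmod (h n))) at 2.
  apply Rmult_le_compat_l. apply Cmod_ge_0. rewrite <- (pow1 n). apply pow_incr; lra. }
apply Rle_trans with (1 := Cmod_le_Re_Im _).
assert (G : forall f : C -> R, (forall c, Rabs (f c) <= Cmod c) -> Rabs (Series (fun n => f (h n * RtoC y ^ n)%C)) <= Series b).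
{ intros f Hf. 
  assert (Hn : forall n, 0 <= Rabs (f (h n * RtoC y ^ n)%C) <= b n).
  { intros n. split. apply Rabs_pos. apply Rle_trans with (2 := Hu n). apply Hf. }
  apply Rle_trans with (Series (fun n => Rabs (f (h n * RtoC y ^ n)%C))).
  apply Series_Rabs. apply (ex_series_le (K := R_AbsRing) (V := R_CompleteNormedModule) _ b); auto.
  intros n. unfold norm; simpl. unfold abs; simpl. rewrite Rabs_Rabsolu. apply Hn.
  apply Series_le; auto. }
assert (G1 := G Re re_le_Cmod). assert (G2 := G Im im_le_Cmod).
change (Rabs (Re (CPSeries h y)) <= Series b) in G1. change (Rabs (Im (CPSeries h y)) <= Series b) in G2. lra.
Qed.

Lemma jac_bound k p q : 0 < p -> exists M, 0 <= M /\ forall y, 0 < y < 1 -> Cmod (jac k p q y) <= M.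
Proof.
intros Hp.
destruct (CPSeries_finite_bound (hyp_coeff (- INR k) (RtoC (INR k + p + q - 1)) p) k) as [M HM].
- now apply subexp_hyp_coeff.
- intros n Hn. unfold hyp_coeff. 
  replace n with (S k + (n - S k))%nat by lia. rewrite pochhammer_add, pochhammer_S.
  replace (- RtoC (INR k) + RtoC (INR k))%C with (RtoC 0) by ring. unfold Cdiv. ring.
- assert (M0 : 0 <= M) by (apply Rle_trans with (2 := HM (1/2) ltac:(lra)); apply Cmod_ge_0).
  exists (Cmod (pochhammer (RtoC p) k / INR (fact k)) * M). split.
  apply Rmult_le_pos; auto. apply Cmod_ge_0.
  intros y Hy. unfold jac. rewrite Cmod_mult. apply Rmult_le_compat_l; auto. apply Cmod_ge_0.
Qed.

Lemma CPSeries_ext g h z : (forall n, g n = h n) -> CPSeries g z = CPSeries h z.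
Proof.
intros E. unfold CPSeries, CSeries. f_equal; apply Series_ext; intros n; now rewrite E.
Qed.

(** The derivative of the series [F(-k-1, k+p+q; p; y)] is a multiple of the
    series of [jac k (p + 1) (q + 1)], so this is the hypergeometric equation of
    [jac (S k) p q] divided by the nonzero product [A * B] of its parameters. *)
Lemma jac_raise k p q y : 0 < p -> 0 < q -> -1 < y < 1 ->
  ((RtoC p * (1 - RtoC y) - RtoC q * RtoC y) * jac k (p + 1) (q + 1) y + RtoC y * (1 - RtoC y) * jac1 k (p + 1) (q + 1) y
   = (RtoC (INR k) + 1) * jac (S k) p q y)%C.
Proof.
intros Hp Hq Hy. 
set (A := (- INR (S k))%C). set (B := RtoC (INR (S k) + p + q - 1)).
set (g := hyp_coeff A B p). set (f := hyp_coeff (- INR k) (RtoC (INR k + (p + 1) + (q + 1) - 1)) (p + 1)).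
assert (Sf : subexp f) by (apply subexp_hyp_coeff; lra). assert (Sf1 := subexp_CPderiv _ Sf).
assert (Np : RtoC p <> 0) by (apply RtoC_neq0; lra).
assert (Hk := pos_INR k).
assert (NA : A <> 0). { unfold A. rewrite <- RtoC_opp. apply RtoC_neq0. rewrite S_INR. lra. }
assert (NB : B <> 0). { unfold B. apply RtoC_neq0. rewrite S_INR. lra. }
assert (E1 : forall n, CPderiv g n = (A * B / RtoC p * f n)%C).
{ intros n. unfold g. rewrite hyp_coeff_deriv by auto. unfold f. do 2 f_equal.
  unfold A. rewrite RtoC_S. ring. unfold B. rewrite <- RtoC_plus, S_INR. f_equal. ring. }
assert (F1 : CPSeries (CPderiv g) y = (A * B / RtoC p * CPSeries f y)%C).
{ rewrite <- CPSeries_scal by auto. apply CPSeries_ext, E1. }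
assert (F2 : CPSeries (CPderiv (CPderiv g)) y = (A * B / RtoC p * CPSeries (CPderiv f) y)%C).
{ rewrite <- CPSeries_scal by auto. apply CPSeries_ext. intros n.
  change (CPderiv (CPderiv g) n) with (RtoC (INR (S n)) * CPderiv g (S n))%C. rewrite E1. unfold CPderiv. ring. }
assert (H := hyp_ode A B p y Hp Hy). cbv zeta in H. fold g in H. rewrite F1, F2 in H.
unfold jac, jac1. fold A B g. fold f.
replace (CPSeries g y) with (A * B * CPSeries g y / (A * B))%C by (field; auto). rewrite <- H.
rewrite (pochhammer_S_l _ k), fact_S_C, (RtoC_plus p 1).
replace (A + B + 1)%C with (RtoC p + RtoC q)%C.
2:{ unfold A, B. rewrite S_INR. push_RtoC. ring. }
field. repeat split; auto. apply fact_neq0. apply INR_S_neq0.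
Qed.

(** * The integrals of a Jacobi polynomial against [bern] *)

Lemma bern_bounded N b c : 0 < c -> exists M, forall y, 0 < y < 1 -> Cmod (bern N b c y) <= M.
Proof.
intros Hc. destruct (subexp_pochhammer b c Hc 2 ltac:(lra)) as [M [M0 HM]].
exists (M * 2 ^ N). intros y Hy. rewrite <- (Cmult_1_l (bern N b c y)).
apply bern_bound; auto; try lra. intros n. rewrite Cmult_1_l. auto.
Qed.

Lemma ex_Cderiv_bern N b c y : 0 < c -> exists l, Cderiv (bern N b c) y l.
Proof.
intros Hc. destruct N as [|N]. exists 0; apply Cderiv_bern_0. eexists. now apply Cderiv_bern_S.
Qed.

(** The primitive [- y^p (1-y)^q] times [jac k (p + 1) (q + 1)] times [bern] has
    [jac (S k) p q] in its derivative by the raising relation. *)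
Lemma jac_bern_parts k N p q b (b1 : R -> C) : 0 < p -> 0 < q ->
  (forall y, 0 < y < 1 -> Cderiv (bern N b p) y (b1 y)) -> (forall y, 0 < y < 1 -> Ccont b1 y) ->
  beta_integral p q (fun y => (RtoC (INR k) + 1) * (jac (S k) p q y * bern N b p y)
     + RtoC y * ((1 - RtoC y) * (jac k (p + 1) (q + 1) y * b1 y)))%C 0.
Proof.
intros Hp Hq Hb Hb1.
assert (Hp1 : 0 < p + 1) by lra.
destruct (jac_bound k (p + 1) (q + 1) Hp1) as [M1 [M10 HM1]].
destruct (bern_bounded N b p Hp) as [M2 HM2].
assert (Cont : forall f g y, Ccont f y -> Ccont g y -> Ccont (fun y => f y * g y)%C y).
{ intros f g y [F1 F2] [G1 G2]. split.
  apply (continuous_minus (fun y => Re (f y) * Re (g y)) (fun y => Im (f y) * Im (g y)));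
  [apply (continuous_mult (fun y => Re (f y)) (fun y => Re (g y)))|apply (continuous_mult (fun y => Im (f y)) (fun y => Im (g y)))]; auto.
  apply (continuous_plus (fun y => Re (f y) * Im (g y)) (fun y => Im (f y) * Re (g y)));
  [apply (continuous_mult (fun y => Re (f y)) (fun y => Im (g y)))|apply (continuous_mult (fun y => Im (f y)) (fun y => Re (g y)))]; auto. }
assert (H := beta_integral_parts p q (fun y => jac k (p + 1) (q + 1) y * bern N b p y)%C
  (fun y => jac1 k (p + 1) (q + 1) y * bern N b p y + jac k (p + 1) (q + 1) y * b1 y)%C (M1 * M2) Hp Hq).
eapply beta_integral_ext. 2: apply H.
- intros y Hy. cbv beta. rewrite (Cmult_assoc (RtoC (INR k) + 1)), <- jac_raise by (auto; lra). ring.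
- intros y Hy. apply Cderiv_mult; auto. apply Cderiv_jac; lra.
- intros y Hy.
  assert (C1 : Ccont (jac1 k (p + 1) (q + 1)) y) by (eapply Cderiv_cont; apply Cderiv_jac1; lra).
  assert (C2 : Ccont (jac k (p + 1) (q + 1)) y) by (eapply Cderiv_cont; apply Cderiv_jac; lra).
  assert (C3 : Ccont (bern N b p) y) by (eapply Cderiv_cont; now apply Hb).
  destruct (Cont _ _ y C1 C3) as [A1 A2]. destruct (Cont _ _ y C2 (Hb1 y Hy)) as [A3 A4]. split.
  apply (continuous_plus (fun y => Re (jac1 k (p + 1) (q + 1) y * bern N b p y)%C) _ _ A1 A3).
  apply (continuous_plus (fun y => Im (jac1 k (p + 1) (q + 1) y * bern N b p y)%C) _ _ A2 A4).
- intros y Hy. rewrite Cmod_mult. apply Rmult_le_compat; auto; apply Cmod_ge_0.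
Qed.

Lemma beta_integral_jac_bern_0 k p q b : 0 < p -> 0 < q ->
  beta_integral p q (fun y => jac (S k) p q y * bern 0 b p y)%C 0.
Proof.
intros Hp Hq.
assert (H := jac_bern_parts k 0 p q b (fun _ => RtoC 0) Hp Hq (fun y _ => Cderiv_bern_0 b p y)
  (fun y _ => Cderiv_cont _ _ _ (Cderiv_const 0 y))).
assert (H2 := beta_integral_scal _ _ (/ (RtoC (INR k) + 1)) _ _ H).
rewrite Cmult_0_r in H2. eapply beta_integral_ext. 2: exact H2.
intros y Hy. cbv beta. field. apply INR_S_neq0.
Qed.

(** Integration by parts moves the derivative onto [bern (S N)], whose
    derivative is a multiple of [bern N b (p + 1)]. *)
Lemma beta_integral_jac_bern_S k N p q b v : 0 < p -> 0 < q ->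
  beta_integral (p + 1) (q + 1) (fun y => jac k (p + 1) (q + 1) y * bern N b (p + 1) y)%C v ->
  beta_integral p q (fun y => jac (S k) p q y * bern (S N) b p y)%C
    ((RtoC (INR N) + 1) * (RtoC p - b) / (RtoC p * (RtoC (INR k) + 1)) * v)%C.
Proof.
intros Hp Hq Hv.
assert (Hp1 : 0 < p + 1) by lra.
set (kap := ((RtoC (INR N) + 1) * ((b - RtoC p) / RtoC p))%C).
assert (H := jac_bern_parts k (S N) p q b (fun y => kap * bern N b (p + 1) y)%C Hp Hq (fun y _ => Cderiv_bern_S N b p y Hp)).
assert (H1 : forall y, 0 < y < 1 -> Ccont (fun y => kap * bern N b (p + 1) y)%C y).
{ intros y Hy. destruct (ex_Cderiv_bern N b (p + 1) y Hp1) as [l Hl]. eapply Cderiv_cont. apply Cderiv_scal, Hl. }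
specialize (H H1).
assert (H2 := beta_integral_succ_l _ _ _ _ (beta_integral_succ_r _ _ _ _ (beta_integral_scal _ _ (- kap) _ _ Hv))).
assert (H3 := beta_integral_scal _ _ (/ (RtoC (INR k) + 1)) _ _ (beta_integral_plus _ _ _ _ _ _ H H2)).
assert (Np : RtoC p <> 0) by (apply RtoC_neq0; lra).
eapply beta_integral_eq. eapply beta_integral_ext. 2: exact H3.
- intros y Hy. cbv beta. field. apply INR_S_neq0.
- unfold kap. field. split; auto. apply INR_S_neq0.
Qed.

(** Orthogonality to polynomials of lower degree: [k] steps of integration by
    parts differentiate [bern N] to 0. *)
Lemma beta_integral_jac_bern_low k : forall N p q b, 0 < p -> 0 < q -> (N < k)%nat ->
  beta_integral p q (fun y => jac k p q y * bern N b p y)%C 0.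
Proof.
induction k as [|k IH]; intros N p q b Hp Hq HN. lia.
destruct N as [|N]. now apply beta_integral_jac_bern_0.
eapply beta_integral_eq. apply beta_integral_jac_bern_S; auto. apply IH; lra || lia. ring.
Qed.

(** After [k] integrations by parts the Jacobi polynomial is 1, the degree of
    [bern] is [N], and [p], [q] have grown by [k]. *)
Lemma beta_integral_jac_bern k : forall N p q b, 0 < p -> 0 < q ->
  beta_integral p q (fun y => jac k p q y * bern (k + N) b p y)%C
    (INR (fact (k + N)) / (INR (fact k) * INR (fact N)) * (pochhammer (RtoC p - b) k / pochhammer (RtoC p) k)
     * (RtoC (RBeta (p + INR k) (q + INR k))
        * (pochhammer (b + RtoC (q + INR k)) N / pochhammer (RtoC (p + q + 2 * INR k)) N)))%C.
Proof.
induction k as [|k IH]; intros N p q b Hp Hq.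
- eapply beta_integral_eq. eapply beta_integral_ext. 2: apply (beta_integral_bern N b p q Hp Hq).
  intros y Hy. rewrite jac_0 by lra. simpl. ring.
  simpl. replace (p + 0) with p by ring. replace (q + 0) with q by ring. replace (p + q + 2 * 0) with (p + q) by ring.
  field. split. apply pochhammer_neq0; lra. apply fact_neq0.
- eapply beta_integral_eq. apply (beta_integral_jac_bern_S k (k + N) p q b) with (3 := IH N (p + 1) (q + 1) b ltac:(lra) ltac:(lra)); auto.
  change (S k + N)%nat with (S (k + N)). rewrite !fact_S_C, !(pochhammer_S_l _ k).
  rewrite S_INR. replace (p + 1 + INR k) with (p + (INR k + 1)) by ring. replace (q + 1 + INR k) with (q + (INR k + 1)) by ring.
  replace (p + 1 + (q + 1) + 2 * INR k) with (p + q + 2 * (INR k + 1)) by ring.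
  replace (RtoC (p + 1) - b)%C with (RtoC p - b + 1)%C by (rewrite RtoC_plus; ring).
  assert (Hk := pos_INR k).
  assert (N1 := pochhammer_neq0 (p + q + 2 * (INR k + 1)) N ltac:(lra)). assert (N2 := pochhammer_neq0 (p + 1) k ltac:(lra)).
  assert (Np : RtoC p <> 0) by (apply RtoC_neq0; lra).
  rewrite (RtoC_plus p 1) in N2 |- *.
  field. repeat split; solve [auto | apply INR_S_neq0 | apply fact_neq0].
Qed.

(** * Termwise integration *)

Lemma is_series_geometric_tail (x : nat -> R) X M r : 0 <= M -> 0 <= r < 1 -> is_series x X ->
  (forall n, Rabs (x n) <= M * r ^ n) -> forall n, Rabs (X - sum_n x n) <= M / (1 - r) * r ^ n.
Proof.
intros HM Hr HX Hx n.
assert (HK : forall K, Rabs (sum_n x (K + n) - sum_n x n) <= M / (1 - r) * (r ^ n - r ^ (K + n))).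
{ induction K as [|K IH]. simpl. rewrite !Rminus_diag, Rabs_R0. lra.
  change (S K + n)%nat with (S (K + n)). rewrite sum_n_S.
  replace (sum_n x (K + n) + x (S (K + n)) - sum_n x n) with ((sum_n x (K + n) - sum_n x n) + x (S (K + n))) by Rring.
  apply Rle_trans with (1 := Rabs_triang _ _).
  apply Rle_trans with (M / (1 - r) * (r ^ n - r ^ (K + n)) + M * r ^ (S (K + n))). apply Rplus_le_compat; auto.
  assert (P : 0 <= r ^ (K + n)) by (apply pow_le; lra). simpl pow.
  replace (M / (1 - r) * (r ^ n - r ^ (K + n)) + M * (r * r ^ (K + n))) with
    (M / (1 - r) * (r ^ n - r * r ^ (K + n)) - (M * r ^ (K + n) * (1 - r))) by (field; lra).
  assert (0 <= M * r ^ (K + n) * (1 - r)) by (repeat apply Rmult_le_pos; lra). lra. }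
assert (L : is_lim_seq (fun K => Rabs (sum_n x (K + n) - sum_n x n)) (Rabs (X - sum_n x n))).
{ apply (is_lim_seq_abs _ (Finite _)). apply is_lim_seq_minus'. 
  apply (is_lim_seq_incr_n (sum_n x) n). apply is_series_lim, HX. apply is_lim_seq_const. }
apply (is_lim_seq_le _ _ _ _) with (2 := L) (3 := is_lim_seq_const (M / (1 - r) * r ^ n)).
intros K. apply Rle_trans with (1 := HK K). apply Rmult_le_compat_l. apply Rdiv_le_0_compat; lra.
assert (P : 0 <= r ^ (K + n)) by (apply pow_le; lra). lra.
Qed.

Lemma beta_integral_series p q (u : nat -> R -> C) (v : nat -> C) (G : R -> C) V M r : 0 < p -> 0 < q ->
  0 <= M -> 0 <= r < 1 ->
  (forall N, beta_integral p q (u N) (v N)) -> (forall N y, 0 < y < 1 -> Ccont (u N) y) ->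
  (forall N y, 0 < y < 1 -> Cmod (u N y) <= M * r ^ N) ->
  (forall y, 0 < y < 1 -> is_Cseries (fun N => u N y) (G y)) -> is_Cseries v V ->
  beta_integral p q G V.
Proof.
intros Hp Hq HM Hr Hint Hcont Hb HG [HV1 HV2].
assert (P1 := ends_Fa _ _ _ ends_m1_1). assert (P2 := ends_Fb _ _ _ ends_m1_1).
assert (Key : forall (f : C -> R) (l : R), (forall c, Rabs (f c) <= Cmod c) ->
  (forall N, is_RInt_gen (fun x => beta_weight p q x * f (u N ((1 - x) / 2))) (at_right (-1)) (at_left 1) (f (v N))) ->
  (forall N y, 0 < y < 1 -> continuous (fun y => f (u N y)) y) ->
  (forall y, 0 < y < 1 -> is_series (fun N => f (u N y)) (f (G y))) ->
  is_series (fun N => f (v N)) l ->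
  is_RInt_gen (fun x => beta_weight p q x * f (G ((1 - x) / 2))) (at_right (-1)) (at_left 1) l).
{ intros f l Hf I1 C1 S1 S2.
  assert (Hc : forall N x, -1 < x < 1 -> continuous (fun x => f (u N ((1 - x) / 2))) x).
  { intros N x Hx. apply (continuous_comp (fun x => (1 - x) / 2) (fun y => f (u N y))).
    apply (ex_derive_continuous (fun x => (1 - x) / 2)). now auto_derive. apply C1; lra. }
  apply (is_RInt_gen_uniform_limit _ _ _ ends_m1_1 (beta_weight p q) (fun x => f (G ((1 - x) / 2)))
    (fun n x => sum_n (fun N => f (u N ((1 - x) / 2))) n) (fun n => M / (1 - r) * r ^ n)
    (fun n => sum_n (fun N => f (v N)) n) (RBeta p q) l).
  - intros. apply Rlt_le, beta_weight_pos.
  - intros. now apply continuous_beta_weight.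
  - now apply is_RBeta.
  - induction n as [|n IH]; intros x Hx.
    + apply continuous_ext with (fun x => f (u 0%nat ((1 - x) / 2))). intros; now rewrite sum_n_0. auto.
    + apply continuous_ext with (fun x => sum_n (fun N => f (u N ((1 - x) / 2))) n + f (u (S n) ((1 - x) / 2))).
      intros; now rewrite sum_n_S. 
      apply (continuous_plus (fun x => sum_n (fun N => f (u N ((1 - x) / 2))) n) (fun x => f (u (S n) ((1 - x) / 2)))); auto.
  - induction n as [|n IH].
    + rewrite sum_n_0. apply (is_RInt_gen_ext_ends _ _ _ _ ends_m1_1) with (2 := I1 O). intros; now rewrite sum_n_0.
    + rewrite sum_n_S. apply (is_RInt_gen_ext_ends _ _ _ _ ends_m1_1) with (2 := is_RInt_gen_plus _ _ _ _ IH (I1 (S n))).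
      intros x Hx. rewrite sum_n_S. unfold plus; simpl. Rring.
  - intros n x Hx. apply is_series_geometric_tail; auto. apply S1; lra.
    intros N. apply Rle_trans with (1 := Hf _). apply Hb; lra.
  - replace (Finite 0) with (Rbar_mult (M / (1 - r)) 0) by (simpl; f_equal; ring).
    apply is_lim_seq_scal_l. apply is_lim_seq_geom. rewrite Rabs_pos_eq; lra.
  - apply is_series_lim, S2. }
split.
- apply (Key Re); auto. apply re_le_Cmod. intros N; apply (Hint N). intros N y Hy; apply (Hcont N y Hy). intros y Hy; apply (HG y Hy).
- apply (Key Im); auto. apply im_le_Cmod. intros N; apply (Hint N). intros N y Hy; apply (Hcont N y Hy). intros y Hy; apply (HG y Hy).
Qed.

Lemma is_Cseries_incr_n (v : nat -> C) k V : (forall n, (n < k)%nat -> v n = 0) ->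
  is_Cseries (fun n => v (k + n)%nat) V -> is_Cseries v V.
Proof.
revert v. induction k as [|k IH]; intros v Hv H. exact H.
assert (H1 : is_Cseries (fun n => v (S n)) V).
{ apply IH. intros n Hn. apply Hv; lia. exact H. }
assert (H0 := Hv O ltac:(lia)). split.
- apply is_series_decr_1. evar_last. apply H1. rewrite H0. unfold plus, opp; simpl. ring.
- apply is_series_decr_1. evar_last. apply H1. rewrite H0. unfold plus, opp; simpl. ring.
Qed.

(** Only the degrees [N >= k] contribute, and their contributions are again the
    terms of a hypergeometric series in [zeta]. *)
Lemma beta_integral_jac_generating k p q a b zeta : 0 < p -> 0 < q -> 0 < zeta < 1 ->
  beta_integral p q
    (fun y => jac k p q y * (cpow (1 - zeta * (1 - y)) (- a) * CPSeries (hyp_coeff a b p) (zeta * y / (1 - zeta * (1 - y)))))%C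
    (pochhammer a k * pochhammer (RtoC p - b) k / (pochhammer (RtoC p) k * INR (fact k)) * RtoC (zeta ^ k)
     * (RtoC (RBeta (p + INR k) (q + INR k))
        * CPSeries (hyp_coeff (a + INR k) (b + RtoC (q + INR k)) (p + q + 2 * INR k)) zeta))%C.
Proof.
intros Hp Hq Hz.
assert (Hk := pos_INR k).
destruct (exists_square_margin zeta Hz) as [s [Hs Hs2]].
destruct (subexp_binom a s Hs) as [M1 [M10 HM1]].
destruct (subexp_pochhammer b p Hp s Hs) as [M2 [M20 HM2]].
destruct (jac_bound k p q Hp) as [M3 [M30 HM3]].
assert (S0 : forall n, 0 <= s ^ n) by (intros; apply pow_le; lra).
set (w := fun N => if (N <? k)%nat then RtoC 0 else
  (INR (fact N) / (INR (fact k) * INR (fact (N - k))) * (pochhammer (RtoC p - b) k / pochhammer (RtoC p) k)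
     * (RtoC (RBeta (p + INR k) (q + INR k))
        * (pochhammer (b + RtoC (q + INR k)) (N - k) / pochhammer (RtoC (p + q + 2 * INR k)) (N - k))))%C).
apply (beta_integral_series p q (fun N y => jac k p q y * (binom_coeff a N * RtoC (zeta ^ N) * bern N b p y))%C
  (fun N => binom_coeff a N * RtoC (zeta ^ N) * w N)%C _ _ (M3 * (M1 * M2)) (s * s * zeta)); auto.
- repeat apply Rmult_le_pos; auto.
- intros N. apply beta_integral_ext with (fun y => (binom_coeff a N * RtoC (zeta ^ N)) * (jac k p q y * bern N b p y))%C.
  intros; ring. apply beta_integral_scal. unfold w. destruct (Nat.ltb_spec N k) as [H|H].
  now apply beta_integral_jac_bern_low. 
  assert (HB := beta_integral_jac_bern k (N - k) p q b Hp Hq).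
  replace (k + (N - k))%nat with N in HB by lia. exact HB.
- intros N y Hy. destruct (ex_Cderiv_bern N b p y Hp) as [l Hl]. eapply Cderiv_cont.
  apply Cderiv_mult. apply Cderiv_jac; auto; lra. apply Cderiv_scal. exact Hl.
- intros N y Hy. rewrite !Cmod_mult, Cmod_R. 
  assert (Z0 : 0 <= zeta ^ N) by (apply pow_le; lra). rewrite (Rabs_pos_eq _ Z0).
  assert (HB : Cmod (bern N b p y) <= M2 * s ^ N).
  { rewrite <- (Cmult_1_l (bern N b p y)). apply bern_bound; auto; try lra. intros n. rewrite Cmult_1_l. apply HM2. }
  rewrite !Rpow_mult_distr.
  replace (M3 * (M1 * M2) * (s ^ N * s ^ N * zeta ^ N)) with (M3 * ((M1 * s ^ N) * zeta ^ N * (M2 * s ^ N))) by ring.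
  apply Rmult_le_compat; auto; try apply Cmod_ge_0. repeat apply Rmult_le_pos; auto; apply Cmod_ge_0.
  apply Rmult_le_compat; auto; try apply Cmod_ge_0. repeat apply Rmult_le_pos; auto; apply Cmod_ge_0.
  apply Rmult_le_compat_r; auto. apply HM1.
- intros y Hy. apply is_Cseries_scal. apply bern_generating; auto; lra.
- apply (is_Cseries_incr_n _ k).
  + intros n Hn. unfold w. rewrite (proj2 (Nat.ltb_lt n k) Hn). ring.
  + assert (Sh : subexp (hyp_coeff (a + INR k) (b + RtoC (q + INR k)) (p + q + 2 * INR k))) by (apply subexp_hyp_coeff; lra).
    assert (H := is_Cseries_scal (RtoC (RBeta (p + INR k) (q + INR k))) _ _ (is_CPSeries _ zeta Sh ltac:(lra))).
    assert (H2 := is_Cseries_scal (pochhammer a k * pochhammer (RtoC p - b) k / (pochhammer (RtoC p) k * INR (fact k)) * RtoC (zeta ^ k))%C _ _ H).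
    apply is_Cseries_ext with (2 := H2). intros N. unfold w.
    destruct (Nat.ltb_spec (k + N) k) as [Hlt|_]; [lia|].
    replace (k + N - k)%nat with N by lia. unfold binom_coeff, hyp_coeff.
    rewrite pochhammer_add, pow_add, RtoC_mult, !RtoC_pow. 
    field. repeat split; try apply fact_neq0; apply pochhammer_neq0; lra.
Qed.

(** * Gamma and Ferrers functions *)

Lemma is_RInt_gen_C D Fa Fb (I : integration_ends D Fa Fb) (f : R -> C) (l : C) :
  is_RInt_gen (fun x => Re (f x)) Fa Fb (Re l) -> is_RInt_gen (fun x => Im (f x)) Fa Fb (Im l) ->
  is_RInt_gen (V := C_R_NormedModule) f Fa Fb l.
Proof.
intros H1 H2 P [e He]. assert (P1 := ends_Fa _ _ _ I). assert (P2 := ends_Fb _ _ _ I).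
assert (L : forall x : R, locally x (ball x e)) by (intros x; exists e; auto).
specialize (H1 _ (L _)). specialize (H2 _ (L _)). unfold filtermapi in *.
generalize (filter_and _ _ H1 H2). apply filter_imp. intros [a b] [[y1 [A1 B1]] [y2 [A2 B2]]].
exists (y1, y2). split.
- apply (is_RInt_fct_extend_pair f). exact A1. exact A2.
- apply He. split; [exact B1|exact B2].
Qed.

Lemma Gamma_Euler_RGamma s : 0 < s -> Gamma_Euler (RtoC s) = RtoC (RGamma s).
Proof.
intros Hs. unfold Gamma_Euler. assert (P1 := ends_Fa _ _ _ ends_half_line). assert (P2 := ends_Fb _ _ _ ends_half_line).
apply (is_RInt_gen_unique (V := C_R_CompleteNormedModule) _ (RtoC (RGamma s))).
assert (E : forall t, (cpow t (RtoC s - 1) * RtoC (exp (- t)))%C = RtoC (gamma_weight s t)).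
{ intros t. unfold gamma_weight. rewrite <- RtoC_minus, cpow_RtoC, RtoC_mult. reflexivity. }
assert (H := is_RGamma s Hs).
apply (is_RInt_gen_C _ _ _ ends_half_line).
- apply (is_RInt_gen_ext_ends _ _ _ _ ends_half_line) with (2 := H). intros t Ht. rewrite E. reflexivity.
- assert (H0 := is_RInt_gen_scal _ 0 _ H). unfold scal in H0 at 2; simpl in H0; unfold mult in H0; simpl in H0.
  rewrite Rmult_0_l in H0.
  apply (is_RInt_gen_ext_ends _ _ _ _ ends_half_line) with (2 := H0). intros t Ht. rewrite E. 
  unfold scal; simpl. unfold mult; simpl. ring.
Qed.

(** For [s > 0] the continuation of Euler's integral uses no shift, since
    [up (- s) <= 0]. *)
Lemma Gamma_RGamma s : 0 < s -> Gamma (RtoC s) = RtoC (RGamma s).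
Proof.
intros Hs. unfold Gamma. rewrite re_RtoC.
replace (Z.to_nat (up (- s))) with O.
- simpl. rewrite Cplus_0_r, Gamma_Euler_RGamma by auto. field.
- destruct (archimed (- s)) as [_ H]. assert (IZR (up (- s)) < 1) by lra. apply lt_IZR in H0.
  lia.
Qed.

Lemma RGamma_pochhammer s k : 0 < s -> RtoC (RGamma (s + INR k)) = (pochhammer (RtoC s) k * RtoC (RGamma s))%C.
Proof.
intros Hs. induction k as [|k IH]. simpl. rewrite Rplus_0_r. ring.
assert (Hk := pos_INR k).
rewrite S_INR, <- Rplus_assoc, RGamma_succ, RtoC_mult, IH, pochhammer_S, RtoC_plus by lra. ring.
Qed.

Lemma RtoC_Rpower x p : RtoC (Rpower x p) = Cexp (RtoC p * RtoC (ln x)).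
Proof. now rewrite <- cpow_RtoC. Qed.

Lemma RtoC_half x : RtoC (x / 2) = (RtoC x / 2)%C.
Proof. apply RtoC_div. lra. Qed.

(** The quadratic transformation exposes the dependence on [t^2] only; this is
    what makes [dist x] enter through its square. *)
Lemma ferrersP_quadratic (nu : C) (c t : R) : 0 < c -> 0 < t < 1 ->
  ferrersP nu (RtoC (1 - c)) t =
   (/ RtoC (RGamma c) * RtoC (Rpower (1 - t ^ 2) ((c - 1) / 2) * Rpower 2 (1 - c))
    * CPSeries (hyp_coeff ((RtoC c + nu) / 2) ((RtoC c - nu - 1) / 2) c) (1 - t ^ 2))%C.
Proof.
intros Hc Ht. unfold ferrersP.
replace (1 - RtoC (1 - c))%C with (RtoC c) by (rewrite RtoC_minus; ring).
replace ((1 - RtoC t) / 2)%C with (RtoC ((1 - t) / 2)) by (rewrite RtoC_half, RtoC_minus; reflexivity).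
rewrite hyp2F1_CPSeries, quadratic_transformation, Gamma_RGamma by auto.
rewrite <- !Cmult_assoc. f_equal. rewrite !Cmult_assoc. f_equal.
rewrite RtoC_mult, !RtoC_Rpower. unfold cpow. rewrite <- !Cexp_plus. f_equal.
replace (1 - t ^ 2) with ((1 + t) * (1 - t)) by ring.
unfold Rdiv. rewrite !ln_mult, !ln_Rinv by (try apply Rinv_0_lt_compat; lra).
change (?x * / 2) with (x / 2). rewrite RtoC_half. push_RtoC. field.
Qed.

Lemma jacobi_jac k (alpha gamma x : R) :
  jacobi k alpha gamma x = jac k (alpha + 1) (gamma + 1) ((1 - x) / 2).
Proof.
unfold jacobi, jac. 
replace ((1 - RtoC x) / 2)%C with (RtoC ((1 - x) / 2)) by (rewrite RtoC_half, RtoC_minus; reflexivity).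
replace (INR k + RtoC alpha + RtoC gamma + 1)%C with (RtoC (INR k + (alpha + 1) + (gamma + 1) - 1)) by (push_RtoC; ring).
rewrite <- RtoC_plus. reflexivity.
Qed.

Theorem corollary16 (k : nat) (beta : C) (alpha gamma rho : R)
    (Halpha : -1 < alpha) (Hgamma : -1 < gamma)
    (Hsum : -1 < alpha < 0 -> -1 < gamma < 0 -> alpha + gamma + 1 <> 0)
    (Hrho : 0 < rho < 1) :
  let dist (x : R) : R := sqrt (1 + rho ^ 2 - 2 * rho * x) in
  is_RInt_gen (V := C_R_NormedModule)
    (fun x : R =>
       ((Rpower (1 - x) (alpha / 2) * Rpower (1 + x) gamma)%R
        / cpow (dist x) (beta + 1)
        * ferrersP beta (- alpha) ((1 - rho) / dist x)%R
        * jacobi k alpha gamma x)%C)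
    (at_right (-1)) (at_left 1)
    (Rpower 2 (gamma + alpha / 2 + 1)
     * Gamma (gamma + INR k + 1)
     * pochhammer (alpha + beta + 1) (2 * k)
     / (cpow (1 + rho) (beta - gamma) * Rpower rho ((gamma + 1) / 2) * INR (fact k))
     * ferrersP (gamma - beta) (- gamma - alpha - 2 * INR k - 1)
         ((1 - rho) / (1 + rho)))%C.
Proof.
intros dist.
set (p := alpha + 1). set (q := gamma + 1).
assert (Hp : 0 < p) by (unfold p; lra). assert (Hq : 0 < q) by (unfold q; lra).
assert (Hk := pos_INR k).
set (zeta := 4 * rho / (1 + rho) ^ 2).
assert (Hr2 : 0 < (1 + rho) ^ 2) by (apply pow_lt; lra).
assert (Hz : 0 < zeta < 1).
{ unfold zeta. split. apply Rdiv_lt_0_compat; lra. apply Rlt_div_l; auto. nra. }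
set (a := ((RtoC p + beta) / 2)%C). set (b := ((RtoC p - beta - 1) / 2)%C).
set (c' := p + q + 2 * INR k).
assert (Gp := RGamma_pos p Hp).
set (K0 := (/ RtoC (RGamma p) * RtoC (Rpower 2 q * Rpower (2 * rho) (alpha / 2)) * cpow (1 + rho) (- (RtoC p + beta)))%C).
assert (H := beta_integral_scal _ _ K0 _ _ (beta_integral_jac_generating k p q a b zeta Hp Hq Hz)).
(* the elementary factors, compared through the logarithms of 2, rho, 1 + rho, 1 - x, 1 + x and [m] *)
assert (Hpow : forall x, -1 < x < 1 ->
   let y := (1 - x) / 2 in let t := (1 - rho) / dist x in
   0 < t < 1 /\ 1 - t ^ 2 = zeta * y / (1 - zeta * (1 - y)) /\
   (RtoC (Rpower (1 - x) (alpha / 2) * Rpower (1 + x) gamma) / cpow (dist x) (beta + 1)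
     * RtoC (Rpower (1 - t ^ 2) ((p - 1) / 2) * Rpower 2 (1 - p))
    = RtoC (beta_weight p q x) * (RtoC (Rpower 2 q * Rpower (2 * rho) (alpha / 2)) * cpow (1 + rho) (- (RtoC p + beta))
       * cpow (1 - zeta * (1 - y)) (- a)))%C).
{ intros x Hx y t.
  set (r2 := 1 + rho ^ 2 - 2 * rho * x).
  set (m := 1 - zeta * (1 - y)).
  assert (Hm : r2 = (1 + rho) ^ 2 * m).
  { unfold r2, m, zeta, y. field. lra. }
  assert (Hr2' : (1 - rho) ^ 2 < r2) by (unfold r2; nra).
  assert (Hr20 : 0 < r2) by nra.
  assert (Hm0 : 0 < m). { apply Rmult_lt_reg_l with ((1 + rho) ^ 2); auto. rewrite <- Hm. lra. }
  assert (Hd : 0 < dist x) by (apply sqrt_lt_R0; auto).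
  assert (Hdd : dist x ^ 2 = r2) by (unfold dist; apply pow2_sqrt; fold r2; lra).
  assert (Ht2 : 1 - t ^ 2 = 2 * rho * (1 - x) / r2).
  { unfold t. rewrite <- Hdd. unfold Rdiv at 1. rewrite Rpow_mult_distr, pow_inv.
    replace ((1 - rho) ^ 2) with (dist x ^ 2 - 2 * rho * (1 - x)) by (rewrite Hdd; unfold r2; ring).
    field. lra. }
  split; [|split].
  - unfold t. split. apply Rdiv_lt_0_compat; lra. apply Rlt_div_l; auto. nra.
  - rewrite Ht2, Hm. fold m. clearbody m. unfold zeta, y. field. split; lra.
  - rewrite Ht2, Hm. unfold beta_weight, dist. fold r2 m. clearbody m.
    rewrite cpow_sqrt by auto. unfold Cdiv at 1. rewrite <- cpow_opp, Hm.
    replace (Rpower ((1 - x) / 2) (p - 1) * Rpower ((1 + x) / 2) (q - 1) / 2) with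
      (Rpower ((1 - x) / 2) (p - 1) * Rpower ((1 + x) / 2) (q - 1) * Rpower 2 (- 1)).
    2:{ replace (-1) with (- (1)) by ring. rewrite Rpower_Ropp, Rpower_1 by lra. reflexivity. }
    rewrite !RtoC_mult, !RtoC_Rpower. unfold cpow. rewrite <- !Cexp_plus. f_equal.
    assert (Hdiv : forall u v, 0 < u -> 0 < v -> ln (u / v) = ln u - ln v).
    { intros u v Hu Hv. unfold Rdiv. rewrite ln_mult, ln_Rinv; auto. now apply Rinv_0_lt_compat. }
    assert (L2 : ln ((1 + rho) ^ 2 * m) = 2 * ln (1 + rho) + ln m).
    { rewrite ln_mult, ln_pow by (auto; lra). simpl; ring. }
    assert (L5 : ln (2 * rho) = ln 2 + ln rho) by (apply ln_mult; lra).
    rewrite (Hdiv (2 * rho * (1 - x))) by (repeat apply Rmult_lt_0_compat; auto; lra).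
    rewrite (Hdiv (1 - x)), (Hdiv (1 + x)), (ln_mult (2 * rho)), L2, L5 by lra.
    unfold a, p, q. rewrite !RtoC_half. push_RtoC. rewrite ?RtoC_half. push_RtoC. field. }
assert (Hc' : 0 < c') by (unfold c'; lra).
assert (F : forall x, -1 < x < 1 ->
  ((Rpower (1 - x) (alpha / 2) * Rpower (1 + x) gamma)%R / cpow (dist x) (beta + 1)
        * ferrersP beta (- alpha) ((1 - rho) / dist x)%R * jacobi k alpha gamma x)%C
  = (RtoC (beta_weight p q x) * (K0 * (jac k p q ((1 - x) / 2) * (cpow (1 - zeta * (1 - (1 - x) / 2)) (- a)
     * CPSeries (hyp_coeff a b p) (zeta * ((1 - x) / 2) / (1 - zeta * (1 - (1 - x) / 2)))))))%C).
{ intros x Hx. destruct (Hpow x Hx) as [Ht [Ht2 E]].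
  replace (- RtoC alpha)%C with (RtoC (1 - p)) by (unfold p; push_RtoC; ring).
  rewrite ferrersP_quadratic by auto. rewrite jacobi_jac. fold p q a b.
  rewrite <- Ht2. set (Ph := CPSeries _ (1 - _)). unfold K0.
  transitivity ((RtoC (Rpower (1 - x) (alpha / 2) * Rpower (1 + x) gamma) / cpow (dist x) (beta + 1)
     * RtoC (Rpower (1 - ((1 - rho) / dist x) ^ 2) ((p - 1) / 2) * Rpower 2 (1 - p)))
     * (/ RtoC (RGamma p) * Ph * jac k p q ((1 - x) / 2)))%C.
  - unfold Cdiv. ring.
  - rewrite E. ring. }
assert (V : forall v, beta_integral p q (fun y => K0 * (jac k p q y * (cpow (1 - zeta * (1 - y)) (- a)
     * CPSeries (hyp_coeff a b p) (zeta * y / (1 - zeta * (1 - y))))))%C v ->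
   is_RInt_gen (V := C_R_NormedModule) (fun x => RtoC (beta_weight p q x) * (K0 * (jac k p q ((1 - x) / 2) * (cpow (1 - zeta * (1 - (1 - x) / 2)) (- a)
     * CPSeries (hyp_coeff a b p) (zeta * ((1 - x) / 2) / (1 - zeta * (1 - (1 - x) / 2)))))))%C (at_right (-1)) (at_left 1) v).
{ intros v [V1 V2]. apply (is_RInt_gen_C _ _ _ ends_m1_1).
  - apply (is_RInt_gen_ext_ends _ _ _ _ ends_m1_1) with (2 := V1). intros x Hx. now rewrite re_scal_l.
  - apply (is_RInt_gen_ext_ends _ _ _ _ ends_m1_1) with (2 := V2). intros x Hx. now rewrite im_scal_l. }
apply (is_RInt_gen_ext_ends _ _ _ _ ends_m1_1) with (1 := fun x Hx => eq_sym (F x Hx)).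
apply V. eapply beta_integral_eq. exact H. clear V F Hpow H.
assert (Hrt : 0 < (1 - rho) / (1 + rho) < 1).
{ split. apply Rdiv_lt_0_compat; lra. apply Rlt_div_l; lra. }
assert (Ez : 1 - ((1 - rho) / (1 + rho)) ^ 2 = zeta) by (unfold zeta; field; lra).
replace (- RtoC gamma - alpha - 2 * INR k - 1)%C with (RtoC (1 - c')) by (unfold c', p, q; push_RtoC; ring).
rewrite ferrersP_quadratic, Ez by auto.
replace (RtoC gamma + INR k + 1)%C with (RtoC (q + INR k)) by (unfold q; push_RtoC; ring).
rewrite Gamma_RGamma by lra.
(* the numerator parameters agree up to their order *)
assert (EF : CPSeries (hyp_coeff (a + INR k) (b + RtoC (q + INR k)) c') zeta
  = CPSeries (hyp_coeff ((RtoC c' + (RtoC gamma - beta)) / 2) ((RtoC c' - (RtoC gamma - beta) - 1) / 2) c') zeta).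
{ apply CPSeries_ext. intros n. unfold hyp_coeff.
  replace ((RtoC c' + (RtoC gamma - beta)) / 2)%C with (b + RtoC (q + INR k))%C by (unfold b, c', p, q; push_RtoC; field).
  replace ((RtoC c' - (RtoC gamma - beta) - 1) / 2)%C with (a + INR k)%C by (unfold a, c', p, q; push_RtoC; field).
  unfold Cdiv. ring. }
fold c'. rewrite <- EF. set (Ph := CPSeries _ zeta).
(* [alpha + beta + 1 = 2 a] and [p - b = a + 1/2] *)
assert (EP : pochhammer (RtoC alpha + beta + 1) (2 * k) = (4 ^ k * pochhammer a k * pochhammer (RtoC p - b) k)%C).
{ replace (RtoC alpha + beta + 1)%C with (2 * a)%C by (unfold a, p; push_RtoC; field).
  rewrite pochhammer_double. f_equal. f_equal. unfold a, b. field. }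
rewrite EP.
assert (Gc : RGamma c' <> 0) by (assert (X := RGamma_pos c' Hc'); lra).
assert (EB : RtoC (RBeta (p + INR k) (q + INR k)) = (pochhammer (RtoC p) k * RtoC (RGamma p) * RtoC (RGamma (q + INR k)) / RtoC (RGamma c'))%C).
{ assert (X := RBeta_RGamma (p + INR k) (q + INR k) ltac:(lra) ltac:(lra)).
  replace (p + INR k + (q + INR k)) with c' in X by (unfold c'; ring).
  rewrite <- RGamma_pochhammer by auto. rewrite <- RtoC_mult, <- X, <- RtoC_div by auto. f_equal. field. auto. }
rewrite EB. unfold K0.
assert (Epow : (RtoC (Rpower 2 q * Rpower (2 * rho) (alpha / 2)) * cpow (1 + rho) (- (RtoC p + beta)) * RtoC (zeta ^ k)
  = RtoC (Rpower 2 (gamma + alpha / 2 + 1)) * 4 ^ k / (cpow (1 + rho) (beta - gamma) * RtoC (Rpower rho (q / 2)))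
     * RtoC (Rpower zeta ((c' - 1) / 2) * Rpower 2 (1 - c')))%C).
{ replace ((4 ^ k)%C) with (RtoC (Rpower 4 (INR k))) by (rewrite Rpower_pow, RtoC_pow by lra; reflexivity).
  rewrite <- (Rpower_pow k zeta) by lra.
  assert (Nr : RtoC (Rpower rho (q / 2)) <> 0) by (apply RtoC_neq0, Rgt_not_eq, Rpower_pos).
  replace (RtoC (Rpower 2 (gamma + alpha / 2 + 1)) * RtoC (Rpower 4 (INR k)) / (cpow (1 + rho) (beta - gamma) * RtoC (Rpower rho (q / 2))))%C
   with (RtoC (Rpower 2 (gamma + alpha / 2 + 1)) * RtoC (Rpower 4 (INR k)) * (/ cpow (1 + rho) (beta - gamma) * / RtoC (Rpower rho (q / 2))))%C
   by (field; split; auto using cpow_neq0).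
  rewrite <- cpow_opp.
  rewrite <- RtoC_inv by (assert (X := Rpower_pos rho (q / 2)); lra). rewrite <- Rpower_Ropp.
  rewrite !RtoC_mult, !RtoC_Rpower. unfold cpow. rewrite <- !Cexp_plus. f_equal.
  assert (L5 : ln (2 * rho) = ln 2 + ln rho) by (apply ln_mult; lra).
  assert (L4 : ln 4 = 2 * ln 2) by (replace 4 with (2 * 2) by ring; rewrite ln_mult by lra; ring).
  assert (Lz : ln zeta = 2 * ln 2 + ln rho - 2 * ln (1 + rho)).
  { unfold zeta, Rdiv. rewrite ln_mult, ln_Rinv, ln_mult, ln_pow, L4; try lra. simpl; ring. now apply Rinv_0_lt_compat. }
  rewrite L5, L4, Lz. unfold c', p, q. push_RtoC. rewrite ?RtoC_half. push_RtoC. field. }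
transitivity ((RtoC (Rpower 2 q * Rpower (2 * rho) (alpha / 2)) * cpow (1 + rho) (- (RtoC p + beta)) * RtoC (zeta ^ k))
  * (pochhammer a k * pochhammer (RtoC p - b) k * RtoC (RGamma (q + INR k)) / (RtoC (RGamma c') * INR (fact k)) * Ph))%C.
- field. repeat split; try apply fact_neq0; try (apply RtoC_neq0; lra). apply pochhammer_neq0; lra.
- rewrite Epow. field. repeat split; try apply fact_neq0; try (apply RtoC_neq0; auto). apply Rgt_not_eq, Rpower_pos. apply cpow_neq0.
Qed.
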